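(* Let $X_\epsilon$ be the perturbed Duffing oscillator $\dot x=H_y+\epsilon f(x,y,\epsilon)$, $\dot y=-H_x+\epsilon g(x,y,\epsilon)$, $H=\frac{y^2}{2}-\frac{x^2}{2}+\frac{x^4}{4}$, with $f,g$ cubic polynomials in $(x,y)$ with real coefficients depending analytically on $\epsilon$. Let $$M_1(h)=(c_0+c_1h)I_0(h)+\alpha_1I_1(h)+c_2I_2(h)$$ be its first Melnikov function associated with an interior period annulus, with real constants $c_0,c_1,c_2,\alpha_1$ as in the context, and suppose that $M_1$ is not identically zero. Then the analytic continuation of $M_1$ has at most three zeros in the complex domain $\mathcal{D}=\mathbb{C}\setminus[0,+\infty)$.
   Context: Interior period annulus: one of the two families of ovals $\gamma(h)\subset\{H=h\}$, $h\in(-\frac14,0)$, lying in $x>0$ or in $x<0$, oriented by the flow of $X_0$. Set $I_i(h)=\oint_{\gamma(h)}x^iy\,dx$. The functions $I_i$ extend to single-valued analytic functions on $\mathcal{D}=\mathbb{C}\setminus[0,+\infty)$. The first Melnikov function is the coefficient of $\epsilon$ in the displacement map $P(h,\epsilon)-h=\epsilon M_1(h)+\epsilon^2M_2(h)+\cdots$, where $P$ is the first return map of $X_\epsilon$ on a cross-section parameterized by $h=H$; equivalently $M_1(h)=\oint_{\gamma(h)}g(x,y,0)dx-f(x,y,0)dy$. With $$f(x,y,0)=\lambda_{0,1}+\lambda_{1,1}x+\lambda_{2,1}y+\lambda_{3,1}xy+\lambda_{4,1}x^2+\lambda_{5,1}y^2+\lambda_{6,1}x^2y+\lambda_{7,1}xy^2+\lambda_{8,1}x^3+\lambda_{9,1}y^3,$$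 $$g(x,y,0)=\gamma_{0,1}+\gamma_{1,1}x+\gamma_{2,1}y+\gamma_{3,1}xy+\gamma_{4,1}x^2+\gamma_{5,1}y^2+\gamma_{6,1}x^2y+\gamma_{7,1}xy^2+\gamma_{8,1}x^3+\gamma_{9,1}y^3,$$ the constants are $c_0=\lambda_{1,1}+\gamma_{2,1}$, $c_1=\frac47(\lambda_{7,1}+3\gamma_{9,1})$, $\alpha_1=2\lambda_{4,1}+\gamma_{3,1}$, $c_2=\gamma_{6,1}+3\lambda_{8,1}+\frac17\lambda_{7,1}+\frac37\gamma_{9,1}$.
   Formalization: The bound as stated fails: M_1 always vanishes at h=-1/4, which lies in D, and three more zeros can be prescribed in (-1/4,0). The theorem proved says M_1 has at most three zeros in D, counted with multiplicity, besides one zero at h=-1/4. *)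

(* Defs.v *)
(* Stdlib reals and Coquelicot. *)
From Stdlib Require Import Reals List.
From Coquelicot Require Import Coquelicot.

Open Scope R_scope.

Definition Ham (x y : R) : R := y ^ 2 / 2 - x ^ 2 / 2 + x ^ 4 / 4.

(* [a i e] is the value at e of the i-th coefficient; only i <= 9 matters. *)
Definition cubic (a : nat -> R -> R) (x y e : R) : R :=
  a 0%nat e + a 1%nat e * x + a 2%nat e * y + a 3%nat e * (x * y)
  + a 4%nat e * x ^ 2 + a 5%nat e * y ^ 2 + a 6%nat e * (x ^ 2 * y)
  + a 7%nat e * (x * y ^ 2) + a 8%nat e * x ^ 3 + a 9%nat e * y ^ 3.

Definition analytic_at_0 (u : R -> R) : Prop :=
  exists a : nat -> R, locally 0 (fun e : R => is_pseries a e (u e)).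

(* Here Ham_y = y and - Ham_x = x - x^3. *)
Definition is_solution (lam gam : nat -> R -> R) (e T : R) (x y : R -> R) : Prop :=
  forall t : R, 0 <= t <= T ->
    is_derive x t (y t + e * cubic lam (x t) (y t) e) /\
    is_derive y t (x t - x t ^ 3 + e * cubic gam (x t) (y t) e).

Inductive side : Set := Right | Left.

Definition sgn (s : side) : R := match s with Right => 1 | Left => -1 end.

(* The cross-section lies on the x-axis, between the center (+-1, 0) and the
   point (+-sqrt 2, 0) of the separatrix loop. On it, Ham is a coordinate
   with range (-1/4, 0). *)
Definition section (s : side) (x y : R) : Prop :=
  y = 0 /\ 1 < sgn s * x < sqrt 2.

Definition first_return (s : side) (lam gam : nat -> R -> R) (e h p : R) : Prop :=
  exists (T : R) (x y : R -> R),
    0 < T /\ is_solution lam gam e T x y /\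
    section s (x 0) (y 0) /\ Ham (x 0) (y 0) = h /\
    (forall t : R, 0 < t < T -> ~ section s (x t) (y t)) /\
    section s (x T) (y T) /\ Ham (x T) (y T) = p.

Definition is_first_melnikov (s : side) (lam gam : nat -> R -> R) (M1 : R -> R) : Prop :=
  forall h : R, -1/4 < h < 0 ->
    exists d : nat -> R,
      d 0%nat = 0 /\ d 1%nat = M1 h /\
      locally 0 (fun e : R => exists p : R,
        first_return s lam gam e h p /\ is_pseries d e (p - h)).

(* On {Ham = h} one has y^2 = 2 h + x^2 - x^4 / 2, which is nonnegative
   exactly for 1 - sqrt (1 + 4 h) <= x^2 <= 1 + sqrt (1 + 4 h). *)
Definition y_arc (h x : R) : R := sqrt (2 * h + x ^ 2 - x ^ 4 / 2).

Definition x_min (s : side) (h : R) : R :=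
  match s with
  | Right => sqrt (1 - sqrt (1 + 4 * h))
  | Left => - sqrt (1 + sqrt (1 + 4 * h))
  end.

Definition x_max (s : side) (h : R) : R :=
  match s with
  | Right => sqrt (1 + sqrt (1 + 4 * h))
  | Left => - sqrt (1 - sqrt (1 + 4 * h))
  end.

(* Line integral of x^i y dx over the oval. As x' = y along the flow, the arc
   y > 0 runs from x_min to x_max and the arc y < 0 runs back. *)
Definition I_ (s : side) (i : nat) (h : R) : R :=
  RInt (fun x => x ^ i * y_arc h x) (x_min s h) (x_max s h)
  + RInt (fun x => x ^ i * - y_arc h x) (x_max s h) (x_min s h).

Definition c_0 (lam gam : nat -> R -> R) : R := lam 1%nat 0 + gam 2%nat 0.
Definition c_1 (lam gam : nat -> R -> R) : R :=
  4 / 7 * (lam 7%nat 0 + 3 * gam 9%nat 0).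
Definition alpha_1 (lam gam : nat -> R -> R) : R := 2 * lam 4%nat 0 + gam 3%nat 0.
Definition c_2 (lam gam : nat -> R -> R) : R :=
  gam 6%nat 0 + 3 * lam 8%nat 0 + 1 / 7 * lam 7%nat 0 + 3 / 7 * gam 9%nat 0.

Definition DD (z : C) : Prop := ~ (Im z = 0 /\ 0 <= Re z).

Definition holomorphic_on_DD (F : C -> C) : Prop :=
  forall z : C, DD z -> ex_derive (K := C_AbsRing) (V := C_NormedModule) F z.

Definition is_continuation (F1 : R -> R) (F : C -> C) : Prop :=
  holomorphic_on_DD F /\
  forall h : R, -1/4 < h < 0 -> F (RtoC h) = RtoC (F1 h).

(* The entries of zs, repetitions included, are zeros of F in DD counted with
   at most their multiplicities. *)
Definition zeros_in_DD (F : C -> C) (zs : list C) : Prop :=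
  (forall z : C, In z zs -> DD z) /\
  exists G : C -> C, holomorphic_on_DD G /\
    forall z : C, DD z ->
      F z = Cmult (fold_right (fun a p => Cmult (Cminus z a) p) (RtoC 1) zs) (G z).

(* F has at most n zeros in DD, counted with multiplicity, besides one zero at
   the level -1/4 of the centers. Every I_ s i vanishes at that level because
   the oval shrinks to a center there. *)
Definition at_most_zeros_besides_center (n : nat) (F : C -> C) : Prop :=
  forall zs : list C, zeros_in_DD F (RtoC (-1/4) :: zs) -> (length zs <= n)%nat.

(* Main.v *)
Require Import Defs.
From Stdlib Require Import Reals List.
From Coquelicot Require Import Coquelicot.
From Stdlib Require Import Lra Lia Psatz Classical ClassicalEpsilon Ranalysis5.
Open Scope R_scope.

(** The zeros are counted by an orthogonality argument, which plays the role of the argument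
    principle on the slit plane.

    The continuation. On the oval put x^2 = 1 + r cos t or 1 - r cos t, with r^2 = 1 + 4 h. The
    curve becomes an ellipse in (x^2, y), so I_1 is a constant multiple of 1 + 4 h, and I_0, I_2
    become integrals over t in [0, PI/2] of algebraic functions of h and cos t. The latter are
    even in r, and written without r they make sense for every h in the slit plane ([I_0_eq],
    [I_1_eq], [I_2_eq]). Hence M is the function [melnikov], that is
      (1 + 4 z) / sqrt 2 * ((c0 + c1 z) per0 z + c2 per2 z + k),
    first on (-1/4, 0) and then on the whole slit plane by the identity theorem
    ([identity_DD]), which is derived from Goursat's theorem for rectangles.

    The orthogonality relation. Suppose that M has five zeros, counted with multiplicity and -1/4
    included. As M is real on the negative axis, its zeros are symmetric, and the list of zeros
    can be enlarged to one that is closed under conjugation ([conj_closure]): M = P G with G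
    holomorphic and P a real polynomial
    of degree at least 5, positive on [0, +oo). Let Q be a real polynomial of degree at most 2.
    Since M = O(|z|^(7/4)), the integral of Q G over the three far sides of the rectangle
    [-L, L] x [0, L] tends to 0, while over the negative half of its base the integral is real.
    Goursat's theorem therefore leaves, with M_+ the boundary value of M from above,
      integral over (0, +oo) of Q Im M_+ / P = 0.
    A contradiction follows from a Q for which Q Im M_+ is nonnegative and not identically
    zero ([melnikov_few_zeros]).

    The choice of Q. On the cut I_1 is real, so it does not contribute, and Im M_+ is a positive
    multiple of c0 + c1 h - c2 ratio h, where ratio is a quotient of two complete elliptic
    integrals ([Im_per_on_cut]). The Picard-Fuchs system of these integrals becomes a Riccati
    equation for ratio ([ratio_derive]), which forces ratio to be strictly concave
    ([ratio2_neg]). Thus c0 + c1 h - c2 ratio h changes sign at most twice, and Q is built from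
    the sign changes ([sign_poly]). The only case left is c0 = c1 = c2 = 0, where M is a nonzero
    multiple of z + 1/4. *)

Local Notation CU := C_UniformSpace.
Local Notation RU := R_UniformSpace.
Local Notation RN := R_NormedModule.
Local Notation RCN := R_CompleteNormedModule.

(** * Continuity and differentiability of complex functions *)

(** Continuity is tested on the two components to keep the lemmas on real functions
    applicable. The source is a line, the plane, or the plane times a line of parameters. *)
Definition cont {U : UniformSpace} (f : U -> C) (x : U) : Prop :=
  continuous (fun u => Re (f u)) x /\ continuous (fun u => Im (f u)) x.

Lemma cont_const {U : UniformSpace} (k : C) (x : U) : cont (fun _ => k) x.
Proof. split; apply continuous_const. Qed.

Lemma cont_id (z : C) : cont (fun w : C => w) z.
Proof. split; [ apply continuous_fst | apply continuous_snd ]. Qed.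

Lemma cont_plus {U : UniformSpace} (f g : U -> C) (x : U) :
  cont f x -> cont g x -> cont (fun u => f u + g u)%C x.
Proof.
  intros [f1 f2] [g1 g2]; split.
  - exact (continuous_plus _ _ _ f1 g1).
  - exact (continuous_plus _ _ _ f2 g2).
Qed.

Lemma cont_opp {U : UniformSpace} (f : U -> C) (x : U) :
  cont f x -> cont (fun u => - f u)%C x.
Proof.
  intros [f1 f2]; split.
  - exact (continuous_opp _ _ f1).
  - exact (continuous_opp _ _ f2).
Qed.

Lemma cont_minus {U : UniformSpace} (f g : U -> C) (x : U) :
  cont f x -> cont g x -> cont (fun u => f u - g u)%C x.
Proof. intros Hf Hg; exact (cont_plus _ _ _ Hf (cont_opp _ _ Hg)). Qed.

Lemma cont_mult {U : UniformSpace} (f g : U -> C) (x : U) :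
  cont f x -> cont g x -> cont (fun u => f u * g u)%C x.
Proof.
  intros [f1 f2] [g1 g2]; split.
  - apply (continuous_minus (V := RN) (fun u => Re (f u) * Re (g u))
      (fun u => Im (f u) * Im (g u)));
    apply (continuous_mult (K := R_AbsRing)); assumption.
  - apply (continuous_plus (V := RN) (fun u => Re (f u) * Im (g u)) (fun u => Im (f u) * Re (g u)));
    apply (continuous_mult (K := R_AbsRing)); assumption.
Qed.

Ltac prove_cont :=
  repeat first [ solve [ auto ] | match goal with
  | |- cont (fun _ => ?k) _ => apply cont_const
  | |- cont (fun x => x) _ => apply cont_id
  | |- cont (fun x => (@?f x - @?g x)%C) _ => apply (cont_minus f g)
  | |- cont (fun x => (@?f x + @?g x)%C) _ => apply (cont_plus f g)
  | |- cont (fun x => (@?f x * @?g x)%C) _ => apply (cont_mult f g)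
  | |- cont (fun x => (- @?f x)%C) _ => apply (cont_opp f)
  end ].

Lemma cont_comp {U V : UniformSpace} (f : U -> V) (g : V -> C) (x : U) :
  continuous f x -> cont g (f x) -> cont (fun u => g (f u)) x.
Proof.
  intros Hf [g1 g2]; split.
  - exact (continuous_comp f (fun v => Re (g v)) x Hf g1).
  - exact (continuous_comp f (fun v => Im (g v)) x Hf g2).
Qed.

Lemma cont_continuous {U : UniformSpace} (f : U -> C) (x : U) :
  cont f x -> continuous f x.
Proof.
  intros [f1 f2].
  apply (continuous_ext (fun u => (Re (f u), Im (f u)))).
  - intros u; destruct (f u); reflexivity.
  - intros P HP.
    apply (filterlim_pair (F := locally x) (G := locally (Re (f x))) (H := locally (Im (f x))) _ _
      f1 f2).
    destruct HP as [e He].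
    exists (ball (Re (f x)) e) (ball (Im (f x)) e).
    + apply locally_ball.
    + apply locally_ball.
    + intros a b Ha Hb. apply He. split; assumption.
Qed.

Lemma Cmod_le_abs (z : C) : Cmod z <= Rabs (Re z) + Rabs (Im z).
Proof.
  destruct z as [a b]. unfold Cmod; simpl.
  apply Rsqr_incr_0_var.
  - rewrite Rsqr_sqrt by nra. unfold Rsqr.
    generalize (Rabs_pos a) (Rabs_pos b) (Rsqr_abs a) (Rsqr_abs b); unfold Rsqr; intros; nra.
  - generalize (Rabs_pos a) (Rabs_pos b); lra.
Qed.

Lemma Im_le_Cmod (z : C) : Rabs (Im z) <= Cmod z.
Proof.
  apply Rle_trans with (2 := Rmax_Cmod z). apply Rmax_r.
Qed.

Lemma Cmod_coords (z w : C) :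
  Re z - Cmod (w - z) <= Re w <= Re z + Cmod (w - z) /\
  Im z - Cmod (w - z) <= Im w <= Im z + Cmod (w - z).
Proof.
  assert (A1 := re_le_Cmod (w - z)). assert (A2 := Im_le_Cmod (w - z)).
  apply Rabs_le_between in A1. apply Rabs_le_between in A2.
  change (Re (w - z)%C) with (Re w - Re z) in A1. change (Im (w - z)%C) with (Im w - Im z) in A2.
  lra.
Qed.

Lemma locally_Cmod (z : C) (P : C -> Prop) :
  locally (T := CU) z P <-> exists d : R, 0 < d /\ forall w : C, Cmod (w - z) < d -> P w.
Proof.
  split.
  - intros [d Hd]. exists d; split; [ apply d | ]. intros w Hw. apply Hd. split.
    + apply Rle_lt_trans with (2 := Hw). exact (re_le_Cmod (w - z)).
    + apply Rle_lt_trans with (2 := Hw). exact (Im_le_Cmod (w - z)).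
  - intros [d [Hd H]]. assert (Hd2 : 0 < d / 2) by lra.
    exists (mkposreal _ Hd2). intros w [B1 B2]. apply H.
    apply Rle_lt_trans with (1 := Cmod_le_abs _).
    change (Rabs (Re w - Re z) < d / 2) in B1.
    change (Rabs (Im w - Im z) < d / 2) in B2.
    change (Rabs (Re w - Re z) + Rabs (Im w - Im z) < d). lra.
Qed.

Lemma cont_locally {U : UniformSpace} (f : U -> C) (x : U) (e : R) : 0 < e ->
  cont f x -> locally x (fun y => Cmod (f y - f x) < e).
Proof.
  intros He [H1 H2]. assert (He2 : 0 < e / 2) by lra.
  assert (L1 : locally x (fun y => Rabs (Re (f y) - Re (f x)) < e / 2))
    by exact (H1 _ (locally_ball (Re (f x)) (mkposreal _ He2))).
  assert (L2 : locally x (fun y => Rabs (Im (f y) - Im (f x)) < e / 2))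
    by exact (H2 _ (locally_ball (Im (f x)) (mkposreal _ He2))).
  generalize (filter_and _ _ L1 L2). apply filter_imp. intros y [B1 B2].
  apply Rle_lt_trans with (1 := Cmod_le_abs _).
  change (Rabs (Re (f y) - Re (f x)) + Rabs (Im (f y) - Im (f x)) < e). lra.
Qed.

Lemma cont_of_locally {U : UniformSpace} (f : U -> C) (x : U) :
  (forall e, 0 < e -> locally x (fun y => Cmod (f y - f x) < e)) -> cont f x.
Proof.
  intros H. split; intros P [e He].
  - change (locally x (fun u => P (Re (f u)))).
    generalize (H e (cond_pos e)). apply filter_imp. intros y Hy. apply He.
    apply Rle_lt_trans with (2 := Hy). exact (re_le_Cmod (f y - f x)).
  - change (locally x (fun u => P (Im (f u)))).
    generalize (H e (cond_pos e)). apply filter_imp. intros y Hy. apply He.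
    apply Rle_lt_trans with (2 := Hy). exact (Im_le_Cmod (f y - f x)).
Qed.

Lemma cont_eps (f : C -> C) (z : C) :
  cont f z <-> forall e : R, 0 < e -> exists d : R, 0 < d /\
    forall w : C, Cmod (w - z) < d -> Cmod (f w - f z) < e.
Proof.
  split.
  - intros H e He. exact (proj1 (locally_Cmod z _) (cont_locally f z e He H)).
  - intros H. apply (cont_of_locally (U := CU)). intros e He. apply locally_Cmod. exact (H e He).
Qed.

Lemma cont_inv {U : UniformSpace} (f : U -> C) (x : U) :
  cont f x -> f x <> RtoC 0 -> cont (fun u => / f u)%C x.
Proof.
  intros [f1 f2] H0.
  assert (N : Re (f x) * Re (f x) + Im (f x) * Im (f x) <> 0).
  { intros E. apply H0. destruct (f x) as [a b]; simpl in *.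
      apply injective_projections; simpl; nra. }
  assert (D : continuous (fun u => / (Re (f u) * Re (f u) + Im (f u) * Im (f u))) x).
  { apply (continuous_comp (fun u => Re (f u) * Re (f u) + Im (f u) * Im (f u)) Rinv).
    - apply (continuous_plus (V := RN)); apply (continuous_mult (K := R_AbsRing)); assumption.
    - apply continuity_pt_filterlim. apply continuity_pt_inv; [ apply continuity_pt_id | exact N ].
      }
  split.
  - apply (continuous_ext (fun u => Re (f u) * / (Re (f u) * Re (f u) + Im (f u) * Im (f u)))).
    + intros u. destruct (f u) as [a b]. simpl. unfold Rdiv. f_equal. f_equal. ring.
    + apply (continuous_mult (K := R_AbsRing)); assumption.
  - apply (continuous_ext (fun u => (- Im (f u)) * / (Re (f u) * Re (f u) + Im (f u) * Im (f u)))).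
    + intros u. destruct (f u) as [a b]. simpl. unfold Rdiv. f_equal. f_equal. ring.
    + apply (continuous_mult (K := R_AbsRing)); [ | assumption ].
      exact (continuous_opp _ _ f2).
Qed.

Lemma cont_ext_loc {U : UniformSpace} (f g : U -> C) (x : U) :
  locally x (fun u => f u = g u) -> cont f x -> cont g x.
Proof.
  intros L [f1 f2]; split.
  - apply (continuous_ext_loc _ (fun u => Re (f u))); [ | assumption ].
    apply filter_imp with (2 := L). intros u E; now rewrite E.
  - apply (continuous_ext_loc _ (fun u => Im (f u))); [ | assumption ].
    apply filter_imp with (2 := L). intros u E; now rewrite E.
Qed.

(** Caratheodory's form of differentiability at z: the difference quotient extends
    continuously to z. Sums, products, inverses and integrals over a parameter then need no
    estimates. *)
Definition holo (f : C -> C) (z : C) : Prop :=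
  exists phi : C -> C, cont phi z /\
    locally (T := CU) z (fun w => f w = f z + phi w * (w - z))%C.

Lemma holo_cont (f : C -> C) (z : C) : holo f z -> cont f z.
Proof.
  intros [phi [Hp L]].
  apply (cont_ext_loc (fun w => f z + phi w * (w - z))%C).
  - apply filter_imp with (2 := L). intros w E; now rewrite E.
  - prove_cont.
Qed.

Lemma holo_const (k z : C) : holo (fun _ => k) z.
Proof.
  exists (fun _ => RtoC 0). split; [ apply cont_const | ].
  apply filter_forall. intros w. ring.
Qed.

Lemma holo_id (z : C) : holo (fun w => w) z.
Proof.
  exists (fun _ => RtoC 1). split; [ apply cont_const | ].
  apply filter_forall. assert (E : forall w : C, w = (z + 1 * (w - z))%C) by (intros; ring).
  exact E.
Qed.

Lemma holo_plus (f g : C -> C) (z : C) :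
  holo f z -> holo g z -> holo (fun w => f w + g w)%C z.
Proof.
  intros [p [Hp Lp]] [q [Hq Lq]]. exists (fun w => p w + q w)%C. split.
  - prove_cont.
  - generalize (filter_and _ _ Lp Lq). apply filter_imp. intros w [E1 E2].
    rewrite E1, E2. ring.
Qed.

Lemma holo_mult (f g : C -> C) (z : C) :
  holo f z -> holo g z -> holo (fun w => f w * g w)%C z.
Proof.
  intros Hf Hg. assert (Cg := holo_cont _ _ Hg). revert Hf Hg.
  intros [p [Hp Lp]] [q [Hq Lq]]. exists (fun w => p w * g w + f z * q w)%C. split.
  - prove_cont.
  - generalize (filter_and _ _ Lp Lq). apply filter_imp. intros w [E1 E2].
    rewrite E1, E2. ring.
Qed.

Lemma holo_inv (f : C -> C) (z : C) :
  holo f z -> f z <> RtoC 0 -> holo (fun w => / f w)%C z.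
Proof.
  intros Hf H0. assert (Cf := holo_cont _ _ Hf). destruct Hf as [p [Hp Lp]].
  exists (fun w => - (p w * / f w * / f z))%C. split.
  - prove_cont. now apply (cont_inv (U := CU)).
  - assert (Ln : locally (T := CU) z (fun w => f w <> RtoC 0)).
    { destruct (proj1 (cont_eps f z) Cf (Cmod (f z))) as [d [Hd Hw]].
      { now apply Cmod_gt_0. }
      apply locally_Cmod. exists d; split; [ assumption | ]. intros w Hwd E.
      specialize (Hw w Hwd). rewrite E in Hw.
      replace (0 - f z)%C with (- f z)%C in Hw by ring. rewrite Cmod_opp in Hw. lra. }
    generalize (filter_and _ _ Lp Ln). apply filter_imp. intros w [E1 E2].
    assert (E : (p w * (w - z) = f w - f z)%C) by (rewrite E1; ring).
    transitivity (/ f z - (p w * (w - z)) * / f w * / f z)%C; [ | ring ].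
    rewrite E. field. auto.
Qed.

Lemma holo_opp (f : C -> C) (z : C) : holo f z -> holo (fun w => - f w)%C z.
Proof.
  intros [p [Hp Lp]]. exists (fun w => - p w)%C. split.
  - prove_cont.
  - revert Lp. apply filter_imp. intros w E1. rewrite E1. ring.
Qed.

Lemma holo_minus (f g : C -> C) (z : C) :
  holo f z -> holo g z -> holo (fun w => f w - g w)%C z.
Proof. intros Hf Hg. exact (holo_plus _ _ _ Hf (holo_opp _ _ Hg)). Qed.

Lemma holo_ext_loc (f g : C -> C) (z : C) :
  locally (T := CU) z (fun w => f w = g w) -> holo f z -> holo g z.
Proof.
  intros L [p [Hp Lp]]. exists p. split; [ assumption | ].
  assert (E0 := locally_singleton _ _ L).
  generalize (filter_and _ _ L Lp). apply filter_imp. intros w [E1 E2].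
  rewrite <- E1, <- E0. exact E2.
Qed.

Ltac prove_holo :=
  repeat first [ solve [ auto ] | match goal with
  | |- holo (fun _ => ?k) _ => apply holo_const
  | |- holo (fun x => x) _ => apply holo_id
  | |- holo (fun x => (@?f x - @?g x)%C) _ => apply (holo_minus f g)
  | |- holo (fun x => (@?f x + @?g x)%C) _ => apply (holo_plus f g)
  | |- holo (fun x => (@?f x * @?g x)%C) _ => apply (holo_mult f g)
  end ].

(** Several conditions on a small step are met at once. *)
Lemma below_all (l : list R) : (forall x, In x l -> 0 < x) ->
  exists e, 0 < e /\ forall x, In x l -> e <= x.
Proof.
  induction l as [ | y l IH ]; intros Hl.
  - exists 1. split; [ lra | contradiction ].
  - destruct IH as (e & He & H); [ intros x Hx; apply Hl; now right | ].
    exists (Rmin y e). split; [ apply Rmin_pos; [ apply Hl; now left | exact He ] | ].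
    intros x [<- | Hx]; [ apply Rmin_l | apply Rle_trans with (1 := Rmin_r _ _); auto ].
Qed.

(** An estimate that improves linearly with a free small parameter leaves only zero. *)
Lemma Cmod_linear_small (z : C) (K e0 : R) : 0 < e0 -> 0 <= K ->
  (forall e, 0 < e <= e0 -> Cmod z <= K * e) -> z = RtoC 0.
Proof.
  intros He0 HK H. apply Cmod_eq_0. apply Rle_antisym; [ | apply Cmod_ge_0 ].
  apply Rnot_lt_le. intros Hpos. set (X := Cmod z) in *.
  set (e := Rmin e0 (X / (2 * (K + 1)))).
  assert (L : e <= X / (2 * (K + 1))) by apply Rmin_r.
  assert (He : 0 < e <= e0).
  { split; [ apply Rmin_pos; [ lra | apply Rdiv_lt_0_compat; lra ] | apply Rmin_l ]. }
  assert (K * e <= (K + 1) * (X / (2 * (K + 1)))) by (apply Rmult_le_compat; lra).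
  replace ((K + 1) * (X / (2 * (K + 1)))) with (X / 2) in H0 by (field; lra).
  specialize (H e He). lra.
Qed.

Lemma ex_derive_holo (f : C -> C) (z : C) :
  ex_derive (K := C_AbsRing) (V := C_NormedModule) f z -> holo f z.
Proof.
  intros [l [_ H]].
  exists (fun w => if Ceq_dec w z then l else (f w - f z) / (w - z))%C. split.
  - apply cont_eps. intros e He.
    assert (He2 : 0 < e / 2) by lra.
    specialize (H z (fun P HP => HP) (mkposreal _ He2)).
    apply locally_C in H.
    destruct (proj1 (locally_Cmod z _) H) as [d [Hd Hw]].
    exists d. split; [ assumption | ]. intros w Hwd.
    destruct (Ceq_dec z z) as [_ | n]; [ | now elim n ].
    destruct (Ceq_dec w z) as [E | N].
    + replace (l - l)%C with (RtoC 0) by ring. rewrite Cmod_0. lra.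
    + specialize (Hw w Hwd). simpl in Hw.
      assert (Nz := Cminus_eq_contra _ _ N).
      assert (P := proj1 (Cmod_gt_0 _) Nz).
      replace ((f w - f z) / (w - z) - l)%C with ((f w - f z - (w - z) * l) / (w - z))%C
        by (field; auto).
      rewrite Cmod_div by assumption.
      apply Rmult_lt_reg_r with (1 := P).
      unfold Rdiv. rewrite Rmult_assoc, Rinv_l by lra. rewrite Rmult_1_r.
      apply Rle_lt_trans with (e / 2 * Cmod (w - z)); [ exact Hw | nra ].
  - apply filter_forall. intros w. destruct (Ceq_dec w z) as [E | N].
    + rewrite E. ring.
    + field. now apply Cminus_eq_contra.
Qed.

(** * Integrals over rectangles and Goursat's theorem *)

Definition CInt (f : R -> C) (a b : R) : C :=
  (RInt (fun t => Re (f t)) a b, RInt (fun t => Im (f t)) a b).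

Definition cont_on (f : R -> C) (a b : R) : Prop :=
  forall t : R, a <= t <= b -> cont f t.

Lemma cont_on_ex (f : R -> C) (a b : R) : a <= b -> cont_on f a b ->
  ex_RInt (fun t => Re (f t)) a b /\ ex_RInt (fun t => Im (f t)) a b.
Proof.
  intros Hab H. split; apply (ex_RInt_continuous (V := RCN));
    intros t; rewrite Rmin_left, Rmax_right by assumption; intros Ht; apply (H t Ht).
Qed.

Lemma CInt_ext (f g : R -> C) (a b : R) : a <= b ->
  (forall t, a < t < b -> f t = g t) -> CInt f a b = CInt g a b.
Proof.
  intros Hab H. unfold CInt. f_equal; apply RInt_ext; intros t;
    rewrite Rmin_left, Rmax_right by assumption; intros Ht; now rewrite H.
Qed.

Lemma CInt_plus (f g : R -> C) (a b : R) : a <= b -> cont_on f a b -> cont_on g a b ->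
  CInt (fun t => f t + g t)%C a b = (CInt f a b + CInt g a b)%C.
Proof.
  intros Hab Hf Hg. destruct (cont_on_ex _ _ _ Hab Hf), (cont_on_ex _ _ _ Hab Hg).
  unfold CInt. apply injective_projections; simpl.
  - exact (RInt_plus (fun t => Re (f t)) (fun t => Re (g t)) a b H H1).
  - exact (RInt_plus (fun t => Im (f t)) (fun t => Im (g t)) a b H0 H2).
Qed.

Lemma CInt_scal (k : C) (f : R -> C) (a b : R) : a <= b -> cont_on f a b ->
  CInt (fun t => k * f t)%C a b = (k * CInt f a b)%C.
Proof.
  intros Hab Hf. destruct (cont_on_ex _ _ _ Hab Hf) as [H1 H2].
  unfold CInt. apply injective_projections; simpl.
  - rewrite (RInt_minus (V := RCN)
      (fun t => fst k * Re (f t)) (fun t => snd k * Im (f t))).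
    + rewrite (RInt_scal (V := RCN) (fun t => Re (f t))) by assumption.
      rewrite (RInt_scal (V := RCN) (fun t => Im (f t))) by assumption.
      reflexivity.
    + now apply (ex_RInt_scal (V := RN)).
    + now apply (ex_RInt_scal (V := RN)).
  - rewrite (RInt_plus (V := RCN)
      (fun t => fst k * Im (f t)) (fun t => snd k * Re (f t))).
    + rewrite (RInt_scal (V := RCN) (fun t => Re (f t))) by assumption.
      rewrite (RInt_scal (V := RCN) (fun t => Im (f t))) by assumption.
      reflexivity.
    + now apply (ex_RInt_scal (V := RN)).
    + now apply (ex_RInt_scal (V := RN)).
Qed.

Lemma CInt_Chasles (f : R -> C) (a b c : R) : a <= b -> b <= c -> cont_on f a c ->
  (CInt f a b + CInt f b c)%C = CInt f a c.
Proof.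
  intros Hab Hbc Hf.
  destruct (cont_on_ex f a b) as [H1 H2]; [ lra | intros t Ht; apply Hf; lra | ].
  destruct (cont_on_ex f b c) as [H3 H4]; [ lra | intros t Ht; apply Hf; lra | ].
  unfold CInt. apply injective_projections; simpl.
  - exact (RInt_Chasles (fun t => Re (f t)) a b c H1 H3).
  - exact (RInt_Chasles (fun t => Im (f t)) a b c H2 H4).
Qed.

(** The two components are bounded separately, whence the factor 2. *)
Lemma CInt_norm (f : R -> C) (a b M : R) : a <= b -> cont_on f a b ->
  (forall t, a <= t <= b -> Cmod (f t) <= M) -> Cmod (CInt f a b) <= 2 * ((b - a) * M).
Proof.
  intros Hab Hf HM. destruct (cont_on_ex _ _ _ Hab Hf) as [H1 H2].
  apply Rle_trans with (1 := Cmod_le_abs _). simpl.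
  assert (A1 : Rabs (RInt (fun t => Re (f t)) a b) <= (b - a) * M).
  { apply abs_RInt_le_const; [ assumption | assumption | ]. intros t Ht.
    apply Rle_trans with (2 := HM t Ht). apply re_le_Cmod. }
  assert (A2 : Rabs (RInt (fun t => Im (f t)) a b) <= (b - a) * M).
  { apply abs_RInt_le_const; [ assumption | assumption | ]. intros t Ht.
    apply Rle_trans with (2 := HM t Ht). apply Im_le_Cmod. }
  lra.
Qed.

Lemma cont_hor (f : C -> C) (c t : R) : cont f ((t, c) : C) -> cont (fun x => f ((x, c) : C)) t.
Proof.
  intros H. apply (cont_comp (V := CU) (fun x : R => (x, c))); [ | assumption ].
  intros P [e He]. exists e. intros y Hy. apply He. split; [ exact Hy | apply ball_center ].
Qed.

Lemma cont_ver (f : C -> C) (a t : R) : cont f ((a, t) : C) -> cont (fun y => f ((a, y) : C)) t.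
Proof.
  intros H. apply (cont_comp (V := CU) (fun y : R => (a, y))); [ | assumption ].
  intros P [e He]. exists e. intros y Hy. apply He. split; [ apply ball_center | exact Hy ].
Qed.

(** Counterclockwise along the boundary of [a, b] x [c, d]. *)
Definition rect_int (f : C -> C) (a b c d : R) : C :=
  (CInt (fun x => f (x, c)) a b + Ci * CInt (fun y => f (b, y)) c d
   - CInt (fun x => f (x, d)) a b - Ci * CInt (fun y => f (a, y)) c d)%C.

Definition in_rect (a b c d : R) (z : C) : Prop := a <= Re z <= b /\ c <= Im z <= d.

Definition frame (a b c d : R) (z : C) : Prop :=
  in_rect a b c d z /\ (Re z = a \/ Re z = b \/ Im z = c \/ Im z = d).

Definition cont_frame (f : C -> C) (a b c d : R) : Prop :=
  forall z, frame a b c d z -> cont f z.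

Lemma cont_frame_on (f : C -> C) (a b c d : R) : a <= b -> c <= d -> cont_frame f a b c d ->
  cont_on (fun x => f (x, c)) a b /\ cont_on (fun y => f (b, y)) c d /\
  cont_on (fun x => f (x, d)) a b /\ cont_on (fun y => f (a, y)) c d.
Proof.
  intros Hab Hcd H. refine (conj _ (conj _ (conj _ _))); intros t Ht;
    (apply cont_hor || apply cont_ver); apply H; unfold frame, in_rect; simpl; intuition lra.
Qed.

Lemma rect_int_ext (f g : C -> C) (a b c d : R) : a <= b -> c <= d ->
  (forall z, frame a b c d z -> f z = g z) -> rect_int f a b c d = rect_int g a b c d.
Proof.
  intros Hab Hcd H. unfold rect_int.
  rewrite (CInt_ext (fun x => f (x, c)) (fun x => g (x, c)) a b Hab),
          (CInt_ext (fun x => f (x, d)) (fun x => g (x, d)) a b Hab),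
          (CInt_ext (fun y => f (a, y)) (fun y => g (a, y)) c d Hcd),
          (CInt_ext (fun y => f (b, y)) (fun y => g (b, y)) c d Hcd); [ reflexivity | .. ];
    intros t Ht; apply H; unfold frame, in_rect; simpl; intuition lra.
Qed.

Lemma rect_int_plus (f g : C -> C) (a b c d : R) : a <= b -> c <= d ->
  cont_frame f a b c d -> cont_frame g a b c d ->
  rect_int (fun z => f z + g z)%C a b c d = (rect_int f a b c d + rect_int g a b c d)%C.
Proof.
  intros Hab Hcd Hf Hg.
  destruct (cont_frame_on f a b c d) as (F1 & F2 & F3 & F4); try assumption.
  destruct (cont_frame_on g a b c d) as (G1 & G2 & G3 & G4); try assumption.
  unfold rect_int. rewrite !CInt_plus by assumption. ring.
Qed.

Lemma rect_int_scal (k : C) (f : C -> C) (a b c d : R) : a <= b -> c <= d ->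
  cont_frame f a b c d -> rect_int (fun z => k * f z)%C a b c d = (k * rect_int f a b c d)%C.
Proof.
  intros Hab Hcd Hf.
  destruct (cont_frame_on f a b c d) as (F1 & F2 & F3 & F4); try assumption.
  unfold rect_int. rewrite !CInt_scal by assumption. ring.
Qed.

Lemma rect_int_norm (f : C -> C) (a b c d M : R) : a <= b -> c <= d ->
  cont_frame f a b c d -> (forall z, frame a b c d z -> Cmod (f z) <= M) ->
  Cmod (rect_int f a b c d) <= 4 * ((b - a + (d - c)) * M).
Proof.
  intros Hab Hcd Hf HM.
  destruct (cont_frame_on f a b c d) as (F1 & F2 & F3 & F4); try assumption.
  assert (A1 : Cmod (CInt (fun x => f (x, c)) a b) <= 2 * ((b - a) * M)).
  { apply CInt_norm; try assumption. intros t Ht; apply HM; unfold frame, in_rect; simpl;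
      intuition lra. }
  assert (A2 : Cmod (CInt (fun y => f (b, y)) c d) <= 2 * ((d - c) * M)).
  { apply CInt_norm; try assumption. intros t Ht; apply HM; unfold frame, in_rect; simpl;
      intuition lra. }
  assert (A3 : Cmod (CInt (fun x => f (x, d)) a b) <= 2 * ((b - a) * M)).
  { apply CInt_norm; try assumption. intros t Ht; apply HM; unfold frame, in_rect; simpl;
      intuition lra. }
  assert (A4 : Cmod (CInt (fun y => f (a, y)) c d) <= 2 * ((d - c) * M)).
  { apply CInt_norm; try assumption. intros t Ht; apply HM; unfold frame, in_rect; simpl;
      intuition lra. }
  unfold rect_int, Cminus.
  eapply Rle_trans; [ apply Cmod_triangle | ].
  rewrite Cmod_opp, Cmod_mult, Cmod_Ci.
  eapply Rle_trans; [ apply Rplus_le_compat_r, Cmod_triangle | ].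
  rewrite Cmod_opp.
  eapply Rle_trans; [ apply Rplus_le_compat_r, Rplus_le_compat_r, Cmod_triangle | ].
  rewrite Cmod_mult, Cmod_Ci. lra.
Qed.

Lemma rect_int_split_v (f : C -> C) (a m b c d : R) : a <= m -> m <= b ->
  cont_on (fun x => f (x, c)) a b -> cont_on (fun x => f (x, d)) a b ->
  rect_int f a b c d = (rect_int f a m c d + rect_int f m b c d)%C.
Proof.
  intros H1 H2 H3 H4. unfold rect_int.
  rewrite <- (CInt_Chasles (fun x => f (x, c)) a m b) by assumption.
  rewrite <- (CInt_Chasles (fun x => f (x, d)) a m b) by assumption. ring.
Qed.

Lemma rect_int_split_h (f : C -> C) (a b c m d : R) : c <= m -> m <= d ->
  cont_on (fun y => f (a, y)) c d -> cont_on (fun y => f (b, y)) c d ->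
  rect_int f a b c d = (rect_int f a b c m + rect_int f a b m d)%C.
Proof.
  intros H1 H2 H3 H4. unfold rect_int.
  rewrite <- (CInt_Chasles (fun y => f (a, y)) c m d) by assumption.
  rewrite <- (CInt_Chasles (fun y => f (b, y)) c m d) by assumption. ring.
Qed.

Lemma RInt_id (a b : R) : RInt (fun t => t) a b = (b * b - a * a) / 2.
Proof.
  apply is_RInt_unique.
  replace ((b * b - a * a) / 2) with (minus (b * b / 2) (a * a / 2))
    by (unfold minus, plus, opp; simpl; field).
  apply (is_RInt_derive (fun t => t * t / 2) (fun t => t)).
  - intros x _. auto_derive; [ exact I | field ].
  - intros x _. apply continuous_id.
Qed.

Lemma rect_int_affine (k l : C) (a b c d : R) : a <= b -> c <= d ->
  rect_int (fun z => k + l * z)%C a b c d = RtoC 0.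
Proof.
  intros Hab Hcd.
  rewrite (rect_int_plus (fun _ => k) (fun z => l * z)%C); try assumption.
  - rewrite (rect_int_scal l (fun z => z)); try assumption; [ | intros z _; apply cont_id ].
    unfold rect_int, CInt. simpl. rewrite !RInt_const, !RInt_id.
    unfold scal; simpl; unfold mult; simpl.
    apply injective_projections; simpl; field.
  - intros z _; apply cont_const.
  - intros z _. prove_cont.
Qed.

Lemma nested_interval (x : nat -> R) (w : nat -> R) :
  (forall n, x n <= x (S n) /\ x (S n) + w (S n) <= x n + w n) -> (forall n, 0 <= w n) ->
  exists l : R, forall n, x n <= l <= x n + w n.
Proof.
  intros H Hw.
  assert (Hx : forall n k, x n <= x (n + k)%nat /\ x (n + k)%nat + w (n + k)%nat <= x n + w n).
  { intros n k; induction k as [ | k IH ].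
    - rewrite Nat.add_0_r; lra.
    - rewrite Nat.add_succ_r. specialize (H (n + k)%nat). lra. }
  assert (Hb : forall n m, x m <= x n + w n).
  { intros n m. destruct (Nat.le_ge_cases n m) as [L | L].
    - specialize (Hx n (m - n)%nat). replace (n + (m - n))%nat with m in Hx by lia.
      specialize (Hw m). lra.
    - specialize (Hx m (n - m)%nat). replace (m + (n - m))%nat with n in Hx by lia.
      specialize (Hw n). lra. }
  destruct (completeness (fun y => exists n, y = x n)) as [l [Hl1 Hl2]].
  - exists (x 0%nat + w 0%nat). intros y [n ->]. apply Hb.
  - exists (x 0%nat), 0%nat. reflexivity.
  - exists l. intros n. split.
    + apply Hl1. now exists n.
    + apply Hl2. intros y [m ->]. apply Hb.
Qed.

(** Lower left corner of the n-th rectangle in a repeated quartering that starts from a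
    rectangle of sides W, H at (x, y). Each step picks a quarter whose boundary integral
    exceeds k/4^n; if the first three do not, the invariant proved below makes the fourth
    one do so. *)
Fixpoint corner (f : C -> C) (W H k : R) (x y : R) (n : nat) : R * R :=
  match n with
  | O => (x, y)
  | S n => let p := corner f W H k x y n in
           let w := W / 2 ^ S n in let h := H / 2 ^ S n in
           if Rlt_dec (k / 4 ^ S n) (Cmod (rect_int f (fst p) (fst p + w) (snd p) (snd p + h)))
           then p
           else if Rlt_dec (k / 4 ^ S n) (Cmod
             (rect_int f (fst p + w) (fst p + w + w) (snd p) (snd p + h)))
           then (fst p + w, snd p)
           else if Rlt_dec (k / 4 ^ S n) (Cmod
             (rect_int f (fst p) (fst p + w) (snd p + h) (snd p + h + h)))
           then (fst p, snd p + h)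
           else (fst p + w, snd p + h)
  end.

(** Bisection. If the integral were not 0, a nested sequence of rectangles with sides
    divided by 2^n would have integrals of at least k/4^n. At the common point z the
    function is affine up to o(|w - z|). The affine part has integral 0 and the remainder
    contributes o(4^-n), a contradiction. *)
Theorem goursat (f : C -> C) (a b c d : R) : a <= b -> c <= d ->
  (forall z, in_rect a b c d z -> holo f z) -> rect_int f a b c d = RtoC 0.
Proof.
  intros Hab Hcd Hf.
  apply Cmod_eq_0. apply Rle_antisym; [ | apply Cmod_ge_0 ].
  apply Rnot_lt_le. intros Hpos.
  set (k := Cmod (rect_int f a b c d) / 2).
  assert (Hk : 0 < k) by (unfold k; lra).
  set (W := b - a). set (H := d - c).
  set (p := corner f W H k a c).
  assert (P2 : forall n, 0 < 2 ^ n) by (intros; apply pow_lt; lra).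
  assert (P4 : forall n, 0 < 4 ^ n) by (intros; apply pow_lt; lra).
  assert (HW : 0 <= W) by (unfold W; lra).
  assert (HH : 0 <= H) by (unfold H; lra).
  assert (pos : forall u n, 0 <= u -> 0 <= u / 2 ^ n).
  { intros u n Hu. apply Rmult_le_pos; [ assumption | ]. left. apply Rinv_0_lt_compat, P2. }
  assert (half : forall u n, u / 2 ^ S n = u / 2 ^ n / 2).
  { intros u n. simpl. field. specialize (P2 n); lra. }
  assert (step : forall n, fst (p n) <= fst (p (S n)) /\
            fst (p (S n)) + W / 2 ^ S n <= fst (p n) + W / 2 ^ n /\
            snd (p n) <= snd (p (S n)) /\
            snd (p (S n)) + H / 2 ^ S n <= snd (p n) + H / 2 ^ n).
  { intros n. unfold p. simpl corner. fold p.
    assert (A1 := half W n). assert (A2 := half H n).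
    assert (A3 := pos W (S n) HW). assert (A4 := pos H (S n) HH).
    simpl pow in *.
    repeat (destruct Rlt_dec as [_ | _]; [ simpl; repeat split; lra | ]).
    simpl; repeat split; lra. }
  assert (inside : forall n, a <= fst (p n) /\ fst (p n) + W / 2 ^ n <= b /\
                             c <= snd (p n) /\ snd (p n) + H / 2 ^ n <= d).
  { intros n; induction n as [ | n IH ].
    - simpl. unfold W, H. repeat split; lra.
    - specialize (step n). lra. }
  assert (big : forall n, k / 4 ^ n <
      Cmod (rect_int f (fst (p n)) (fst (p n) + W / 2 ^ n) (snd (p n)) (snd (p n) + H / 2 ^ n))).
  { intros n; induction n as [ | n IH ].
    - simpl. replace (a + W / 1) with b by (unfold W; field).
      replace (c + H / 1) with d by (unfold H; field). unfold k; lra.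
    - unfold p. simpl corner. fold p.
      specialize (inside n).
      assert (A1 := half W n). assert (A2 := half H n).
      assert (A3 := pos W (S n) HW). assert (A4 := pos H (S n) HH).
      simpl pow in *. set (w := W / (2 * 2 ^ n)) in *. set (h := H / (2 * 2 ^ n)) in *.
      replace (W / 2 ^ n) with (w + w) in * by lra.
      replace (H / 2 ^ n) with (h + h) in * by lra.
      destruct (p n) as [x y]; simpl in *.
      destruct Rlt_dec as [L | N1]; [ exact L | ].
      destruct Rlt_dec as [L | N2]; [ exact L | ].
      destruct Rlt_dec as [L | N3]; [ exact L | ].
      simpl.
      destruct (Rlt_dec (k / (4 * 4 ^ n)) (Cmod
        (rect_int f (x + w) (x + w + w) (y + h) (y + h + h)))) as [L | N4];
        [ exact L | exfalso ].
      assert (CV : forall u v, a <= u -> v <= b -> forall s, c <= s <= d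
        -> cont_on (fun x => f (x, s)) u v).
      { intros u v Hu Hv s Hs t Ht. apply cont_hor. apply holo_cont, Hf. unfold in_rect; simpl; lra.
          }
      assert (CH : forall u v, c <= u -> v <= d -> forall s, a <= s <= b
        -> cont_on (fun y => f (s, y)) u v).
      { intros u v Hu Hv s Hs t Ht. apply cont_ver. apply holo_cont, Hf. unfold in_rect; simpl; lra.
          }
      assert (E : rect_int f x (x + (w + w)) y (y + (h + h)) =
        (rect_int f x (x + w) y (y + h) + rect_int f (x + w) (x + w + w) y (y + h)
         + rect_int f x (x + w) (y + h) (y + h + h)
             + rect_int f (x + w) (x + w + w) (y + h) (y + h + h))%C).
      { rewrite (rect_int_split_v f x (x + w)); [ | lra | lra | apply CV; lra | apply CV; lra ].
        rewrite <- !Rplus_assoc.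
        rewrite (rect_int_split_h f x (x + w) y (y + h));
          [ | lra | lra | apply CH; lra | apply CH; lra ].
        rewrite (rect_int_split_h f (x + w) (x + w + w) y (y + h));
          [ | lra | lra | apply CH; lra | apply CH; lra ].
        ring. }
      rewrite E in IH.
      assert (K4 : k / 4 ^ n = 4 * (k / (4 * 4 ^ n))).
      { field. specialize (P4 n); lra. }
      assert (T := Cmod_triangle (rect_int f x (x + w) y (y + h)
        + rect_int f (x + w) (x + w + w) y (y + h)
         + rect_int f x (x + w) (y + h) (y + h + h))%C (rect_int f (x + w) (x + w + w) (y + h) (y
             + h + h))).
      assert (T2 := Cmod_triangle (rect_int f x (x + w) y (y + h)
        + rect_int f (x + w) (x + w + w) y (y + h))%C
         (rect_int f x (x + w) (y + h) (y + h + h))).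
      assert (T3 := Cmod_triangle (rect_int f x (x + w) y (y + h))
        (rect_int f (x + w) (x + w + w) y (y + h))).
      lra. }
  destruct (nested_interval (fun n => fst (p n)) (fun n => W / 2 ^ n)) as [X HX].
  { intros n. specialize (step n). lra. }
  { intros n. now apply pos. }
  destruct (nested_interval (fun n => snd (p n)) (fun n => H / 2 ^ n)) as [Y HY].
  { intros n. specialize (step n). lra. }
  { intros n. now apply pos. }
  set (z := (X, Y) : C).
  assert (Hz : in_rect a b c d z).
  { specialize (inside 0%nat). specialize (HX 0%nat). specialize (HY 0%nat). unfold in_rect; simpl.
      simpl in *. lra. }
  destruct (Hf z Hz) as [phi [Hphi L]].
  set (S2 := (W + H) * (W + H)).
  assert (HS : 0 <= S2) by (unfold S2; nra).
  set (e := k / (4 * S2 + 1)).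
  assert (He : 0 < e) by (apply Rdiv_lt_0_compat; lra).
  destruct (proj1 (cont_eps phi z) Hphi e He) as [d1 [Hd1 Hw1]].
  destruct (proj1 (locally_Cmod z _) L) as [d2 [Hd2 Hw2]].
  (* Within dl of z both the expansion of f and the continuity of phi are available. *)
  set (dl := Rmin d1 d2).
  assert (Hdl : 0 < dl) by (now apply Rmin_pos).
  (* By n <= 2 ^ n and the Archimedean property. *)
  assert (Hn : exists n, (W + H) / 2 ^ n < dl).
  { destruct (archimed_cor1 (dl / (W + H + 1))) as [n [Hn Hn0]].
    { apply Rdiv_lt_0_compat; lra. }
    exists n.
    assert (N2 : INR n <= 2 ^ n).
    { clear. induction n as [ | n IH ]; [ simpl; lra | ]. rewrite S_INR. simpl.
      assert (1 <= 2 ^ n) by (apply pow_R1_Rle; lra). lra. }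
    assert (Hn1 : 0 < INR n) by (apply lt_0_INR; lia).
    assert (Q : (W + H + 1) / INR n < dl).
    { apply Rmult_lt_reg_r with (/ (W + H + 1)). { apply Rinv_0_lt_compat; lra. }
      replace ((W + H + 1) / INR n * / (W + H + 1)) with (/ INR n) by (field; lra). exact Hn. }
    apply Rle_lt_trans with (2 := Q).
    apply Rmult_le_compat; try lra.
    - left; now apply Rinv_0_lt_compat.
    - now apply Rinv_le_contravar. }
  destruct Hn as [n Hn].
  specialize (big n). specialize (inside n). specialize (HX n). specialize (HY n). simpl in HX, HY.
  assert (A3 := pos W n HW). assert (A4 := pos H n HH).
  destruct (p n) as [x y]; simpl in *.
  set (w := W / 2 ^ n) in *. set (h := H / 2 ^ n) in *.
  assert (Ewh : (W + H) / 2 ^ n = w + h) by (unfold w, h; field; specialize (P2 n); lra).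
  rewrite Ewh in Hn.
  assert (dist : forall u, frame x (x + w) y (y + h) u -> Cmod (u - z) <= w + h).
  { intros u [[U1 U2] _]. apply Rle_trans with (1 := Cmod_le_abs _).
    change (Rabs (Re u - X) + Rabs (Im u - Y) <= w + h).
    apply Rplus_le_compat; apply Rabs_le; lra. }
  set (g := fun u : C => ((phi u - phi z) * (u - z))%C).
  assert (decomp : forall u, frame x (x + w) y (y + h) u ->
             f u = ((f z - phi z * z) + phi z * u + g u)%C).
  { intros u Hu. unfold g. rewrite (Hw2 u); [ ring | ].
    apply Rle_lt_trans with (1 := dist u Hu). apply Rlt_le_trans with (1 := Hn). apply Rmin_r. }
  assert (Cf : cont_frame f x (x + w) y (y + h)).
  { intros u [[U1 U2] _]. apply holo_cont, Hf. unfold in_rect; lra. }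
  assert (Ca : cont_frame (fun u => (f z - phi z * z) + phi z * u)%C x (x + w) y (y + h)).
  { intros u _. prove_cont. }
  set (g' := fun u : C => (f u + (-(1)) * ((f z - phi z * z) + phi z * u))%C).
  assert (Eg : forall u, frame x (x + w) y (y + h) u -> g' u = g u).
  { intros u Hu. unfold g'. rewrite (decomp u Hu). ring. }
  assert (Cg : cont_frame g' x (x + w) y (y + h)).
  { intros u Hu. unfold g'. prove_cont. }
  assert (B : rect_int f x (x + w) y (y + h) = rect_int g' x (x + w) y (y + h)).
  { unfold g'. rewrite rect_int_plus; try lra; try assumption.
    - rewrite rect_int_scal; try lra; try assumption.
      rewrite rect_int_affine by lra. ring.
    - intros u Hu. prove_cont. }
  rewrite B in big.
  assert (N := rect_int_norm g' x (x + w) y (y + h) (e * (w + h)) ltac:(lra) ltac:(lra) Cg).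
  assert (bound : Cmod (rect_int g' x (x + w) y (y + h))
    <= 4 * ((x + w - x + (y + h - y)) * (e * (w + h)))).
  { apply N. intros u Hu. rewrite (Eg u Hu). unfold g. rewrite Cmod_mult.
    apply Rmult_le_compat; try apply Cmod_ge_0; [ | now apply dist ].
    left. apply Hw1. apply Rle_lt_trans with (1 := dist u Hu).
    apply Rlt_le_trans with (1 := Hn). apply Rmin_l. }
  assert (EE : (w + h) * (w + h) = S2 / 4 ^ n).
  { rewrite <- Ewh. unfold S2. replace 4 with (2 * 2) by ring. rewrite Rpow_mult_distr.
    field. specialize (P2 n); lra. }
  assert (F : 4 * ((x + w - x + (y + h - y)) * (e * (w + h))) = (4 * S2 * e) / 4 ^ n).
  { transitivity (4 * e * ((w + h) * (w + h)));
      [ ring | rewrite EE; field; specialize (P4 n); lra ]. }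
  rewrite F in bound.
  assert (G : k / 4 ^ n < 4 * S2 * e / 4 ^ n) by lra.
  apply Rmult_lt_compat_r with (r := 4 ^ n) in G; [ | apply P4 ].
  unfold Rdiv in G. rewrite !Rmult_assoc, Rinv_l, !Rmult_1_r in G by (specialize (P4 n); lra).
  assert (Ke : k = e * (4 * S2 + 1)) by (unfold e; field; lra).
  nra.
Qed.

(** * Cauchy's formula *)

(** The region between the two rectangles is cut into four rectangles on which Goursat's
    theorem applies. *)
Lemma rect_int_surround (g : C -> C) (a b c d e : R) (z : C) : 0 < e ->
  a < Re z - e -> Re z + e < b -> c < Im z - e -> Im z + e < d ->
  (forall w, in_rect a b c d w -> w <> z -> holo g w) ->
  rect_int g a b c d = rect_int g (Re z - e) (Re z + e) (Im z - e) (Im z + e).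
Proof.
  intros He H1 H2 H3 H4 Hg. destruct z as [x y]; simpl in *.
  assert (neq : forall u v : R, u <> x \/ v <> y -> ((u, v) : C) <> (x, y)).
  { intros u v [H | H] E; apply H; congruence. }
  assert (CV : forall u v s, a <= u -> v <= b -> c <= s <= d -> s <> y
    -> cont_on (fun x => g (x, s)) u v).
  { intros u v s Hu Hv Hs Hn t Ht. apply cont_hor.
      apply holo_cont, Hg; [ unfold in_rect; simpl; lra | ].
    apply neq; now right. }
  assert (CH : forall u v s, c <= u -> v <= d -> a <= s <= b -> s <> x
    -> cont_on (fun y => g (s, y)) u v).
  { intros u v s Hu Hv Hs Hn t Ht. apply cont_ver.
      apply holo_cont, Hg; [ unfold in_rect; simpl; lra | ].
    apply neq; now left. }
  (* Cut along x - e and x + e, then cut the middle strip along y - e and y + e. *)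
  rewrite (rect_int_split_v g a (x - e) b); [ | lra | lra | apply CV; lra | apply CV; lra ].
  rewrite (rect_int_split_v g (x - e) (x + e) b); [ | lra | lra | apply CV; lra | apply CV; lra ].
  rewrite (rect_int_split_h g (x - e) (x + e) c (y - e) d);
    [ | lra | lra | apply CH; lra | apply CH; lra ].
  rewrite (rect_int_split_h g (x - e) (x + e) (y - e) (y + e) d);
    [ | lra | lra | apply CH; lra | apply CH; lra ].
  assert (G : forall a' b' c' d', a' <= b' -> c' <= d' -> a <= a' -> b' <= b -> c <= c' -> d' <= d
    ->
     (b' < x \/ x < a' \/ d' < y \/ y < c') -> rect_int g a' b' c' d' = RtoC 0).
  { intros a' b' c' d' ? ? ? ? ? ? Hd. apply goursat; try assumption.
    intros [u v] [Hu Hv]; simpl in *. apply Hg; [ unfold in_rect; simpl; lra | ]. apply neq.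
    destruct (Req_dec u x); [ right | now left ]. lra. }
  rewrite (G a (x - e) c d), (G (x - e) (x + e) c (y - e)), (G (x - e) (x + e) (y + e) d),
    (G (x + e) b c d) by lra.
  ring.
Qed.

Lemma RInt_ge_const (f : R -> R) (a b m : R) : a <= b -> ex_RInt f a b ->
  (forall t, a <= t <= b -> m <= f t) -> (b - a) * m <= RInt f a b.
Proof.
  intros Hab Hf H.
  replace ((b - a) * m) with (RInt (fun _ => m) a b) by (rewrite RInt_const; reflexivity).
  apply RInt_le; try assumption.
  - apply ex_RInt_const.
  - intros t Ht; apply H; lra.
Qed.

Lemma RInt_le_const (f : R -> R) (a b m : R) : a <= b -> ex_RInt f a b ->
  (forall t, a <= t <= b -> f t <= - m) -> RInt f a b <= - ((b - a) * m).
Proof.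
  intros Hab Hf H.
  replace (- ((b - a) * m)) with (RInt (fun _ => - m) a b)
    by (rewrite RInt_const; unfold scal; simpl; unfold mult; simpl; ring).
  apply RInt_le; try assumption.
  - apply ex_RInt_const.
  - intros t Ht; apply H; lra.
Qed.

Lemma cont_pole (z w : C) : w <> z -> cont (fun u : C => / (u - z))%C w.
Proof.
  intros N. apply (cont_inv (U := CU)).
  - prove_cont.
  - now apply Cminus_eq_contra.
Qed.

Lemma frame_pole (e : R) (z w : C) : 0 < e ->
  frame (Re z - e) (Re z + e) (Im z - e) (Im z + e) w -> w <> z.
Proof. intros He [_ H] E. rewrite E in H. lra. Qed.

(** On each side the relevant component of 1 / (w - z) is e / (u^2 + e^2) with |u| <= e,
    hence at least 1 / (2 e) on a length 2 e. *)
Lemma winding_lower (z : C) (e : R) : 0 < e ->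
  4 <= Im (rect_int (fun w => / (w - z))%C (Re z - e) (Re z + e) (Im z - e) (Im z + e)).
Proof.
  intros He.
  assert (Hc : cont_frame (fun w => / (w - z))%C (Re z - e) (Re z + e) (Im z - e) (Im z + e)).
  { intros w Hw. apply cont_pole. now apply frame_pole with e. }
  assert (Lx : Re z - e <= Re z + e) by lra. assert (Ly : Im z - e <= Im z + e) by lra.
  destruct (cont_frame_on _ (Re z - e) (Re z + e) (Im z - e) (Im z + e) Lx Ly Hc)
    as (F1 & F2 & F3 & F4).
  destruct (cont_on_ex _ _ _ Lx F1) as [_ F1'].
  destruct (cont_on_ex _ _ _ Ly F2) as [F2' _].
  destruct (cont_on_ex _ _ _ Lx F3) as [_ F3'].
  destruct (cont_on_ex _ _ _ Ly F4) as [F4' _].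
  destruct z as [x y]. simpl Re in *. simpl Im in *.
  assert (B0 : forall a s, a - e <= s <= a + e -> / (2 * e) <= e / ((s - a) * (s - a) + e * e)).
  { intros a s Hs.
    assert (P0 := Rle_0_sqr (s - a)). unfold Rsqr in P0.
    assert (P : 0 < (s - a) * (s - a) + e * e) by nra.
    assert (Q : (s - a) * (s - a) <= e * e) by nra.
    apply Rmult_le_reg_r with (2 * e * ((s - a) * (s - a) + e * e)); [ nra | ].
    replace (/ (2 * e) * (2 * e * ((s - a) * (s - a) + e * e))) with ((s - a) * (s - a) + e * e)
      by (field; lra).
    replace (e / ((s - a) * (s - a) + e * e) * (2 * e * ((s - a) * (s - a) + e * e)))
      with (2 * (e * e)) by (field; lra).
    lra. }
  assert (B := B0 x). assert (B' := B0 y).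
  assert (E1 : forall a, (a + e - (a - e)) * / (2 * e) = 1) by (intros; field; lra).
  assert (A1 : 1 <= RInt (fun t => Im (/ ((t, (y - e)%R) - (x, y)))%C) (x - e) (x + e)).
  { apply Rle_trans with (1 := Req_le _ _ (eq_sym (E1 x))).
      apply RInt_ge_const; [ lra | exact F1' | ]. intros t Ht.
    apply Rle_trans with (1 := B t Ht). right. simpl. unfold Rdiv.
    f_equal; [ ring | f_equal; ring ]. }
  assert (A2 : 1 <= RInt (fun t => Re (/ (((x + e)%R, t) - (x, y)))%C) (y - e) (y + e)).
  { apply Rle_trans with (1 := Req_le _ _ (eq_sym (E1 y))).
      apply RInt_ge_const; [ lra | exact F2' | ]. intros t Ht.
    apply Rle_trans with (1 := B' t Ht). right. simpl. unfold Rdiv.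
    f_equal; [ ring | f_equal; ring ]. }
  assert (A3 : RInt (fun t => Im (/ ((t, (y + e)%R) - (x, y)))%C) (x - e) (x + e) <= - (1)).
  { apply Rle_trans with (2 := Req_le _ _ (f_equal Ropp (E1 x))).
    apply RInt_le_const; [ lra | exact F3' | ]. intros t Ht.
    apply Rle_trans with (2 := Ropp_le_contravar _ _ (B t Ht)). right. simpl.
    unfold Rdiv. rewrite Ropp_mult_distr_l. f_equal; [ ring | f_equal; ring ]. }
  assert (A4 : RInt (fun t => Re (/ (((x - e)%R, t) - (x, y)))%C) (y - e) (y + e) <= - (1)).
  { apply Rle_trans with (2 := Req_le _ _ (f_equal Ropp (E1 y))).
    apply RInt_le_const; [ lra | exact F4' | ]. intros t Ht.
    apply Rle_trans with (2 := Ropp_le_contravar _ _ (B' t Ht)). right. simpl.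
    unfold Rdiv. rewrite Ropp_mult_distr_l. f_equal; [ ring | f_equal; ring ]. }
  clear F1' F2' F3' F4' F1 F2 F3 F4 Hc B B' B0 E1 Lx Ly.
  unfold rect_int, CInt. simpl in *. lra.
Qed.

(** The integral over a square of half side e around z is f z times a winding integral
    bounded away from 0, up to O(e). Letting e tend to 0 decides each implication. *)
Lemma cauchy_zero (f : C -> C) (a b c d : R) (z : C) :
  a < Re z < b -> c < Im z < d -> (forall w, in_rect a b c d w -> holo f w) ->
  f z = RtoC 0 <-> rect_int (fun w => f w * / (w - z))%C a b c d = RtoC 0.
Proof.
  intros H1 H2 Hf.
  set (g := fun w => (f w * / (w - z))%C).
  assert (Hg : forall w, in_rect a b c d w -> w <> z -> holo g w).
  { intros w Hw N. unfold g. prove_holo. apply holo_inv;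
      [ prove_holo | now apply Cminus_eq_contra ]. }
  destruct (Hf z) as [phi [Hp L]]; [ unfold in_rect; lra | ].
  destruct (proj1 (cont_eps phi z) Hp 1 Rlt_0_1) as [d1 [Hd1 Hw1]].
  destruct (proj1 (locally_Cmod z _) L) as [d2 [Hd2 Hw2]].
  destruct (below_all (Re z - a :: b - Re z :: Im z - c :: d - Im z :: d1 :: d2 :: nil)) as
    (e1 & He1 & Hle).
  { simpl. intros x Hx. repeat destruct Hx as [<- | Hx]; lra || contradiction. }
  set (e0 := e1 / 3). assert (He0 : 0 < e0) by (unfold e0; lra).
  assert (B : e0 * 3 <= Re z - a /\ e0 * 3 <= b - Re z /\ e0 * 3 <= Im z - c /\
              e0 * 3 <= d - Im z /\ e0 * 3 <= d1 /\ e0 * 3 <= d2).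
  { replace (e0 * 3) with e1 by (unfold e0; field). repeat split; apply Hle; simpl; tauto. }
  set (K := Cmod (phi z) + 1).
  assert (HK : 0 < K) by (generalize (Cmod_ge_0 (phi z)); unfold K; lra).
  assert (key : forall e, 0 < e <= e0 -> Cmod (rect_int g a b c d -
      f z * rect_int (fun w => / (w - z))%C (Re z - e) (Re z + e) (Im z - e) (Im z + e))
        <= 16 * K * e).
  { intros e He.
    rewrite (rect_int_surround g a b c d e z) by (try assumption; lra).
    set (A := Re z - e). set (A' := Re z + e). set (D := Im z - e). set (D' := Im z + e).
    assert (Hs : forall w, frame A A' D D' w -> w <> z)
      by (intros w Hw; now apply frame_pole with e).
    assert (Cp : cont_frame (fun w => / (w - z))%C A A' D D')
      by (intros w Hw; apply cont_pole; auto).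
    assert (Cg : cont_frame g A A' D D').
    { intros w Hw. apply holo_cont, Hg; auto. destruct Hw as [[U V] _].
        unfold A, A', D, D' in *; unfold in_rect; lra. }
    rewrite <- rect_int_scal; [ | unfold A, A'; lra | unfold D, D'; lra | exact Cp ].
    set (h := fun w : C => (g w + (-(1)) * (f z * / (w - z)))%C).
    assert (Cs : cont_frame (fun w => f z * / (w - z))%C A A' D D').
    { intros w Hw. prove_cont. }
    assert (Cs1 : cont_frame (fun w => (-(1)) * (f z * / (w - z)))%C A A' D D').
    { intros w Hw. prove_cont. }
    assert (Ch : cont_frame h A A' D D').
    { intros w Hw. unfold h. prove_cont. }
    replace (rect_int g A A' D D' - rect_int (fun w => f z * / (w - z)) A A' D D')%C
      with (rect_int h A A' D D').
    2: { unfold h. rewrite rect_int_plus; [ | unfold A, A'; lra | unfold D, D'; lra | auto | auto ].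
         rewrite rect_int_scal; [ ring | unfold A, A'; lra | unfold D, D'; lra | auto ]. }
    replace (16 * K * e) with (4 * ((A' - A + (D' - D)) * K)) by (unfold A, A', D, D'; ring).
    apply rect_int_norm; [ unfold A, A'; lra | unfold D, D'; lra | auto | ].
    intros w Hw.
    assert (dw : Cmod (w - z) <= 2 * e).
    { destruct Hw as [[U V] _]. unfold A, A', D, D' in U, V.
      apply Rle_trans with (1 := Cmod_le_abs _).
      change (Rabs (Re w - Re z) + Rabs (Im w - Im z) <= 2 * e).
      assert (Rabs (Re w - Re z) <= e) by (apply Rabs_le; lra).
      assert (Rabs (Im w - Im z) <= e) by (apply Rabs_le; lra). lra. }
    assert (Eh : h w = phi w).
    { unfold h, g. rewrite (Hw2 w) by lra. field. now apply Cminus_eq_contra, Hs. }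
    rewrite Eh. unfold K.
    specialize (Hw1 w ltac:(lra)).
    replace (phi w) with (phi z + (phi w - phi z))%C by ring.
    apply Rle_trans with (1 := Cmod_triangle _ _). lra. }
  split; intros E.
  - apply (Cmod_linear_small _ (16 * K) e0); [ assumption | lra | ]. intros e He.
    specialize (key e He). rewrite E in key.
    replace (rect_int g a b c d - 0 * rect_int (fun w => / (w - z)) (Re z - e) (Re z + e) (Im z - e)
      (Im z + e))%C
      with (rect_int g a b c d) in key by ring. exact key.
  - apply (Cmod_linear_small _ (4 * K) e0); [ assumption | lra | ]. intros e He.
    specialize (key e He). change (rect_int g a b c d = RtoC 0) in E. rewrite E in key.
    assert (W := winding_lower z e (proj1 He)).
    set (k := rect_int (fun w => / (w - z))%C (Re z - e) (Re z + e) (Im z - e) (Im z + e)) in *.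
    replace (0 - f z * k)%C with (- (f z * k))%C in key by ring.
    rewrite Cmod_opp, Cmod_mult in key.
    assert (4 <= Cmod k).
    { apply Rle_trans with (1 := W). apply Rle_trans with (1 := Rle_abs _). apply Im_le_Cmod. }
    assert (P := Cmod_ge_0 (f z)). nra.
Qed.

(** * The identity theorem on the slit plane *)

Lemma cont_on_bounded (g : R -> C) (a b : R) : a <= b -> cont_on g a b ->
  exists M, forall t, a <= t <= b -> Cmod (g t) <= M.
Proof.
  intros Hab Hg.
  destruct (continuity_ab_maj (fun t => Rabs (Re (g t)) + Rabs (Im (g t))) a b Hab) as [m [Hm _]].
  - intros t Ht. apply continuity_pt_filterlim. destruct (Hg t Ht) as [H1 H2].
    apply (continuous_plus (V := RN) (fun u => Rabs (Re (g u))) (fun u => Rabs (Im (g u)))).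
    + exact (continuous_comp (fun u => Re (g u)) Rabs t H1 (continuous_Rabs _)).
    + exact (continuous_comp (fun u => Im (g u)) Rabs t H2 (continuous_Rabs _)).
  - exists (Rabs (Re (g m)) + Rabs (Im (g m))). intros t Ht.
    apply Rle_trans with (1 := Cmod_le_abs _). now apply Hm.
Qed.

Lemma cont_frame_bounded (f : C -> C) (a b c d : R) : a <= b -> c <= d -> cont_frame f a b c d ->
  exists M, 0 < M /\ forall z, frame a b c d z -> Cmod (f z) <= M.
Proof.
  intros Hab Hcd Hf. destruct (cont_frame_on f a b c d Hab Hcd Hf) as (F1 & F2 & F3 & F4).
  destruct (cont_on_bounded _ _ _ Hab F1) as [M1 H1].
  destruct (cont_on_bounded _ _ _ Hcd F2) as [M2 H2].
  destruct (cont_on_bounded _ _ _ Hab F3) as [M3 H3].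
  destruct (cont_on_bounded _ _ _ Hcd F4) as [M4 H4].
  exists (1 + Rabs M1 + Rabs M2 + Rabs M3 + Rabs M4).
  generalize (Rabs_pos M1) (Rabs_pos M2) (Rabs_pos M3) (Rabs_pos M4)
    (Rle_abs M1) (Rle_abs M2) (Rle_abs M3) (Rle_abs M4). intros.
  split; [ lra | ]. intros [x y] [[Hx Hy] Hs]; simpl in *.
  destruct Hs as [-> | [-> | [-> | ->]]].
  - specialize (H4 y Hy); lra.
  - specialize (H2 y Hy); lra.
  - specialize (H1 x Hx); lra.
  - specialize (H3 x Hx); lra.
Qed.

Lemma cont_Cpow {U : UniformSpace} (f : U -> C) (x : U) (n : nat) :
  cont f x -> cont (fun u => f u ^ n)%C x.
Proof.
  intros Hf. induction n as [ | n IH ].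
  - apply cont_const.
  - exact (cont_mult f (fun u => f u ^ n)%C x Hf IH).
Qed.

Lemma frame_far (c w : C) (r : R) : 0 < r ->
  frame (Re c - r) (Re c + r) (Im c - r) (Im c + r) w -> r <= Cmod (w - c).
Proof.
  intros Hr [_ Hs].
  assert (A := Cmod_coords c w). lra.
Qed.

Lemma Cmod_R_pos (t : R) : 0 <= t -> Cmod (RtoC t) = t.
Proof. intros; rewrite Cmod_R. now apply Rabs_pos_eq. Qed.

(** Let Phi N z be the integral of f w / ((w - c) ^ N (w - z)). The expansion of the Cauchy
    kernel gives Phi N z = Phi N c + (z - c) Phi (N + 1) z, where Phi N c is the N-th
    Taylor coefficient up to a constant. Zeros accumulating at c kill these coefficients
    one after the other, so Phi 0 z = (z - c) ^ N Phi N z for all N. The right side is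
    O((|z - c| / r) ^ N), hence Phi 0 vanishes, and so does f by Cauchy's formula. *)
Lemma local_identity (f : C -> C) (c : C) (r dl : R) : 0 < r -> 0 < dl ->
  (forall w, in_rect (Re c - r) (Re c + r) (Im c - r) (Im c + r) w -> holo f w) ->
  (forall t : R, 0 < t < dl -> f (c + RtoC t)%C = RtoC 0) ->
  forall z, Cmod (z - c) < r -> f z = RtoC 0.
Proof.
  intros Hr Hdl Hf H0.
  set (a := Re c - r). set (b := Re c + r). set (a' := Im c - r). set (b' := Im c + r).
  fold a b a' b' in Hf.
  assert (Hab : a <= b) by (unfold a, b; lra). assert (Hab' : a' <= b') by (unfold a', b'; lra).
  assert (far := frame_far c). 
  assert (Hne : forall z w, Cmod (z - c) < r -> frame a b a' b' w -> r - Cmod (z - c)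
    <= Cmod (w - z)).
  { intros z w Hz Hw. assert (F := far w r Hr Hw).
    assert (T := Cmod_triangle (w - z) (z - c)).
    replace (w - z + (z - c))%C with (w - c)%C in T by ring. lra. }
  assert (Hc : Cmod (c - c) < r). { replace (c - c)%C with (RtoC 0) by ring. rewrite Cmod_0.
    exact Hr. }
  assert (Hneq : forall z w, Cmod (z - c) < r -> frame a b a' b' w -> w <> z).
  { intros z w Hz Hw E. specialize (Hne z w Hz Hw). rewrite E in Hne.
    replace (z - z)%C with (RtoC 0) in Hne by ring. rewrite Cmod_0 in Hne. lra. }
  set (F := fun (N : nat) (z w : C) => (f w * (/ (w - c)) ^ N * / (w - z))%C).
  set (Phi := fun (N : nat) (z : C) => rect_int (F N z) a b a' b').
  assert (Cf : cont_frame f a b a' b') by (intros w [Hw _]; now apply holo_cont, Hf).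
  assert (CF : forall N z, Cmod (z - c) < r -> cont_frame (F N z) a b a' b').
  { intros N z Hz w Hw. unfold F.
    prove_cont.
    - apply (cont_Cpow (U := CU)). apply cont_pole. now apply Hneq.
    - apply cont_pole. now apply Hneq. }
  destruct (cont_frame_bounded f a b a' b' Hab Hab' Cf) as [M [HM HfM]].
  assert (bound : forall N z, Cmod (z - c) < r ->
            Cmod (Phi N z) <= 16 * r * (M * (/ r) ^ N * / (r - Cmod (z - c)))).
  { intros N z Hz. unfold Phi.
    replace (16 * r * (M * (/ r) ^ N * / (r - Cmod (z - c)))) with
      (4 * ((b - a + (b' - a')) * (M * (/ r) ^ N * / (r - Cmod (z - c)))))
        by (unfold a, b, a', b'; ring).
    apply rect_int_norm; try assumption; [ now apply CF | ].
    intros w Hw. unfold F. rewrite !Cmod_mult, Cmod_pow.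
    assert (P1 := far w r Hr Hw). assert (P2 := Hne z w Hz Hw).
    rewrite !Cmod_inv by (apply Cminus_eq_contra; now apply Hneq).
    apply Rmult_le_compat; [ | left; apply Rinv_0_lt_compat; lra | | apply Rinv_le_contravar; lra ].
    - apply Rmult_le_pos; [ apply Cmod_ge_0 | ]. apply pow_le. left; apply Rinv_0_lt_compat; lra.
    - apply Rmult_le_compat; [ apply Cmod_ge_0 | | now apply HfM | ].
      + apply pow_le. left; apply Rinv_0_lt_compat; lra.
      + apply pow_incr. split; [ left; apply Rinv_0_lt_compat; lra | apply Rinv_le_contravar; lra ].
        }
  assert (step : forall N z, Cmod (z - c) < r -> Phi N z = (Phi N c + (z - c) * Phi (S N) z)%C).
  { intros N z Hz. unfold Phi.
    rewrite <- rect_int_scal by (try assumption; now apply CF).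
    rewrite <- rect_int_plus; try assumption.
    - apply rect_int_ext; try assumption. intros w Hw. unfold F.
      assert (w - z <> 0)%C by (apply Cminus_eq_contra; now apply Hneq).
      assert (w - c <> 0)%C by (apply Cminus_eq_contra; now apply Hneq).
      replace ((/ (w - c)) ^ S N)%C with (/ (w - c) * (/ (w - c)) ^ N)%C by reflexivity.
      field. split; assumption.
    - now apply CF.
    - intros w Hw. prove_cont. now apply CF. }
  assert (Hzero : forall z, Cmod (z - c) < r -> (f z = RtoC 0 <-> Phi 0%nat z = RtoC 0)).
  { intros z Hz.
    assert (A := Cmod_coords c z).
    assert (E : Phi 0%nat z = rect_int (fun w => f w * / (w - z))%C a b a' b').
    { unfold Phi. apply rect_int_ext; try assumption. intros w _. unfold F. simpl. ring. }
    rewrite E. apply cauchy_zero; try assumption; unfold a, b, a', b'; lra. }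
  assert (main : forall N, (forall z, Cmod (z - c) < r -> Phi 0%nat z = ((z - c) ^ N * Phi N z)%C)
    ->
             Phi N c = RtoC 0).
  { intros N HN.
    set (K := 16 * r * (M * (/ r) ^ S N * / (r / 2))).
    assert (HK : 0 <= K).
    { unfold K. assert (0 < (/ r) ^ S N) by (apply pow_lt, Rinv_0_lt_compat; lra).
      assert (0 < / (r / 2)) by (apply Rinv_0_lt_compat; lra).
      apply Rmult_le_pos; [ lra | ]. apply Rmult_le_pos; [ apply Rmult_le_pos | ]; lra. }
    apply (Cmod_linear_small _ K (Rmin (dl / 2) (r / 2))); [ apply Rmin_pos; lra | exact HK | ].
    intros t [Ht Htm].
    assert (t1 := Rle_trans _ _ _ Htm (Rmin_l _ _)).
    assert (t2 := Rle_trans _ _ _ Htm (Rmin_r _ _)).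
    set (z := (c + RtoC t)%C).
    assert (zc : (z - c)%C = RtoC t) by (unfold z; ring).
    assert (Hz : Cmod (z - c) < r) by (rewrite zc, Cmod_R_pos; lra).
    assert (Ez : Phi 0%nat z = RtoC 0) by (apply Hzero; [ assumption | apply H0; lra ]).
    rewrite (HN z Hz), zc in Ez.
    assert (t0 : RtoC t <> RtoC 0) by (intros [= E]; lra).
    assert (EN : Phi N z = RtoC 0).
    { apply Cmod_eq_0. assert (Q : Cmod (RtoC t ^ N * Phi N z) = 0) by (rewrite Ez; apply Cmod_0).
      rewrite Cmod_mult, Cmod_pow, Cmod_R_pos in Q by lra.
      apply Rmult_integral in Q. destruct Q as [Q | Q]; [ | assumption ].
      exfalso. assert (0 < t ^ N) by (apply pow_lt; lra). lra. }
    rewrite (step N z Hz), zc in EN.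
    replace (Phi N c) with (- (RtoC t * Phi (S N) z))%C.
    2: { transitivity (Phi N c - (Phi N c + t * Phi (S N) z))%C; [ ring | rewrite EN; ring ]. }
    rewrite Cmod_opp, Cmod_mult, Cmod_R_pos, Rmult_comm by lra.
    apply Rmult_le_compat_r; [ lra | ].
    assert (B := bound (S N) z Hz). rewrite zc, Cmod_R_pos in B by lra.
    apply Rle_trans with (1 := B). unfold K.
    apply Rmult_le_compat_l; [ lra | ]. apply Rmult_le_compat_l.
    - apply Rmult_le_pos; [ lra | ]. apply pow_le. left; apply Rinv_0_lt_compat; lra.
    - apply Rinv_le_contravar; lra. }
  assert (all : forall N z, Cmod (z - c) < r -> Phi 0%nat z = ((z - c) ^ N * Phi N z)%C).
  { intros N. induction N as [ | N IH ]; intros z Hz.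
    - simpl. ring.
    - rewrite (IH z Hz), (step N z Hz), (main N IH). simpl. ring. }
  intros z Hz. apply Hzero; [ assumption | ].
  apply Cmod_eq_0. apply Rle_antisym; [ | apply Cmod_ge_0 ].
  apply Rnot_lt_le. intros Hpos. set (X := Cmod (Phi 0%nat z)) in *.
  set (K := 16 * r * M * / (r - Cmod (z - c))).
  assert (HK : 0 < K).
  { unfold K. assert (0 < / (r - Cmod (z - c))) by (apply Rinv_0_lt_compat; lra).
    repeat apply Rmult_lt_0_compat; lra. }
  destruct (pow_lt_1_zero (Cmod (z - c) * / r)) with (y := X / K) as [N HN].
  - rewrite Rabs_pos_eq.
    + apply Rmult_lt_reg_r with r; [ assumption | ]. rewrite Rmult_assoc, Rinv_l by lra. lra.
    + apply Rmult_le_pos; [ apply Cmod_ge_0 | left; apply Rinv_0_lt_compat; lra ].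
  - now apply Rdiv_lt_0_compat.
  - specialize (HN N (le_n N)).
    apply Rle_lt_trans with (1 := Rle_abs _) in HN.
    rewrite Rpow_mult_distr in HN.
    assert (B := bound N z Hz).
    assert (E : X = Cmod (z - c) ^ N * Cmod (Phi N z)).
    { unfold X. rewrite (all N z Hz), Cmod_mult, Cmod_pow. reflexivity. }
    assert (X <= Cmod (z - c) ^ N * (/ r) ^ N * K).
    { rewrite E, Rmult_assoc. apply Rmult_le_compat_l; [ apply pow_le, Cmod_ge_0 | ].
      apply Rle_trans with (1 := B). right. unfold K. ring. }
    assert (Cmod (z - c) ^ N * (/ r) ^ N * K < X / K * K) by (apply Rmult_lt_compat_r; assumption).
    replace (X / K * K) with X in H1 by (field; lra). lra.
Qed.

Lemma DD_open (p : C) : DD p -> exists r, 0 < r /\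
  forall z, in_rect (Re p - r) (Re p + r) (Im p - r) (Im p + r) z -> DD z.
Proof.
  intros Hp. destruct (Req_dec (Im p) 0) as [E | N].
  - assert (Re p < 0) by (apply Rnot_le_lt; intros H; apply Hp; now split).
    exists (- Re p / 2). split; [ lra | ]. intros z [H1 _] [_ H2]. lra.
  - exists (Rabs (Im p) / 2). assert (P := Rabs_pos_lt _ N). split; [ lra | ].
    intros z [_ H1] [H2 _]. rewrite H2 in H1.
    unfold Rabs in *. destruct Rcase_abs; lra.
Qed.

Lemma locally_DD (p : C) : DD p -> locally (T := CU) p DD.
Proof.
  intros Hp. destruct (DD_open p Hp) as [r [Hr H]].
  apply locally_Cmod. exists r. split; [ assumption | ]. intros w Hw. apply H.
  assert (A := Cmod_coords p w). unfold in_rect; lra.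
Qed.

Definition segment (z : C) (t : R) : C := (RtoC (-1/8) + RtoC t * (z - RtoC (-1/8)))%C.

(** A segment from a negative number to z meets the real axis only at that number, unless z
    is real too. *)
Lemma DD_star (z : C) (t : R) : DD z -> 0 <= t <= 1 -> DD (segment z t).
Proof.
  intros Hz Ht [H1 H2]. destruct z as [x y]. unfold segment, DD in *. simpl in *.
  assert (E : t * y = 0) by lra. apply Rmult_integral in E. destruct E as [-> | E].
  - lra.
  - apply Hz. split; [ assumption | ]. destruct (Req_dec t 0) as [-> | N]; [ lra | ]. nra.
Qed.

(** The points of the segment from -1/8 to z near which f vanishes cannot stop before z:
    around the last one there is room for a square on which the local statement applies. *)
Theorem identity_DD (f : C -> C) : (forall z, DD z -> holo f z) ->
  (forall h : R, -1/4 < h < 0 -> f (RtoC h) = RtoC 0) ->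
  forall z, DD z -> f z = RtoC 0.
Proof.
  intros Hf H0 z Hz.
  set (V := fun p : C => exists d, 0 < d /\ forall w, Cmod (w - p) < d -> f w = RtoC 0).
  set (D := Cmod (z - RtoC (-1/8))). assert (HD : 0 <= D) by apply Cmod_ge_0.
  assert (Hseg : forall s t, Cmod (segment z s - segment z t) = Rabs (s - t) * D).
  { intros s t. unfold segment.
    replace (RtoC (-1/8) + s * (z - RtoC (-1/8)) - (RtoC (-1/8) + t * (z - RtoC (-1/8))))%C
      with (RtoC (s - t) * (z - RtoC (-1/8)))%C
      by (rewrite RtoC_minus; ring).
    rewrite Cmod_mult, Cmod_R. reflexivity. }
  set (S := fun t => 0 <= t <= 1 /\ forall s, 0 <= s <= t -> V (segment z s)).
  assert (S0 : S 0).
  { split; [ lra | ]. intros s Hs. replace s with 0 by lra.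
    exists (1 / 16). split; [ lra | ]. intros w Hw.
    apply (local_identity f (RtoC (-1/8)) (1/16) (1/16)); try lra.
    - intros u [[U1 U2] _]. simpl in *. apply Hf. intros [_ H]. lra.
    - intros t Ht. rewrite <- RtoC_plus. apply H0. lra.
    - replace (RtoC (-1/8)) with (segment z 0) by (unfold segment; ring). exact Hw. }
  destruct (completeness S) as [T [HT1 HT2]].
  { exists 1. intros t [Ht _]. lra. }
  { exists 0. exact S0. }
  assert (T0 : 0 <= T) by (apply HT1, S0).
  assert (T1 : T <= 1) by (apply HT2; intros t [Ht _]; lra).
  destruct (DD_open (segment z T) (DD_star z T Hz (conj T0 T1))) as [r [Hr Hsq]].
  set (eta := r / (4 * (D + 1))).
  assert (Heta : 0 < eta) by (apply Rdiv_lt_0_compat; lra).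
  assert (etaD : eta * D < r / 4).
  { unfold eta. apply Rmult_lt_reg_r with (4 * (D + 1)); [ lra | ].
    replace (r / (4 * (D + 1)) * D * (4 * (D + 1))) with (r * D) by (field; lra). nra. }
  assert (Ht : exists t, S t /\ T - eta < t).
  { apply NNPP. intros N.
    assert (B : T <= T - eta); [ | lra ].
    apply HT2. intros t St. apply Rnot_lt_le. intros L. apply N. now exists t. }
  destruct Ht as [t [St Lt]].
  assert (tT : t <= T) by now apply HT1.
  destruct (proj2 St t) as [d [Hd Vd]]. { destruct St; lra. }
  assert (zero : forall w, Cmod (w - segment z t) < r / 2 -> f w = RtoC 0).
  { apply (local_identity f (segment z t) (r / 2) d); try lra.
    - intros w [W1 W2]. apply Hf, Hsq.
      assert (B : Cmod (segment z t - segment z T) <= eta * D).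
      { rewrite Hseg. apply Rmult_le_compat_r; [ assumption | ]. apply Rabs_le. lra. }
      assert (A := Cmod_coords (segment z T) (segment z t)). unfold in_rect. lra.
    - intros u Hu. apply Vd. replace (segment z t + u - segment z t)%C with (RtoC u) by ring.
      rewrite Cmod_R_pos; lra. }
  assert (grow : S (Rmin 1 (T + eta / 2))).
  { assert (M1 := Rmin_l 1 (T + eta / 2)). assert (M2 := Rmin_r 1 (T + eta / 2)).
    split. { split; [ apply Rmin_glb; lra | assumption ]. }
    intros s Hs. destruct (Rle_lt_dec s t) as [L | L]; [ apply St; lra | ].
    exists (r / 8). split; [ lra | ]. intros w Hw. apply zero.
    assert (T3 := Cmod_triangle (w - segment z s) (segment z s - segment z t)).
    replace (w - segment z s + (segment z s - segment z t))%C with (w - segment z t)%C in T3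
      by ring.
    rewrite Hseg, Rabs_pos_eq in T3 by lra.
    assert ((s - t) * D <= 3 / 2 * eta * D) by (apply Rmult_le_compat_r; lra). lra. }
  assert (E : Rmin 1 (T + eta / 2) <= T) by now apply HT1.
  assert (E1 : Rmin 1 (T + eta / 2) = 1).
  { unfold Rmin in *. destruct Rle_dec; lra. }
  rewrite E1 in grow. destruct (proj2 grow 1) as [d1 [Hd1 V1]]; [ lra | ].
  apply V1. replace (z - segment z 1)%C with (RtoC 0) by (unfold segment; ring). rewrite Cmod_0.
  exact Hd1.
Qed.

(** * Square roots *)

(** Root in the closed fourth quadrant. It is continuous on the whole plane, and it is the
    boundary value of the principal root from the lower half plane. *)
Definition CsqrtL (w : C) : C :=
  (sqrt ((Cmod w + Re w) / 2), - sqrt ((Cmod w - Re w) / 2)).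

(** Principal root, with the value from below on the negative axis. *)
Definition Csqrt (w : C) : C := if Rlt_dec 0 (Im w) then Cconj (CsqrtL w) else CsqrtL w.

Definition slit (w : C) : Prop := 0 < Re w \/ Im w <> 0.

Lemma Cmod_sqr (w : C) : Cmod w * Cmod w = Re w * Re w + Im w * Im w.
Proof. assert (H := Cmod2_alt w). simpl in *. lra. Qed.

Lemma CsqrtL_aux (w : C) : 0 <= (Cmod w + Re w) / 2 /\ 0 <= (Cmod w - Re w) / 2.
Proof.
  assert (H := re_le_Cmod w). apply Rabs_le_between in H. lra.
Qed.

Lemma Csqrt_sqr (w : C) : (Csqrt w * Csqrt w)%C = w.
Proof.
  destruct (CsqrtL_aux w) as [H1 H2].
  assert (S1 := sqrt_sqrt _ H1). assert (S2 := sqrt_sqrt _ H2).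
  set (u := sqrt ((Cmod w + Re w) / 2)) in *. set (v := sqrt ((Cmod w - Re w) / 2)) in *.
  assert (Hu : 0 <= u) by apply sqrt_pos. assert (Hv : 0 <= v) by apply sqrt_pos.
  assert (uv : u * v = Rabs (Im w) / 2).
  { unfold u, v. rewrite <- sqrt_mult by assumption.
    replace ((Cmod w + Re w) / 2 * ((Cmod w - Re w) / 2)) with (Rsqr (Im w / 2)).
    - rewrite sqrt_Rsqr_abs. unfold Rdiv. rewrite Rabs_mult, (Rabs_pos_eq (/ 2)) by lra.
      reflexivity.
    - unfold Rsqr. assert (H := Cmod_sqr w). nra. }
  unfold Csqrt. destruct Rlt_dec as [L | L].
  - rewrite Rabs_pos_eq in uv by lra.
    apply injective_projections; simpl; fold u v; [ unfold Re in *; lra | unfold Im in *; lra ].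
  - rewrite Rabs_left1 in uv by lra.
    apply injective_projections; simpl; fold u v; [ unfold Re in *; lra | unfold Im in *; lra ].
Qed.

Lemma Csqrt_Re (w : C) : Re (Csqrt w) = sqrt ((Cmod w + Re w) / 2).
Proof. unfold Csqrt. destruct Rlt_dec; reflexivity. Qed.

Lemma Csqrt_Re_pos (w : C) : slit w -> 0 < Re (Csqrt w).
Proof.
  intros Hw. rewrite Csqrt_Re. apply sqrt_lt_R0.
  assert (H := Cmod_sqr w). assert (P := Cmod_ge_0 w).
  destruct Hw as [Hw | Hw]; [ lra | ].
  assert (0 < Im w * Im w) by (apply Rsqr_pos_lt in Hw; exact Hw).
  assert (- Re w < Cmod w); [ | lra ].
  destruct (Rle_lt_dec 0 (Re w)); [ | nra ].
  assert (Cmod w <> 0); [ intros E; rewrite E in H; nra | lra ].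
Qed.

Lemma Csqrt_Re_ge0 (w : C) : 0 <= Re (Csqrt w).
Proof. rewrite Csqrt_Re. apply sqrt_pos. Qed.

Lemma CsqrtL_Csqrt (w : C) : Im w <= 0 -> CsqrtL w = Csqrt w.
Proof. intros H. unfold Csqrt. destruct Rlt_dec; [ lra | reflexivity ]. Qed.

Lemma CsqrtL_Im (w : C) : Im (CsqrtL w) <= 0.
Proof. simpl. assert (H := sqrt_pos ((Cmod w - Re w) / 2)). unfold Re in *. lra. Qed.

Lemma Csqr_eq (s t : C) : (s * s)%C = (t * t)%C -> s = t \/ s = (- t)%C.
Proof.
  intros E. destruct (Ceq_dec s t) as [H | H]; [ now left | right ].
  assert (P : ((s - t) * (s + t))%C = RtoC 0).
  { transitivity (s * s - t * t)%C; [ ring | rewrite E; ring ]. }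
  assert (N := Cminus_eq_contra s t H).
  transitivity (s + t - t)%C; [ ring | ].
  replace (s + t)%C with (/ (s - t) * ((s - t) * (s + t)))%C by (field; assumption).
  rewrite P. ring.
Qed.

Lemma Csqrt_unique (w s : C) : 0 < Re s -> (s * s)%C = w -> Csqrt w = s.
Proof.
  intros Hs E. assert (P := Csqrt_Re_ge0 w).
  destruct (Csqr_eq (Csqrt w) s) as [H | H]; [ now rewrite Csqrt_sqr, E | assumption | ].
  rewrite H in P. simpl in P. unfold Re in *. lra.
Qed.

(** The conjugate-factor identity; it gives continuity and complex differentiability of the
    root. *)
Lemma Csqrt_diff (v w : C) : slit v -> slit w ->
  (Csqrt v - Csqrt w)%C = ((v - w) * / (Csqrt v + Csqrt w))%C /\ (Csqrt v + Csqrt w)%C <> RtoC 0.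
Proof.
  intros Hv Hw. assert (P := Csqrt_Re_pos v Hv). assert (Q := Csqrt_Re_pos w Hw).
  assert (N : (Csqrt v + Csqrt w)%C <> RtoC 0).
  { intros E. assert (Re (Csqrt v + Csqrt w)%C = 0) by now rewrite E. simpl in H.
      unfold Re in *; lra. }
  split; [ | assumption ].
  rewrite <- (Csqrt_sqr v) at 2. rewrite <- (Csqrt_sqr w) at 2. field. exact N.
Qed.

Lemma locally_slit (w : C) : slit w -> locally (T := CU) w slit.
Proof.
  intros [H | H].
  - apply locally_Cmod. exists (Re w). split; [ assumption | ]. intros u Hu. left.
    assert (A := Cmod_coords w u). lra.
  - apply locally_Cmod. exists (Rabs (Im w)). split; [ now apply Rabs_pos_lt | ]. intros u Hu.
    right.
    intros E.
    assert (A := Cmod_coords w u). unfold Rabs in Hu. destruct Rcase_abs; lra.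
Qed.

Lemma cont_Csqrt (w : C) : slit w -> cont Csqrt w.
Proof.
  intros Hw. assert (P := Csqrt_Re_pos w Hw).
  destruct (proj1 (locally_Cmod w _) (locally_slit w Hw)) as [d [Hd H]].
  apply cont_eps. intros e He.
  exists (Rmin d (e * Re (Csqrt w))). split; [ apply Rmin_pos; [ assumption | nra ] | ].
  intros u Hu.
  assert (Hu1 : Cmod (u - w) < d) by (apply Rlt_le_trans with (1 := Hu), Rmin_l).
  assert (Hu2 : Cmod (u - w) < e * Re (Csqrt w)) by (apply Rlt_le_trans with (1 := Hu), Rmin_r).
  destruct (Csqrt_diff u w (H u Hu1) Hw) as [E N]. rewrite E, Cmod_mult, Cmod_inv by assumption.
  assert (Q := Csqrt_Re_ge0 u).
  assert (B : Re (Csqrt w) <= Cmod (Csqrt u + Csqrt w)).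
  { apply Rle_trans with (2 := re_le_Cmod _). apply Rle_trans with (2 := Rle_abs _).
    simpl. unfold Re in *. lra. }
  apply Rmult_lt_reg_r with (Cmod (Csqrt u + Csqrt w)); [ lra | ].
  rewrite Rmult_assoc, Rinv_l, Rmult_1_r by lra.
  apply Rlt_le_trans with (1 := Hu2). apply Rmult_le_compat_l; lra.
Qed.

Lemma continuous_Cmod (w : C) : continuous (T := CU) Cmod w.
Proof.
  apply (continuous_ext (fun z : C => sqrt (Re z * Re z + Im z * Im z))).
  { intros z. unfold Cmod, Re, Im. f_equal. ring. }
  destruct (cont_id w) as [H1 H2].
  apply (continuous_comp (fun z : C => Re z * Re z + Im z * Im z) sqrt).
  - apply (continuous_plus (V := RN)); apply (continuous_mult (K := R_AbsRing)); assumption.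
  - apply continuous_sqrt.
Qed.

Lemma cont_CsqrtL (w : C) : cont CsqrtL w.
Proof.
  destruct (cont_id w) as [H1 H2]. assert (H := continuous_Cmod w).
  split; simpl.
  - apply (continuous_comp (fun z : C => (Cmod z + Re z) / 2) sqrt); [ | apply continuous_sqrt ].
    apply (continuous_mult (K := R_AbsRing) (fun z : C => Cmod z + Re z));
      [ | apply continuous_const ].
    now apply (continuous_plus (V := RN) (Cmod : C -> R) (Re : C -> R)).
  - apply (continuous_opp (V := RN) (fun z : C => sqrt ((Cmod z - Re z) / 2))).
    apply (continuous_comp (fun z : C => (Cmod z - Re z) / 2) sqrt); [ | apply continuous_sqrt ].
    apply (continuous_mult (K := R_AbsRing) (fun z : C => Cmod z - Re z));
      [ | apply continuous_const ].
    now apply (continuous_minus (V := RN) (Cmod : C -> R) (Re : C -> R)).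
Qed.

(** * The continuation of the period integrals *)

(** Continuity in both variables jointly, as needed for integrals depending on a parameter. *)
Definition jcont {U : UniformSpace} (g : U -> R -> C) (x : U) (t : R) : Prop :=
  cont (U := prod_UniformSpace U RU) (fun p => g (fst p) (snd p)) (x, t).

Lemma jcont_section {U : UniformSpace} (g : U -> R -> C) (x : U) (t : R) :
  jcont g x t -> cont (g x) t.
Proof.
  intros H.
  apply (cont_comp (V := prod_UniformSpace U RU) (fun s : R => (x, s))
    (fun p => g (fst p) (snd p)));
    [ | exact H ].
  intros P [e He]. exists e. intros y Hy. apply He. split; [ apply ball_center | exact Hy ].
Qed.

(** Compactness of [a, b] makes the continuity in the parameter uniform. *)
Lemma uniform_param {U : UniformSpace} (g : U -> R -> C) (x : U) (a b e : R) : 0 < e ->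
  (forall t, a <= t <= b -> jcont g x t) ->
  locally x (fun y => forall t, a <= t <= b -> Cmod (g y t - g x t) < e).
Proof.
  intros He Hg.
  assert (D : forall t, exists d : posreal, a <= t <= b -> forall y s, ball x d y -> ball t d s ->
             Cmod (g y s - g x t) < e / 2).
  { intros t. destruct (classic (a <= t <= b)) as [Ht | Ht].
    - assert (He2 : 0 < e / 2) by lra.
      destruct (cont_locally _ _ _ He2 (Hg t Ht)) as [d Hd].
      exists d. intros _ y s Hy Hs. exact (Hd (y, s) (conj Hy Hs)).
    - exists (mkposreal 1 Rlt_0_1). intros; contradiction. }
  set (delta := fun t => proj1_sig (constructive_indefinite_description _ (D t))).
  assert (Hdelta : forall t, a <= t <= b -> forall y s, ball x (delta t) y -> ball t (delta t) s ->
             Cmod (g y s - g x t) < e / 2).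
  { intros t. exact (proj2_sig (constructive_indefinite_description _ (D t))). }
  destruct (compactness_value_1d a b delta) as [d Hd].
  exists d. intros y Hy t Ht. apply NNPP. intros N. apply (Hd t Ht). intros [s (Hs & Hts & Hds)].
  apply N.
  assert (Bt : ball s (delta s) t) by exact Hts.
  assert (H1 := Hdelta s Hs y t (ball_le x _ _ Hds y Hy) Bt).
  assert (H2 := Hdelta s Hs x t (ball_center x _) Bt).
  replace (g y t - g x t)%C with ((g y t - g x s) + - (g x t - g x s))%C by ring.
  apply Rle_lt_trans with (1 := Cmod_triangle _ _). rewrite Cmod_opp. lra.
Qed.

Lemma CInt_minus (f g : R -> C) (a b : R) : a <= b -> cont_on f a b -> cont_on g a b ->
  CInt (fun t => f t - g t)%C a b = (CInt f a b - CInt g a b)%C.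
Proof.
  intros Hab Hf Hg.
  transitivity (CInt (fun t => f t + (-(1)) * g t)%C a b).
  { apply CInt_ext; [ assumption | ]. intros; ring. }
  rewrite CInt_plus; try assumption.
  - rewrite CInt_scal by assumption. ring.
  - intros t Ht. prove_cont.
Qed.

Lemma cont_CInt {U : UniformSpace} (g : U -> R -> C) (x : U) (a b : R) : a <= b ->
  locally x (fun y => forall t, a <= t <= b -> jcont g y t) ->
  cont (fun y => CInt (g y) a b) x.
Proof.
  intros Hab L. assert (L0 := locally_singleton _ _ L).
  apply cont_of_locally. intros e He.
  assert (He' : 0 < e / (4 * (b - a + 1))) by (apply Rdiv_lt_0_compat; lra).
  generalize (filter_and _ _ L (uniform_param g x a b _ He' L0)). apply filter_imp.
  intros y [Hy1 Hy2].
  assert (C1 : cont_on (g y) a b) by (intros t Ht; now apply jcont_section, Hy1).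
  assert (C2 : cont_on (g x) a b) by (intros t Ht; now apply jcont_section, L0).
  rewrite <- CInt_minus by assumption.
  apply Rle_lt_trans with (2 * ((b - a) * (e / (4 * (b - a + 1))))).
  - apply CInt_norm; [ assumption | | ].
    + intros t Ht. prove_cont.
    + intros t Ht. left. now apply Hy2.
  - apply Rmult_lt_reg_r with (4 * (b - a + 1)); [ lra | ].
    replace (2 * ((b - a) * (e / (4 * (b - a + 1)))) * (4 * (b - a + 1))) with (2 * (b - a) * e)
      by (field; lra).
    nra.
Qed.

(** Caratheodory's form passes under the integral sign: the slope of the integral is the
    integral of the slopes. *)
Lemma holo_CInt (f psi : C -> R -> C) (z : C) (a b : R) : a <= b ->
  (forall t, a <= t <= b -> cont (f z) t) ->
  locally (T := CU) z (fun w => forall t, a <= t <= b -> jcont (U := CU) psi w t) ->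
  locally (T := CU) z (fun w => forall t, a <= t <= b -> f w t = (f z t + (w - z) * psi w t)%C) ->
  holo (fun w => CInt (f w) a b) z.
Proof.
  intros Hab Hf L1 L2. exists (fun w => CInt (psi w) a b). split.
  - now apply (cont_CInt (U := CU)).
  - generalize (filter_and _ _ L1 L2). apply filter_imp. intros w [H1 H2].
    rewrite (CInt_ext (f w) (fun t => f z t + (w - z) * psi w t)%C);
      [ | assumption | intros t Ht; apply H2; lra ].
    assert (Cp : cont_on (psi w) a b).
    { intros t Ht. apply (jcont_section (U := CU)). now apply H1. }
    rewrite CInt_plus; try assumption.
    + rewrite CInt_scal by assumption. ring.
    + intros t Ht. prove_cont.
Qed.

(** Let r^2 = 1 + 4 z. This is (1 + r cos t) (1 - r cos t), written without the choice of
    r. *)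
Definition radicand (z : C) (t : R) : C := (RtoC 1 - (1 + 4 * z) * RtoC (cos t * cos t))%C.
(** sqrt (1 + r cos t) + sqrt (1 - r cos t), obtained from its square. The argument q is
    the branch of the root: Csqrt inside the slit plane, CsqrtL for the extension to its
    upper edge. *)
Definition root_sum (q : C -> C) (z : C) (t : R) : C := q (RtoC 2 + 2 * q (radicand z t))%C.
(** An integration by parts in I_0 leads to this integrand, which stays bounded on the cut. *)
Definition per0_fun (q : C -> C) (z : C) (t : R) : C :=
  (RtoC (4 * (cos t * cos t)) * / root_sum q z t)%C.
Definition per2_fun (q : C -> C) (z : C) (t : R) : C := (RtoC (sin t * sin t) * root_sum q z t)%C.
Definition per0 (q : C -> C) (z : C) : C := CInt (per0_fun q z) 0 (PI / 2).
Definition per2 (q : C -> C) (z : C) : C := CInt (per2_fun q z) 0 (PI / 2).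

(** Why the continuation exists on all of DD: the radicand meets (-oo, 0] only if z >= 0. *)
Lemma slit_radicand (z : C) (t : R) : DD z -> slit (radicand z t).
Proof.
  intros Hz. destruct z as [x y]. unfold slit, radicand, DD in *. simpl in *.
  assert (C2 := Rle_0_sqr (cos t)). assert (S2 := sin2_cos2 t). unfold Rsqr in *.
  assert (P := Rle_0_sqr (sin t)). unfold Rsqr in P.
  destruct (Req_dec y 0) as [-> | Hy].
  - left. assert (x < 0) by (apply Rnot_le_lt; intros H; apply Hz; now split).
    destruct (Req_dec (cos t) 0) as [E | N]; [ rewrite E in *; lra | ].
    assert (0 < cos t * cos t) by (apply Rsqr_pos_lt in N; exact N). nra.
  - destruct (Req_dec (cos t) 0) as [E | N]; [ left; rewrite E in *; lra | right ].
    assert (0 < cos t * cos t) by (apply Rsqr_pos_lt in N; exact N).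
    intros E. assert (y * (cos t * cos t) = 0) by lra.
    apply Rmult_integral in H0. destruct H0; lra.
Qed.

Lemma slit_outer (s : C) : 0 <= Re s -> slit (RtoC 2 + 2 * s)%C.
Proof. intros H. left. simpl. unfold Re in *. lra. Qed.

Lemma slit_root_sum (z : C) (t : R) : slit (RtoC 2 + 2 * Csqrt (radicand z t))%C.
Proof. apply slit_outer, Csqrt_Re_ge0. Qed.

Lemma Csqrt_neq0 (w : C) : slit w -> Csqrt w <> RtoC 0.
Proof. intros H E. assert (P := Csqrt_Re_pos w H). rewrite E in P. simpl in P. lra. Qed.

Lemma root_sum_neq0 (z : C) (t : R) : root_sum Csqrt z t <> RtoC 0.
Proof. apply Csqrt_neq0, slit_root_sum. Qed.

Lemma jcont_real (h : R -> R) (z : C) (t : R) : continuous h t ->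
  jcont (U := CU) (fun _ s => RtoC (h s)) z t.
Proof.
  intros H. split; simpl.
  - apply (continuous_comp (fun p : C * R => snd p) h); [ apply continuous_snd | exact H ].
  - apply continuous_const.
Qed.

Ltac smooth := apply (ex_derive_continuous (V := RN)); auto_derive; try exact I.

Lemma jcont_fst (z : C) (t : R) : jcont (U := CU) (fun w _ => w) z t.
Proof.
  apply (cont_comp (V := CU) (fun p : C * R => fst p) (fun w => w)).
  - apply continuous_fst.
  - apply cont_id.
Qed.

Lemma jcont_const (k z : C) (t : R) : jcont (U := CU) (fun _ _ => k) z t.
Proof. apply cont_const. Qed.

Lemma jcont_plus (f g : C -> R -> C) (z : C) (t : R) : jcont (U := CU) f z t ->
  jcont (U := CU) g z t -> jcont (U := CU) (fun w s => f w s + g w s)%C z t.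
Proof. apply cont_plus. Qed.

Lemma jcont_mult (f g : C -> R -> C) (z : C) (t : R) : jcont (U := CU) f z t ->
  jcont (U := CU) g z t -> jcont (U := CU) (fun w s => f w s * g w s)%C z t.
Proof. apply cont_mult. Qed.

Lemma jcont_inv (f : C -> R -> C) (z : C) (t : R) : jcont (U := CU) f z t ->
  f z t <> RtoC 0 -> jcont (U := CU) (fun w s => / f w s)%C z t.
Proof. intros H N. exact (cont_inv _ _ H N). Qed.

Lemma jcont_comp (q : C -> C) (f : C -> R -> C) (z : C) (t : R) : jcont (U := CU) f z t ->
  cont q (f z t) -> jcont (U := CU) (fun w s => q (f w s)) z t.
Proof.
  intros H Hq.
  apply (cont_comp (V := CU) (fun p : C * R => f (fst p) (snd p)) q); [ | exact Hq ].
  now apply cont_continuous.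
Qed.

Lemma jcont_opp (f : C -> R -> C) (z : C) (t : R) : jcont (U := CU) f z t ->
  jcont (U := CU) (fun w s => - f w s)%C z t.
Proof. apply cont_opp. Qed.

Lemma jcont_snd (f : R -> C) (z : C) (t : R) : cont f t -> jcont (U := CU) (fun _ s => f s) z t.
Proof.
  intros Hf. apply (cont_comp (V := RU) (fun p : C * R => snd p) f);
    [ apply continuous_snd | exact Hf ].
Qed.

Ltac prove_jcont :=
  repeat first [ solve [ auto ] | match goal with
  | |- jcont (fun _ _ => ?k) _ _ => apply jcont_const
  | |- jcont (fun w _ => w) _ _ => apply jcont_fst
  | |- jcont (fun _ s => RtoC (@?h s)) _ _ => apply (jcont_real h); smooth
  | |- jcont (fun w s => (@?f w s - @?g w s)%C) _ _ => apply (jcont_plus f (fun w s => - g w s)%C)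
  | |- jcont (fun w s => (@?f w s + @?g w s)%C) _ _ => apply (jcont_plus f g)
  | |- jcont (fun w s => (@?f w s * @?g w s)%C) _ _ => apply (jcont_mult f g)
  | |- jcont (fun w s => (- @?f w s)%C) _ _ => apply (jcont_opp f)
  | |- jcont (fun _ s => @?f s) _ _ => apply (jcont_snd f)
  end ].

Lemma jcont_radicand (z : C) (t : R) : jcont (U := CU) radicand z t.
Proof. unfold radicand. prove_jcont. Qed.

Lemma jcont_root_sum (q : C -> C) (z : C) (t : R) :
  cont q (radicand z t) -> cont q (RtoC 2 + 2 * q (radicand z t))%C
    -> jcont (U := CU) (root_sum q) z t.
Proof.
  intros H1 H2. apply (jcont_comp q (fun w s => RtoC 2 + 2 * q (radicand w s))%C); [ | exact H2 ].
  prove_jcont. apply jcont_comp; [ apply jcont_radicand | exact H1 ].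
Qed.

Lemma jcont_root_sum_Csqrt (z : C) (t : R) : DD z -> jcont (U := CU) (root_sum Csqrt) z t.
Proof.
  intros Hz. apply jcont_root_sum; apply cont_Csqrt;
    [ now apply slit_radicand | apply slit_root_sum ].
Qed.

(** (root_sum w - root_sum z) / (w - z), by two applications of the conjugate-factor
    identity. *)
Definition root_sum_slope (z w : C) (t : R) : C :=
  (RtoC (-8 * (cos t * cos t)) * (/ (Csqrt (radicand w t) + Csqrt (radicand z t)) * /
    (root_sum Csqrt w t + root_sum Csqrt z t)))%C.

Lemma root_sum_slope_eq (z w : C) (t : R) : DD z -> DD w ->
  root_sum Csqrt w t = (root_sum Csqrt z t + (w - z) * root_sum_slope z w t)%C.
Proof.
  intros Hz Hw.
  destruct (Csqrt_diff (radicand w t) (radicand z t) (slit_radicand w t Hw) (slit_radicand z t Hz))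
    as [E1 N1].
  destruct (Csqrt_diff _ _ (slit_root_sum w t) (slit_root_sum z t)) as [E2 N2].
  fold (root_sum Csqrt w t) (root_sum Csqrt z t) in E2, N2.
  replace (RtoC 2 + 2 * Csqrt (radicand w t) - (RtoC 2 + 2 * Csqrt (radicand z t)))%C
    with (2 * (Csqrt (radicand w t) - Csqrt (radicand z t)))%C in E2 by ring.
  rewrite E1 in E2.
  transitivity (root_sum Csqrt z t + (root_sum Csqrt w t - root_sum Csqrt z t))%C; [ ring | ].
  rewrite E2.
  unfold root_sum_slope. f_equal. unfold radicand at 1 2.
  replace (-8 * (cos t * cos t)) with (- (2 * (4 * (cos t * cos t)))) by ring.
  rewrite RtoC_opp, (RtoC_mult 2), (RtoC_mult 4).
  ring.
Qed.

Lemma jcont_root_sum_slope (z w : C) (t : R) : DD z -> DD w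
  -> jcont (U := CU) (root_sum_slope z) w t.
Proof.
  intros Hz Hw.
  destruct (Csqrt_diff (radicand w t) (radicand z t) (slit_radicand w t Hw) (slit_radicand z t Hz))
    as [_ N1].
  destruct (Csqrt_diff _ _ (slit_root_sum w t) (slit_root_sum z t)) as [_ N2].
  assert (HW : forall v, DD v -> jcont (U := CU) (fun v s => Csqrt (radicand v s)) v t).
  { intros v Hv. apply jcont_comp; [ apply jcont_radicand | apply cont_Csqrt, slit_radicand, Hv ]. }
  assert (HB := jcont_root_sum_Csqrt w t Hw).
  assert (HWz := jcont_section (U := CU) _ _ _ (HW z Hz)).
  assert (HBz := jcont_section (U := CU) _ _ _ (jcont_root_sum_Csqrt z t Hz)).
  unfold root_sum_slope. prove_jcont.
  - apply (jcont_inv (fun v s => Csqrt (radicand v s) + Csqrt (radicand z s))%C);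
      [ prove_jcont | exact N1 ].
  - apply (jcont_inv (fun v s => root_sum Csqrt v s + root_sum Csqrt z s)%C);
      [ prove_jcont | exact N2 ].
Qed.

Lemma PI2_ge0 : 0 <= PI / 2.
Proof. generalize PI_RGT_0; lra. Qed.

Lemma holo_per2 (z : C) : DD z -> holo (per2 Csqrt) z.
Proof.
  intros Hz.
  apply (holo_CInt (per2_fun Csqrt) (fun w t => RtoC (sin t * sin t) * root_sum_slope z w t)%C);
    [ apply PI2_ge0 | | | ].
  - intros t _. apply (jcont_section (U := CU)). assert (HB := jcont_root_sum_Csqrt z t Hz).
    unfold per2_fun. prove_jcont.
  - apply filter_imp with (2 := locally_DD z Hz). intros w Hw t _.
    assert (HS := jcont_root_sum_slope z w t Hz Hw).
    prove_jcont.
  - apply filter_imp with (2 := locally_DD z Hz). intros w Hw t _.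
    unfold per2_fun. rewrite (root_sum_slope_eq z w t Hz Hw). ring.
Qed.

Lemma jcont_per0_fun (q : C -> C) (z : C) (t : R) : jcont (U := CU) (root_sum q) z t ->
  root_sum q z t <> RtoC 0 -> jcont (U := CU) (per0_fun q) z t.
Proof. intros HB N. unfold per0_fun. prove_jcont. now apply jcont_inv. Qed.

Lemma jcont_per0_fun_Csqrt (z : C) (t : R) : DD z -> jcont (U := CU) (per0_fun Csqrt) z t.
Proof. intros Hz. apply jcont_per0_fun; [ now apply jcont_root_sum_Csqrt | apply root_sum_neq0 ].
Qed.

Lemma holo_per0 (z : C) : DD z -> holo (per0 Csqrt) z.
Proof.
  intros Hz.
  apply (holo_CInt (per0_fun Csqrt) (fun w t => - / root_sum Csqrt z t *
    (per0_fun Csqrt w t * root_sum_slope z w t))%C); [ apply PI2_ge0 | | | ].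
  - intros t _. apply (jcont_section (U := CU)). now apply jcont_per0_fun_Csqrt.
  - apply filter_imp with (2 := locally_DD z Hz). intros w Hw t _.
    assert (HB := jcont_section (U := CU) _ _ _ (jcont_root_sum_Csqrt z t Hz)).
    assert (H0 := jcont_per0_fun_Csqrt w t Hw). assert (HS := jcont_root_sum_slope z w t Hz Hw).
    prove_jcont. prove_cont. apply (cont_inv (U := RU)); [ exact HB | apply root_sum_neq0 ].
  - apply filter_imp with (2 := locally_DD z Hz). intros w Hw t _.
    assert (E := root_sum_slope_eq z w t Hz Hw).
    assert (N1 := root_sum_neq0 z t). assert (N2 := root_sum_neq0 w t).
    unfold per0_fun. rewrite <- (Cmult_1_r (/ root_sum Csqrt z t)) at 1.
    transitivity (RtoC (4 * (cos t * cos t)) *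
      (/ root_sum Csqrt z t - / root_sum Csqrt z t * / root_sum Csqrt w t *
        ((w - z) * root_sum_slope z w t)))%C.
    2: ring.
    replace ((w - z) * root_sum_slope z w t)%C with (root_sum Csqrt w t - root_sum Csqrt z t)%C
      by (rewrite E; ring).
    f_equal. field. split; assumption.
Qed.

(** * The integrals over the oval *)

(** x^2 on the oval; the sign makes x increase with t on both sides. *)
Definition oval_u (s : side) (r t : R) : R := 1 - sgn s * r * cos t.

Lemma oval_u_pos (s : side) (r t : R) : 0 < r < 1 -> 0 < oval_u s r t.
Proof.
  intros Hr. unfold oval_u. generalize (COS_bound t). intros Hc.
  assert (- r <= r * cos t <= r) by nra.
  destruct s; simpl; nra.
Qed.

Lemma cos_PI_x (t : R) : cos (PI - t) = - cos t.
Proof. replace (PI - t) with (- t + PI) by ring. now rewrite neg_cos, cos_neg. Qed.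

Lemma RInt_fold (F : R -> R) : (forall t, continuous F t) ->
  RInt F 0 PI = RInt (fun t => F t + F (PI - t)) 0 (PI / 2).
Proof.
  intros HF.
  assert (ex : forall a b, ex_RInt F a b).
  { intros a b. apply (ex_RInt_continuous (V := RCN)). intros; apply HF. }
  assert (HG : forall t, continuous (fun t => F (PI - t)) t).
  { intros t. apply (continuous_comp (fun t => PI - t) F); [ | apply HF ].
    apply (continuous_minus (V := RN) (fun _ => PI) (fun t => t));
      [ apply continuous_const | apply continuous_id ]. }
  assert (exG : ex_RInt (fun t => F (PI - t)) 0 (PI / 2)).
  { apply (ex_RInt_continuous (V := RCN)). intros; apply HG. }
  rewrite (RInt_plus (V := RCN) F (fun t => F (PI - t))); [ | apply ex | exact exG ].
  rewrite <- (RInt_Chasles F 0 (PI / 2) PI (ex _ _) (ex _ _)). f_equal.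
  assert (E := RInt_comp (V := RCN) F (fun t => PI - t) (fun _ => -1) 0 (PI / 2)).
  cbv beta in E.
  rewrite (RInt_scal (V := RCN) (fun t => F (PI - t))) in E by exact exG.
  replace (PI - PI / 2) with (PI / 2) in E by field. rewrite Rminus_0_r in E.
  rewrite <- (opp_RInt_swap F PI (PI / 2) (ex _ _)).
  rewrite <- E.
  - unfold opp, scal; simpl; unfold mult; simpl. ring.
  - intros; apply HF.
  - intros x _. split; [ auto_derive; [ exact I | ring ] | apply continuous_const ].
Qed.

(** Substitution x = sgn s * sqrt (oval_u s r t), under which y = r sin t / sqrt 2. *)
Lemma I_param (s : side) (i : nat) (h r : R) : 0 < r < 1 -> r * r = 1 + 4 * h ->
  I_ s i h = (1 + 4 * h) / sqrt 2 *
    RInt (fun t => sin t * sin t * ((sgn s * sqrt (oval_u s r t)) ^ i * / sqrt (oval_u s r t))) 0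
      PI.
Proof.
  intros Hr Er.
  assert (Es : sqrt (1 + 4 * h) = r) by (rewrite <- Er; apply sqrt_square; lra).
  assert (sgn2 : sgn s * sgn s = 1) by (destruct s; simpl; ring).
  set (g := fun t => sgn s * sqrt (oval_u s r t)).
  set (dg := fun t => r * sin t / (2 * sqrt (oval_u s r t))).
  assert (Hu : forall t, 0 < oval_u s r t) by (intros; now apply oval_u_pos).
  assert (Hsq : forall t, sqrt (oval_u s r t) <> 0)
    by (intros t; assert (P := sqrt_lt_R0 _ (Hu t)); lra).
  assert (Hg : forall t, is_derive g t (dg t)).
  { intros t. unfold g, dg. assert (P := Hu t). assert (N := Hsq t). unfold oval_u in *.
    auto_derive; [ exact P | ]. replace (1 + - (sgn s * r * cos t)) with (1 - sgn s * r * cos t)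
      by ring.
    transitivity (sgn s * sgn s * (r * sin t / (2 * sqrt (1 - sgn s * r * cos t))));
      [ field; exact N | ].
    rewrite sgn2. ring. }
  assert (Cu : forall t, continuous (fun t => oval_u s r t) t).
  { intros t. apply (ex_derive_continuous (V := RN)). unfold oval_u. auto_derive. exact I. }
  assert (Csu : forall t, continuous (fun t => sqrt (oval_u s r t)) t).
  { intros t. apply (continuous_comp (fun t => oval_u s r t) sqrt);
      [ apply Cu | apply continuous_sqrt ]. }
  assert (Cdg : forall t, continuous dg t).
  { intros t. apply (ex_derive_continuous (V := RN)). unfold dg. assert (P := Hu t).
      assert (N := Hsq t). unfold oval_u in *.
    auto_derive. replace (1 + - (sgn s * r * cos t)) with (1 - sgn s * r * cos t) by ring.
    split; [ assumption | split; [ lra | exact I ] ]. }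
  assert (ends : x_min s h = g 0 /\ x_max s h = g PI).
  { unfold g, oval_u, x_min, x_max. rewrite Es, cos_0, cos_PI. destruct s; simpl.
    - rewrite !Rmult_1_l. split; f_equal; ring.
    - replace (1 - -1 * r * 1) with (1 + r) by ring. replace (1 - -1 * r * -1) with (1 - r) by ring.
      split; ring. }
  destruct ends as [Emin Emax].
  set (f := fun x => x ^ i * y_arc h x).
  assert (Cf : forall x, continuous f x).
  { intros x. apply (continuous_mult (K := R_AbsRing) (fun x => x ^ i) (y_arc h)).
    - smooth.
    - unfold y_arc. apply (continuous_comp (fun x => 2 * h + x ^ 2 - x ^ 4 / 2) sqrt);
        [ | apply continuous_sqrt ].
      smooth. }
  assert (exf : forall a b, ex_RInt f a b).
  { intros a b. apply (ex_RInt_continuous (V := RCN)). intros; apply Cf. }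
  assert (E1 : I_ s i h = 2 * RInt f (g 0) (g PI)).
  { unfold I_. rewrite Emin, Emax.
    rewrite (RInt_ext (fun x => x ^ i * - y_arc h x) (fun x => opp (f x))).
    - rewrite (RInt_opp (V := RCN) f) by apply exf.
      rewrite (opp_RInt_swap f) by apply exf. fold f. ring.
    - intros x _. unfold f, opp; simpl. ring. }
  rewrite E1.
  rewrite <- (RInt_comp (V := RCN) f g dg 0 PI);
    [ | intros; apply Cf | intros; split; [ apply Hg | apply Cdg ] ].
  assert (S2 : sqrt 2 <> 0) by (assert (P := sqrt_lt_R0 2); lra).
  assert (CF : forall t, continuous (fun t => sin t * sin t *
    ((sgn s * sqrt (oval_u s r t)) ^ i * / sqrt (oval_u s r t))) t).
  { intros t. apply (ex_derive_continuous (V := RN)). assert (P := Hu t). assert (N := Hsq t).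
      unfold oval_u in *.
    auto_derive. replace (1 + - (sgn s * r * cos t)) with (1 - sgn s * r * cos t) by ring.
    repeat split; assumption. }
  rewrite (RInt_ext _ (fun t => scal ((1 + 4 * h) / (2 * sqrt 2))
    (sin t * sin t * ((sgn s * sqrt (oval_u s r t)) ^ i * / sqrt (oval_u s r t))))).
  - rewrite (RInt_scal (V := RCN)).
    + unfold scal; simpl; unfold mult; simpl. field. exact S2.
    + apply (ex_RInt_continuous (V := RCN)). intros; apply CF.
  - intros t. rewrite Rmin_left, Rmax_right by (generalize PI_RGT_0; lra). intros Ht.
    assert (Hy : y_arc h (g t) = r * sin t / sqrt 2).
    { unfold y_arc. assert (G2 : g t ^ 2 = oval_u s r t).
      { unfold g. simpl. rewrite Rmult_1_r.
        transitivity (sgn s * sgn s * (sqrt (oval_u s r t) * sqrt (oval_u s r t))); [ ring | ].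
        rewrite sgn2, sqrt_sqrt by (left; apply Hu). ring. }
      replace (g t ^ 4) with (g t ^ 2 * g t ^ 2) by ring. rewrite G2.
      assert (SC := sin2_cos2 t). unfold Rsqr in SC.
      replace (2 * h + oval_u s r t - oval_u s r t * oval_u s r t / 2)
        with ((r * sin t) * (r * sin t) / 2).
      - rewrite sqrt_div by (try lra; apply Rle_0_sqr). rewrite sqrt_square; [ reflexivity | ].
        apply Rmult_le_pos; [ lra | ]. apply sin_ge_0; lra.
      - unfold oval_u. replace (2 * h) with ((r * r - 1) / 2) by lra.
        replace (r * sin t * (r * sin t)) with (r * r * (sin t * sin t)) by ring.
        replace (sin t * sin t) with (1 - cos t * cos t) by lra.
        replace (1 - sgn s * r * cos t - (1 - sgn s * r * cos t) * (1 - sgn s * r * cos t) / 2)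
          with (1 / 2 - (sgn s * sgn s) * (r * r * (cos t * cos t)) / 2) by field.
        transitivity (r * r * (1 - cos t * cos t) / 2); [ reflexivity | ].
        assert (X : (r * r - 1) / 2 + (1 / 2 - sgn s * sgn s * (r * r * (cos t * cos t)) / 2)
          = r * r * (1 - cos t * cos t) / 2).
        { rewrite sgn2. field. }
        rewrite <- X. field. }
    unfold f, dg. rewrite Hy. rewrite <- Er. fold (g t). unfold scal; simpl; unfold mult; simpl.
    field. split; [ apply Hsq | exact S2 ].
Qed.

Definition root_p (r t : R) : R := sqrt (1 + r * cos t).
Definition root_m (r t : R) : R := sqrt (1 - r * cos t).

Lemma root_pm_facts (r t : R) : 0 < r < 1 ->
  0 < 1 + r * cos t /\ 0 < 1 - r * cos t /\ 0 < root_p r t /\ 0 < root_m r t /\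
  root_p r t * root_p r t = 1 + r * cos t /\ root_m r t * root_m r t = 1 - r * cos t.
Proof.
  intros Hr. generalize (COS_bound t). intros Hc.
  assert (- r <= r * cos t <= r) by nra.
  unfold root_p, root_m. repeat split; try (apply sqrt_lt_R0); try (apply sqrt_sqrt); lra.
Qed.

Ltac smooth_rpm r t Hr := apply (ex_derive_continuous (V := RN));
  destruct (root_pm_facts r t Hr) as (?H & ?H & ?H & ?H & _); unfold root_p, root_m in *;
  auto_derive; unfold Rminus in *; repeat split; try assumption; lra.

(** Both square roots taken by Csqrt have positive real part, which identifies them. *)
Lemma root_sum_real (h r t : R) : 0 < r < 1 -> r * r = 1 + 4 * h ->
  root_sum Csqrt (RtoC h) t = RtoC (root_p r t + root_m r t).
Proof.
  intros Hr Er. destruct (root_pm_facts r t Hr) as (H1 & H2 & H3 & H4 & H5 & H6).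
  unfold root_sum.
  assert (EW : Csqrt (radicand (RtoC h) t) = RtoC (root_p r t * root_m r t)).
  { apply Csqrt_unique.
    - simpl. nra.
    - unfold radicand. rewrite <- RtoC_mult. rewrite <- RtoC_mult, <- RtoC_plus, <- RtoC_mult,
        <- RtoC_minus.
      f_equal. rewrite <- Er.
      transitivity ((root_p r t * root_p r t) * (root_m r t * root_m r t));
        [ ring | rewrite H5, H6; ring ]. }
  rewrite EW. apply Csqrt_unique.
  - simpl. lra.
  - rewrite <- !RtoC_mult, <- RtoC_plus. f_equal.
    transitivity (root_p r t * root_p r t + root_m r t * root_m r t
      + 2 * (root_p r t * root_m r t)); [ ring | rewrite H5, H6; ring ].
Qed.

Lemma CInt_real (F : R -> R) (a b : R) : CInt (fun t => RtoC (F t)) a b = RtoC (RInt F a b).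
Proof.
  unfold CInt. apply injective_projections; simpl; [ reflexivity | ].
  rewrite RInt_const. unfold scal; simpl; unfold mult; simpl. ring.
Qed.

Lemma oval_radius (h : R) : -1/4 < h < 0 -> exists r, 0 < r < 1 /\ r * r = 1 + 4 * h.
Proof.
  intros Hh. exists (sqrt (1 + 4 * h)). split; [ | apply sqrt_sqrt; lra ].
  split; [ apply sqrt_lt_R0; lra | ]. rewrite <- sqrt_1 at 2. apply sqrt_lt_1; lra.
Qed.

(** Integration by parts with sin t (root_p - root_m), which vanishes at both ends, trades
    1 / root_p + 1 / root_m for 4 cos^2 t / (root_p + root_m). *)
Lemma I_0_eq (s : side) (h : R) : -1/4 < h < 0 ->
  RtoC (I_ s 0 h) = (RtoC ((1 + 4 * h) / sqrt 2) * per0 Csqrt (RtoC h))%C.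
Proof.
  intros Hh. destruct (oval_radius h Hh) as (r & Hr & Er).
  assert (Hf := root_pm_facts r).
  unfold per0.
  rewrite (CInt_ext _ (fun t => RtoC (4 * (cos t * cos t) * / (root_p r t + root_m r t)))).
  2: apply PI2_ge0.
  2: { intros t _. unfold per0_fun. rewrite (root_sum_real h r t Hr Er), <- RtoC_inv, <- RtoC_mult.
       - reflexivity.
       - destruct (Hf t Hr); lra. }
  rewrite CInt_real, <- RtoC_mult. f_equal.
  rewrite (I_param s 0 h r Hr Er). f_equal.
  rewrite RInt_fold.
  2: { intros t. apply (ex_derive_continuous (V := RN)).
       assert (P := oval_u_pos s r t Hr). assert (N := sqrt_lt_R0 _ P). unfold oval_u in *.
       simpl. auto_derive. replace (1 + - (sgn s * r * cos t)) with (1 - sgn s * r * cos t) by ring.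
       repeat split; try assumption; lra. }
  assert (ex1 : ex_RInt (fun t => sin t * sin t * (/ root_p r t + / root_m r t)) 0 (PI / 2)).
  { apply (ex_RInt_continuous (V := RCN)). intros t _. smooth_rpm r t Hr. }
  assert (ex2 : ex_RInt (fun t => 4 * (cos t * cos t) * / (root_p r t + root_m r t)) 0 (PI / 2)).
  { apply (ex_RInt_continuous (V := RCN)). intros t _. smooth_rpm r t Hr. }
  transitivity (RInt (fun t => sin t * sin t * (/ root_p r t + / root_m r t)) 0 (PI / 2)).
  { apply RInt_ext. intros t _. unfold oval_u, root_p, root_m. rewrite sin_PI_x, cos_PI_x.
    destruct s; simpl.
    - replace (1 - 1 * r * cos t) with (1 - r * cos t) by ring.
      replace (1 - 1 * r * - cos t) with (1 + r * cos t) by ring. ring.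
    - replace (1 - -1 * r * cos t) with (1 + r * cos t) by ring.
      replace (1 - -1 * r * - cos t) with (1 - r * cos t) by ring. ring. }
  assert (P : is_RInt (fun t => r / 2 * (4 * (cos t * cos t) * / (root_p r t + root_m r t) - sin t *
    sin t * (/ root_p r t + / root_m r t))) 0 (PI / 2)
     (minus (sin (PI / 2) * (root_p r (PI / 2) - root_m r (PI / 2)))
       (sin 0 * (root_p r 0 - root_m r 0)))).
  { apply (is_RInt_derive (fun t => sin t * (root_p r t - root_m r t))).
    - intros t _. destruct (Hf t Hr) as (H1 & H2 & H3 & H4 & H5 & H6).
      assert (X : cos t * (root_p r t - root_m r t)
        = r / 2 * (4 * (cos t * cos t) * / (root_p r t + root_m r t))).
      { apply Rmult_eq_reg_r with (root_p r t + root_m r t); [ | lra ].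
        transitivity (cos t * (root_p r t * root_p r t - root_m r t * root_m r t)); [ ring | ].
        rewrite H5, H6. field. lra. }
      replace (r / 2 * (4 * (cos t * cos t) * / (root_p r t + root_m r t) - sin t * sin t *
        (/ root_p r t + / root_m r t)))
        with (cos t * (root_p r t - root_m r t) - r / 2 *
          (sin t * sin t * (/ root_p r t + / root_m r t))) by (rewrite X; ring).
      unfold root_p, root_m in *. auto_derive; [ unfold Rminus in *; tauto | ].
      replace (1 + - (r * cos t)) with (1 - r * cos t) by ring. field. lra.
    - intros t _. smooth_rpm r t Hr. }
  apply (is_RInt_unique (V := RCN)) in P.
  replace (minus (sin (PI / 2) * (root_p r (PI / 2) - root_m r (PI / 2)))
    (sin 0 * (root_p r 0 - root_m r 0))) with 0 in P.
  2: { unfold root_p, root_m. rewrite cos_PI2, sin_0, Rmult_0_r. unfold minus, plus, opp; simpl.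
         rewrite Rplus_0_r, Rminus_0_r. ring. }
  rewrite (RInt_scal (V := RCN) (fun t => 4 * (cos t * cos t) * / (root_p r t + root_m r t) - sin t
    * sin t * (/ root_p r t + / root_m r t))) in P.
  2: now apply (ex_RInt_minus (V := RN)).
  rewrite (RInt_minus (V := RCN) (fun t => 4 * (cos t * cos t) * / (root_p r t + root_m r t))) in P
    by assumption.
  unfold scal, minus, plus, opp in P; simpl in P; unfold mult in P; simpl in P.
  apply Rmult_integral in P. destruct P as [P | P]; lra.
Qed.

Lemma I_2_eq (s : side) (h : R) : -1/4 < h < 0 ->
  RtoC (I_ s 2 h) = (RtoC ((1 + 4 * h) / sqrt 2) * per2 Csqrt (RtoC h))%C.
Proof.
  intros Hh. destruct (oval_radius h Hh) as (r & Hr & Er).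
  assert (Hf := root_pm_facts r).
  unfold per2.
  rewrite (CInt_ext _ (fun t => RtoC (sin t * sin t * (root_p r t + root_m r t)))).
  2: apply PI2_ge0.
  2: { intros t _. unfold per2_fun. rewrite (root_sum_real h r t Hr Er), <- RtoC_mult. reflexivity.
         }
  rewrite CInt_real, <- RtoC_mult. f_equal.
  rewrite (I_param s 2 h r Hr Er). f_equal.
  rewrite RInt_fold.
  2: { intros t. apply (ex_derive_continuous (V := RN)).
       assert (P := oval_u_pos s r t Hr). assert (N := sqrt_lt_R0 _ P). unfold oval_u in *.
       simpl. auto_derive. replace (1 + - (sgn s * r * cos t)) with (1 - sgn s * r * cos t) by ring.
       repeat split; try assumption; lra. }
  apply RInt_ext. intros t _.
  assert (E : forall u, 0 < u -> (sgn s * sqrt u) ^ 2 * / sqrt u = sqrt u).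
  { intros u Hu. assert (N := sqrt_lt_R0 _ Hu). destruct s; simpl; field; lra. }
  rewrite !E by now apply oval_u_pos.
  unfold oval_u, root_p, root_m. rewrite sin_PI_x, cos_PI_x.
  destruct s; simpl.
  - replace (1 - 1 * r * cos t) with (1 - r * cos t) by ring.
    replace (1 - 1 * r * - cos t) with (1 + r * cos t) by ring. ring.
  - replace (1 - -1 * r * cos t) with (1 + r * cos t) by ring.
    replace (1 - -1 * r * - cos t) with (1 - r * cos t) by ring. ring.
Qed.

Lemma I_1_eq (s : side) : exists k : R, forall h, -1/4 < h < 0 ->
  I_ s 1 h = (1 + 4 * h) / sqrt 2 * k.
Proof.
  exists (RInt (fun t => sin t * sin t * sgn s) 0 PI).
  intros h Hh. destruct (oval_radius h Hh) as (r & Hr & Er).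
  rewrite (I_param s 1 h r Hr Er). f_equal. apply RInt_ext. intros t _.
  assert (P := oval_u_pos s r t Hr). assert (N := sqrt_lt_R0 _ P). simpl. field. lra.
Qed.

(** * Two complete elliptic integrals *)

Lemma is_derive_RInt_of (f df : R -> R -> R) (a b x : R) :
  locally x (fun u => forall t, is_derive (fun v => f v t) u (df u t)) ->
  (forall t, continuity_2d_pt df x t) ->
  locally x (fun u => forall t, continuous (f u) t) ->
  is_derive (fun u => RInt (f u) a b) x (RInt (df x) a b).
Proof.
  intros L1 C2 L2.
  assert (L0 := locally_singleton _ _ L1).
  rewrite <- (RInt_ext (fun t => Derive (fun u => f u t) x) (df x) a b).
  - apply is_derive_RInt_param.
    + apply filter_imp with (2 := L1). intros u Hu t _. exists (df u t). apply Hu.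
    + intros t _. apply continuity_2d_pt_ext_loc with df; [ | apply C2 ].
      destruct L1 as [d Hd]. exists d. intros u v Hu _. symmetry. apply is_derive_unique.
      now apply Hd.
    + apply filter_imp with (2 := L2). intros u Hu.
      apply (ex_RInt_continuous (V := RCN)). intros t _; apply Hu.
  - intros t _. apply is_derive_unique, L0.
Qed.

Definition Delta (n t : R) : R := sqrt (1 - n * (sin t * sin t)).
Definition ell0_fun (n t : R) : R := cos t * cos t * (1 - 2 * n * (sin t * sin t)) / Delta n t.
Definition ell2_fun (n t : R) : R := sin t * sin t * (cos t * cos t) * Delta n t.
Definition ell0_dfun (n t : R) : R :=
  cos t * cos t * (sin t * sin t) * (-3 + 2 * n * (sin t * sin t)) /
    (2 * (Delta n t * Delta n t * Delta n t)).
Definition ell2_dfun (n t : R) : R := - (sin t * sin t * (sin t * sin t) * (cos t * cos t)) /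
  (2 * Delta n t).
(** Both integrals arise from the boundary values on the cut; n is the parameter, the
    square of the modulus. *)
Definition ell0 (n : R) : R := RInt (ell0_fun n) 0 (PI / 2).
Definition ell2 (n : R) : R := RInt (ell2_fun n) 0 (PI / 2).

Lemma sin2_le1 (t : R) : 0 <= sin t * sin t <= 1.
Proof.
  assert (H := sin2_cos2 t). assert (P := Rle_0_sqr (sin t)). assert (Q := Rle_0_sqr (cos t)).
  unfold Rsqr in *. lra.
Qed.

Lemma Delta_facts (n t : R) : n < 1 -> 0 < 1 - n * (sin t * sin t) /\ 0 < Delta n t /\
  Delta n t * Delta n t = 1 - n * (sin t * sin t).
Proof.
  intros Hn. assert (H := sin2_le1 t).
  assert (P : 0 < 1 - n * (sin t * sin t)).
  { destruct (Rle_lt_dec n 0); nra. }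
  split; [ exact P | ]. split; [ now apply sqrt_lt_R0 | apply sqrt_sqrt; lra ].
Qed.

Lemma locally_lt1 (n : R) : n < 1 -> locally n (fun u => u < 1).
Proof. intros H. apply (open_lt 1). exact H. Qed.

Lemma derive_ell0_fun (n t : R) : n < 1 -> is_derive (fun v => ell0_fun v t) n (ell0_dfun n t).
Proof.
  intros Hn. destruct (Delta_facts n t Hn) as (H1 & H2 & H3). unfold ell0_fun, ell0_dfun.
  unfold Delta in *.
  auto_derive.
  - replace (1 + - (n * (sin t * sin t))) with (1 - n * (sin t * sin t)) by ring. lra.
  - replace (1 + - (n * (sin t * sin t))) with (1 - n * (sin t * sin t)) by ring.
    set (q := sqrt (1 - n * (sin t * sin t))) in *. set (s := sin t * sin t) in *.
    field_simplify_eq; [ | lra ].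
    replace (q ^ 2) with (1 - n * s) by (rewrite <- H3; ring). ring.
Qed.

Lemma derive_ell2_fun (n t : R) : n < 1 -> is_derive (fun v => ell2_fun v t) n (ell2_dfun n t).
Proof.
  intros Hn. destruct (Delta_facts n t Hn) as (H1 & H2 & H3). unfold ell2_fun, ell2_dfun.
  unfold Delta in *.
  auto_derive.
  - replace (1 + - (n * (sin t * sin t))) with (1 - n * (sin t * sin t)) by ring. lra.
  - replace (1 + - (n * (sin t * sin t))) with (1 - n * (sin t * sin t)) by ring. field. lra.
Qed.

Lemma Delta_continuous_2d (n t : R) : n < 1 -> continuity_2d_pt Delta n t.
Proof.
  intros Hn. unfold Delta.
  apply (continuity_1d_2d_pt_comp sqrt (fun n t => 1 - n * (sin t * sin t))).
  - apply continuity_pt_filterlim. apply continuous_sqrt.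
  - apply continuity_2d_pt_minus; [ apply continuity_2d_pt_const | ].
    apply continuity_2d_pt_mult; [ apply continuity_2d_pt_id1 | ].
    apply (continuity_1d_2d_pt_comp (fun t => sin t * sin t) (fun _ t => t));
      [ | apply continuity_2d_pt_id2 ].
    apply continuity_pt_mult; apply continuity_sin.
Qed.

Lemma fun2_continuous_2d (f : R -> R) (n t : R) : continuous f t
  -> continuity_2d_pt (fun _ s => f s) n t.
Proof.
  intros H. apply (continuity_1d_2d_pt_comp f (fun _ t => t)); [ | apply continuity_2d_pt_id2 ].
  now apply continuity_pt_filterlim.
Qed.

Lemma ell0_dfun_continuous_2d (n t : R) : n < 1 -> continuity_2d_pt ell0_dfun n t.
Proof.
  intros Hn. destruct (Delta_facts n t Hn) as (H1 & H2 & H3). unfold ell0_dfun, Rdiv.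
  assert (Q := Delta_continuous_2d n t Hn).
  apply continuity_2d_pt_mult; [ apply continuity_2d_pt_mult | ].
  - apply (fun2_continuous_2d (fun t => cos t * cos t * (sin t * sin t))).
    smooth.
  - apply continuity_2d_pt_plus; [ apply continuity_2d_pt_const | ].
    apply continuity_2d_pt_mult; [ apply continuity_2d_pt_mult;
      [ apply continuity_2d_pt_const | apply continuity_2d_pt_id1 ] | ].
    apply (fun2_continuous_2d (fun t => sin t * sin t)).
    smooth.
  - apply continuity_2d_pt_inv.
    + apply continuity_2d_pt_mult; [ apply continuity_2d_pt_const | ].
      apply continuity_2d_pt_mult; [ apply continuity_2d_pt_mult | ]; assumption.
    + assert (0 < Delta n t * Delta n t * Delta n t)
        by (repeat apply Rmult_lt_0_compat; assumption). lra.
Qed.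

Lemma ell2_dfun_continuous_2d (n t : R) : n < 1 -> continuity_2d_pt ell2_dfun n t.
Proof.
  intros Hn. destruct (Delta_facts n t Hn) as (H1 & H2 & H3). unfold ell2_dfun, Rdiv.
  assert (Q := Delta_continuous_2d n t Hn).
  apply continuity_2d_pt_mult.
  - apply (fun2_continuous_2d (fun t => - (sin t * sin t * (sin t * sin t) * (cos t * cos t)))).
    smooth.
  - apply continuity_2d_pt_inv; [ | lra ].
    apply continuity_2d_pt_mult; [ apply continuity_2d_pt_const | assumption ].
Qed.

Lemma continuous_section (f : R -> R -> R) (n t : R) : continuity_2d_pt f n t -> continuous (f n) t.
Proof.
  intros H. apply filterlim_locally. intros e. destruct (H e) as [d Hd]. exists d. intros s Hs.
  apply Hd; [ rewrite Rminus_diag, Rabs_R0; apply d | exact Hs ].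
Qed.

Lemma ell0_fun_continuous_2d (n t : R) : n < 1 -> continuity_2d_pt ell0_fun n t.
Proof.
  intros Hn. destruct (Delta_facts n t Hn) as (H1 & H2 & H3). unfold ell0_fun, Rdiv.
  apply continuity_2d_pt_mult; [ apply continuity_2d_pt_mult | ].
  - apply (fun2_continuous_2d (fun t => cos t * cos t)). smooth.
  - apply continuity_2d_pt_minus; [ apply continuity_2d_pt_const | ].
    apply continuity_2d_pt_mult; [ apply continuity_2d_pt_mult;
      [ apply continuity_2d_pt_const | apply continuity_2d_pt_id1 ] | ].
    apply (fun2_continuous_2d (fun t => sin t * sin t)). smooth.
  - apply continuity_2d_pt_inv; [ now apply Delta_continuous_2d | lra ].
Qed.

Lemma ell2_fun_continuous_2d (n t : R) : n < 1 -> continuity_2d_pt ell2_fun n t.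
Proof.
  intros Hn. apply continuity_2d_pt_mult; [ | now apply Delta_continuous_2d ].
  apply (fun2_continuous_2d (fun t => sin t * sin t * (cos t * cos t))). smooth.
Qed.

Lemma ex_RInt_cont (f : R -> R) (a b : R) : (forall t, continuous f t) -> ex_RInt f a b.
Proof. intros H. apply (ex_RInt_continuous (V := RCN)). intros; apply H. Qed.

Lemma RInt_comb3 (x y z : R) (f g h : R -> R) (a b : R) :
  (forall t, continuous f t) -> (forall t, continuous g t) -> (forall t, continuous h t) ->
  RInt (fun t => x * f t + y * g t + z * h t) a b = x * RInt f a b + y * RInt g a b
    + z * RInt h a b.
Proof.
  intros Hf Hg Hh.
  assert (S : forall c k, (forall t, continuous k t) -> ex_RInt (fun t => c * k t) a b).
  { intros c k Hk. apply (ex_RInt_scal (V := RN)). now apply ex_RInt_cont. }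
  rewrite (RInt_plus (V := RCN) (fun t => x * f t + y * g t) (fun t => z * h t)).
  - rewrite (RInt_plus (V := RCN) (fun t => x * f t) (fun t => y * g t)) by now apply S.
    rewrite (RInt_scal (V := RCN) f), (RInt_scal (V := RCN) g),
      (RInt_scal (V := RCN) h) by now apply ex_RInt_cont.
    reflexivity.
  - apply (ex_RInt_plus (V := RN)); now apply S.
  - now apply S.
Qed.

(** The Picard-Fuchs relations below are obtained in this form. *)
Lemma exact_relation (F f g h : R -> R) (x y z a b : R) :
  (forall t, continuous f t) -> (forall t, continuous g t) -> (forall t, continuous h t) ->
  (forall t, is_derive F t (x * f t + y * g t + z * h t)) -> F a = F b ->
  x * RInt f a b + y * RInt g a b + z * RInt h a b = 0.
Proof.
  intros Hf Hg Hh HF E. rewrite <- RInt_comb3 by assumption.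
  transitivity (minus (F b) (F a)); [ | rewrite E; exact (minus_eq_zero (F b)) ].
  apply (is_RInt_unique (V := RCN)).
  apply (is_RInt_derive F); intros t _; [ apply HF | ].
  apply (continuous_plus (V := RN) (fun t => x * f t + y * g t) (fun t => z * h t)).
  - apply (continuous_plus (V := RN) (fun t => x * f t) (fun t => y * g t));
      apply (continuous_scal_r (V := RN)); auto.
  - apply (continuous_scal_r (V := RN)); auto.
Qed.

Lemma cos4_eq (t : R) : cos t * cos t = 1 - sin t * sin t.
Proof. assert (H := sin2_cos2 t). unfold Rsqr in H. lra. Qed.

(** The difference of the two sides is the integral of the derivative of sin t cos^3 t
    (1-(n/2)sin^2 t)/Delta, which vanishes at 0 and at PI/2. *)
Lemma ell0_derive (n : R) : n < 1 -> is_derive ell0 n ((- ell0 n + 5 / 2 * ell2 n) / (1 - n)).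
Proof.
  intros Hn.
  assert (E : (- ell0 n + 5 / 2 * ell2 n) / (1 - n) = RInt (ell0_dfun n) 0 (PI / 2)).
  { assert (X : (1 - n) * RInt (ell0_dfun n) 0 (PI / 2) + 1 * RInt (ell0_fun n) 0 (PI / 2)
      + (- 5 / 2) * RInt (ell2_fun n) 0 (PI / 2) = 0).
    { apply (exact_relation (fun t => sin t * (cos t * cos t * cos t) *
        (1 - n / 2 * (sin t * sin t)) / Delta n t));
        [ intros; now apply continuous_section, ell0_dfun_continuous_2d | intros;
          now apply continuous_section, ell0_fun_continuous_2d
        | intros; now apply continuous_section, ell2_fun_continuous_2d | | ].
      - intros t. destruct (Delta_facts n t Hn) as (H1 & H2 & H3).
        unfold ell0_fun, ell2_fun, ell0_dfun. unfold Delta in *.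
        auto_derive.
        + unfold Rminus in *. repeat split; try assumption; lra.
        + replace (1 + - (n * (sin t * sin t))) with (1 - n * (sin t * sin t)) by ring.
          set (q := sqrt (1 - n * (sin t * sin t))) in *.
          assert (C := cos4_eq t).
          field_simplify_eq; [ | lra ].
          replace (q ^ 4) with ((q * q) * (q * q)) by ring.
          replace (q ^ 3) with ((q * q) * q) by ring.
          replace (q ^ 2) with (q * q) by ring. rewrite H3.
          replace (cos t ^ 4) with ((cos t * cos t) * (cos t * cos t)) by ring.
          replace (cos t ^ 3) with ((cos t * cos t) * cos t) by ring.
          replace (cos t ^ 2) with (cos t * cos t) by ring. rewrite C. ring.
      - rewrite sin_0, cos_PI2. unfold Rdiv. ring. }
    unfold ell0, ell2. apply Rmult_eq_reg_r with (1 - n); [ | lra ].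
    unfold Rdiv at 1. rewrite Rmult_assoc, Rinv_l, Rmult_1_r by lra. lra. }
  rewrite E. unfold ell0. apply is_derive_RInt_of.
  - apply filter_imp with (2 := locally_lt1 n Hn). intros u Hu t. now apply derive_ell0_fun.
  - intros t. now apply ell0_dfun_continuous_2d.
  - apply filter_imp with (2 := locally_lt1 n Hn). intros u Hu t.
    now apply continuous_section, ell0_fun_continuous_2d.
Qed.

(** As for ell0, with the exact term - sin t cos^3 t Delta / 2. *)
Lemma ell2_derive (n : R) : 0 < n < 1 -> is_derive ell2 n ((ell0 n / 2 - 2 * ell2 n) / n).
Proof.
  intros [Hn0 Hn].
  assert (E : (ell0 n / 2 - 2 * ell2 n) / n = RInt (ell2_dfun n) 0 (PI / 2)).
  { assert (X : n * RInt (ell2_dfun n) 0 (PI / 2) + (- 1 / 2) * RInt (ell0_fun n) 0 (PI / 2)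
      + 2 * RInt (ell2_fun n) 0 (PI / 2) = 0).
    { apply (exact_relation (fun t => - 1 / 2 * (sin t * (cos t * cos t * cos t) * Delta n t)));
        [ intros; now apply continuous_section, ell2_dfun_continuous_2d | intros;
          now apply continuous_section, ell0_fun_continuous_2d
        | intros; now apply continuous_section, ell2_fun_continuous_2d | | ].
      - intros t. destruct (Delta_facts n t Hn) as (H1 & H2 & H3).
        unfold ell0_fun, ell2_fun, ell2_dfun. unfold Delta in *.
        auto_derive.
        + unfold Rminus in *. repeat split; assumption.
        + replace (1 + - (n * (sin t * sin t))) with (1 - n * (sin t * sin t)) by ring.
          set (q := sqrt (1 - n * (sin t * sin t))) in *.
          assert (C := cos4_eq t).
          field_simplify_eq; [ | lra ].
          replace (q ^ 2) with (q * q) by ring. rewrite H3.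
          replace (cos t ^ 4) with ((cos t * cos t) * (cos t * cos t)) by ring.
          replace (cos t ^ 3) with ((cos t * cos t) * cos t) by ring.
          replace (cos t ^ 2) with (cos t * cos t) by ring. rewrite C. ring.
      - rewrite sin_0, cos_PI2. unfold Rdiv. ring. }
    unfold ell0, ell2. apply Rmult_eq_reg_r with n; [ | lra ].
    unfold Rdiv at 1. rewrite Rmult_assoc, Rinv_l, Rmult_1_r by lra. lra. }
  rewrite E. unfold ell2. apply is_derive_RInt_of.
  - apply filter_imp with (2 := locally_lt1 n Hn). intros u Hu t. now apply derive_ell2_fun.
  - intros t. now apply ell2_dfun_continuous_2d.
  - apply filter_imp with (2 := locally_lt1 n Hn). intros u Hu t.
    now apply continuous_section, ell2_fun_continuous_2d.
Qed.

Lemma ell0_pos (n : R) : 0 < n < 1 / 2 -> 0 < ell0 n.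
Proof.
  intros Hn. apply RInt_gt_0; [ generalize PI_RGT_0; lra | | intros;
    apply continuous_section, ell0_fun_continuous_2d; lra ].
  intros t Ht. destruct (Delta_facts n t) as (_ & H2 & _); [ lra | ].
  assert (P := cos_gt_0 t ltac:(lra) ltac:(lra)). assert (Q := sin2_le1 t).
  unfold ell0_fun. apply Rdiv_lt_0_compat; [ | exact H2 ].
  apply Rmult_lt_0_compat; [ now apply Rmult_lt_0_compat | nra ].
Qed.

Lemma ell2_pos (n : R) : 0 < n < 1 -> 0 < ell2 n.
Proof.
  intros Hn. apply RInt_gt_0; [ generalize PI_RGT_0; lra | | intros;
    apply continuous_section, ell2_fun_continuous_2d; lra ].
  intros t Ht. destruct (Delta_facts n t) as (_ & H2 & _); [ lra | ].
  assert (P := cos_gt_0 t ltac:(lra) ltac:(lra)).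
  assert (Q := sin_gt_0 t ltac:(lra) ltac:(generalize PI_RGT_0; lra)).
  unfold ell2_fun. repeat apply Rmult_lt_0_compat; assumption.
Qed.

Lemma ell2_le (n : R) : 0 < n <= 1 / 4 -> ell2 n <= 2 * ell0 n.
Proof.
  intros Hn.
  replace (2 * ell0 n) with (RInt (fun t => 2 * ell0_fun n t) 0 (PI / 2)).
  2: { apply (RInt_scal (V := RCN) (ell0_fun n)). apply ex_RInt_cont.
         intros; apply continuous_section, ell0_fun_continuous_2d; lra. }
  apply RInt_le; [ generalize PI_RGT_0; lra | | | ].
  - apply ex_RInt_cont. intros; apply continuous_section, ell2_fun_continuous_2d; lra.
  - apply ex_RInt_cont. intros t. apply (continuous_scal_r (V := RN)).
    apply continuous_section, ell0_fun_continuous_2d; lra.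
  - intros t _. destruct (Delta_facts n t) as (H1 & H2 & H3); [ lra | ]. assert (Q := sin2_le1 t).
    assert (P : 0 <= cos t * cos t) by (rewrite cos4_eq; lra).
    unfold ell0_fun, ell2_fun. apply Rmult_le_reg_r with (Delta n t); [ exact H2 | ].
    replace (2 * (cos t * cos t * (1 - 2 * n * (sin t * sin t)) / Delta n t) * Delta n t)
      with (cos t * cos t * (2 - 4 * n * (sin t * sin t))) by (field; lra).
    replace (sin t * sin t * (cos t * cos t) * Delta n t * Delta n t)
      with (cos t * cos t * (sin t * sin t * (Delta n t * Delta n t))) by ring.
    apply Rmult_le_compat_l; [ exact P | ]. rewrite H3.
    assert (0 <= n * (sin t * sin t) <= 1 / 4) by nra. nra.
Qed.

(** * Concavity of their ratio *)

(** (r - 1) / (2 r) with r = sqrt (1 + 4 h); it grows from 0 to 1/2 on the cut. *)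
Definition ell_parameter (h : R) : R := (1 - / sqrt (1 + 4 * h)) / 2.
Definition ratio (h : R) : R := 2 * ell_parameter h / (1 - 2 * ell_parameter h) *
  (ell2 (ell_parameter h) / ell0 (ell_parameter h)).

Lemma ell_parameter_facts (h : R) : 0 < h -> 0 < ell_parameter h < 1 / 2
  /\ h * ((1 - 2 * ell_parameter h) * (1 - 2 * ell_parameter h))
    = ell_parameter h * (1 - ell_parameter h) /\
  is_derive ell_parameter h ((1 - 2 * ell_parameter h) * (1 - 2 * ell_parameter h) *
    (1 - 2 * ell_parameter h)).
Proof.
  intros Hh. unfold ell_parameter.
  assert (E : sqrt (1 + 4 * h) * sqrt (1 + 4 * h) = 1 + 4 * h) by (apply sqrt_sqrt; lra).
  assert (P : 1 < sqrt (1 + 4 * h)) by (rewrite <- sqrt_1 at 1; apply sqrt_lt_1; lra).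
  set (r := sqrt (1 + 4 * h)) in *.
  assert (I1 : / r < 1) by (rewrite <- Rinv_1; apply Rinv_lt_contravar; lra).
  assert (I0 : 0 < / r) by (apply Rinv_0_lt_compat; lra).
  split; [ lra | split ].
  - replace h with ((r * r - 1) / 4) by lra. field. lra.
  - auto_derive; fold r; [ split; [ lra | split; [ lra | exact I ] ] | field; lra ].
Qed.

(** The linear system for ell0 and ell2 becomes a Riccati equation for their ratio. *)
Lemma ratio_derive (h : R) : 0 < h ->
  is_derive ratio h ((4 * h + (8 * h - 4) * ratio h - 5 * (ratio h * ratio h)) /
    (4 * h * (4 * h + 1))).
Proof.
  intros Hh. destruct (ell_parameter_facts h Hh) as (H1 & H2 & H3).
  set (n := ell_parameter h) in *.
  assert (J0 := ell0_pos n H1). assert (J2 := ell2_pos n ltac:(lra)).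
  assert (D0 := ell0_derive n ltac:(lra)). assert (D2 := ell2_derive n ltac:(lra)).
  set (F := fun n => 2 * n / (1 - 2 * n) * (ell2 n / ell0 n)).
  assert (DF : is_derive F n (2 / ((1 - 2 * n) * (1 - 2 * n)) * (ell2 n / ell0 n) +
     2 * n / (1 - 2 * n) * ((((ell0 n / 2 - 2 * ell2 n) / n) * ell0 n - ell2 n *
       ((- ell0 n + 5 / 2 * ell2 n) / (1 - n))) / (ell0 n * ell0 n)))).
  { unfold F. auto_derive.
    - repeat split; try lra. now exists ((ell0 n / 2 - 2 * ell2 n) / n).
      now exists ((- ell0 n + 5 / 2 * ell2 n) / (1 - n)).
    - rewrite (is_derive_unique (fun x : R => ell2 x : R) _ _ D2),
        (is_derive_unique (fun x : R => ell0 x : R) _ _ D0). field. repeat split; lra. }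
  assert (DC := is_derive_comp F ell_parameter h _ _ DF H3). fold n in DC.
  change (fun x => F (ell_parameter x)) with ratio in DC.
  refine (eq_ind _ (fun l => is_derive ratio h l) DC _ _).
  unfold scal; simpl; unfold mult; simpl. unfold ratio. fold n.
  assert (Eh : h = n * (1 - n) / ((1 - 2 * n) * (1 - 2 * n))).
  { rewrite <- H2. field. lra. }
  rewrite Eh. field. repeat split; nra.
Qed.

Lemma ratio_pos (h : R) : 0 < h -> 0 < ratio h.
Proof.
  intros Hh. destruct (ell_parameter_facts h Hh) as (H1 & _ & _). unfold ratio.
  apply Rmult_lt_0_compat; apply Rdiv_lt_0_compat; try lra;
    [ apply ell2_pos; lra | now apply ell0_pos ].
Qed.

Lemma ratio_small (h : R) : 0 < h <= 3 / 4 -> ratio h <= 16 * h.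
Proof.
  intros Hh. destruct (ell_parameter_facts h) as (H1 & H2 & _); [ lra | ].
  assert (N4 : ell_parameter h <= 1 / 4).
  { unfold ell_parameter. assert (sqrt (1 + 4 * h) <= 2).
    { replace 2 with (sqrt (2 * 2)) by (apply sqrt_square; lra). apply sqrt_le_1; lra. }
    assert (/ 2 <= / sqrt (1 + 4 * h)) by (apply Rinv_le_contravar;
      [ apply sqrt_lt_R0; lra | assumption ]). lra. }
  set (n := ell_parameter h) in *.
  assert (n <= 2 * h).
  { assert ((1 - 2 * n) * (1 - 2 * n) <= 1) by nra.
    assert (h * ((1 - 2 * n) * (1 - 2 * n)) <= h * 1) by (apply Rmult_le_compat_l; lra). nra. }
  assert (J0 := ell0_pos n H1). assert (J := ell2_le n ltac:(lra)).
  assert (Q : ell2 n / ell0 n <= 2).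
  { apply Rmult_le_reg_r with (ell0 n); [ exact J0 | ]. unfold Rdiv.
      rewrite Rmult_assoc, Rinv_l by lra. lra. }
  assert (Q0 : 0 < ell2 n / ell0 n) by (apply Rdiv_lt_0_compat; [ apply ell2_pos; lra | exact J0 ]).
  assert (Pn : 2 * n / (1 - 2 * n) <= 4 * n).
  { apply Rmult_le_reg_r with (1 - 2 * n); [ lra | ]. unfold Rdiv.
      rewrite Rmult_assoc, Rinv_l by lra. nra. }
  assert (Pn0 : 0 < 2 * n / (1 - 2 * n)) by (apply Rdiv_lt_0_compat; lra).
  unfold ratio. fold n.
  apply Rle_trans with (4 * n * 2); [ | lra ].
  apply Rmult_le_compat; lra.
Qed.

Lemma is_derive_continuity (f : R -> R) (x l : R) : is_derive f x l -> continuity_pt f x.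
Proof.
  intros H. apply continuity_pt_filterlim. apply (ex_derive_continuous (V := RN)). now exists l.
Qed.

Lemma is_derive_sign (f : R -> R) (x l : R) : is_derive f x l -> f x = 0 -> 0 < l ->
  exists d, 0 < d /\ (forall y, x < y < x + d -> 0 < f y) /\ (forall y, x - d < y < x -> f y < 0).
Proof.
  intros H H0 Hl. apply is_derive_Reals in H.
  destruct (H (l / 2) ltac:(lra)) as [d Hd]. exists d. split; [ apply cond_pos | ].
  assert (K : forall y, y <> x -> Rabs (y - x) < d -> l / 2 < f y / (y - x)).
  { intros y Hy Hb. specialize (Hd (y - x) ltac:(lra) Hb).
    replace (x + (y - x)) with y in Hd by ring. rewrite H0, Rminus_0_r in Hd.
    apply Rabs_lt_between in Hd. lra. }
  split; intros y Hy.
  - specialize (K y ltac:(lra)). rewrite Rabs_pos_eq in K by lra. specialize (K ltac:(lra)).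
    assert (E : f y = f y / (y - x) * (y - x)) by (field; lra). rewrite E.
    apply Rmult_lt_0_compat; lra.
  - specialize (K y ltac:(lra)). rewrite Rabs_left in K by lra. specialize (K ltac:(lra)).
    assert (E : f y = f y / (y - x) * (y - x)) by (field; lra). rewrite E. nra.
Qed.

(** At the last point of [x, h1] where u is not negative, u would vanish and, by the sign
    of its derivative, be positive just after. *)
Lemma barrier (u u' : R -> R) (h1 : R) : (forall x, 0 < x -> is_derive u x (u' x)) ->
  (forall x, 0 < x -> u x = 0 -> 0 < u' x) -> 0 < h1 -> u h1 <= 0 ->
  forall x, 0 < x < h1 -> u x < 0.
Proof.
  intros Hd Hz H1 Hu x Hx. apply Rnot_le_lt. intros Hux.
  assert (Hh2 : exists h2, x < h2 <= h1 /\ u h2 < 0).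
  { destruct Hu as [Hu | Hu]; [ exists h1; lra | ].
    destruct (is_derive_sign u h1 _ (Hd h1 H1) Hu (Hz h1 H1 Hu)) as (d & Hd0 & _ & Hl).
    exists (Rmax ((x + h1) / 2) (h1 - d / 2)).
    assert (A := Rmax_l ((x + h1) / 2) (h1 - d / 2)).
    assert (B := Rmax_r ((x + h1) / 2) (h1 - d / 2)).
    assert (C : Rmax ((x + h1) / 2) (h1 - d / 2) < h1) by (apply Rmax_lub_lt; lra).
    split; [ lra | apply Hl; lra ]. }
  destruct Hh2 as (h2 & Hh2 & Hu2).
  destruct (completeness (fun y => x <= y <= h2 /\ 0 <= u y)) as [y [Hy1 Hy2]].
  { exists h2. intros y [Hy _]. lra. }
  { exists x. split; lra. }
  assert (xy : x <= y) by (apply Hy1; split; lra).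
  assert (yh : y <= h2) by (apply Hy2; intros z [Hz0 _]; lra).
  assert (Cy := is_derive_continuity u y _ (Hd y ltac:(lra))).
  assert (Huy : u y = 0).
  { destruct (Rtotal_order (u y) 0) as [L | [E | G]]; [ | exact E | ].
    - exfalso.
      destruct (Cy (- u y) ltac:(lra)) as (d & Hd0 & Hc).
      assert (B : y <= y - d / 2); [ | lra ].
      apply Hy2. intros z [Hz1 Hz2]. apply Rnot_lt_le. intros Lz.
      assert (zy : z <= y) by (apply Hy1; split; assumption).
      destruct (Req_dec z y) as [-> | N]; [ lra | ].
      specialize (Hc z). unfold dist in Hc; simpl in Hc. unfold R_dist in Hc.
      assert (Rabs (u z - u y) < - u y).
      { apply Hc. split; [ split; [ exact I | lra ] | ]. rewrite Rabs_left; lra. }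
      apply Rabs_lt_between in H. lra.
    - exfalso.
      assert (yh' : y < h2) by (destruct yh as [? | ->]; lra).
      destruct (Cy (u y) G) as (d & Hd0 & Hc).
      set (z := Rmin ((y + h2) / 2) (y + d / 2)).
      assert (A := Rmin_l ((y + h2) / 2) (y + d / 2)).
      assert (B := Rmin_r ((y + h2) / 2) (y + d / 2)).
      assert (C : y < z) by (apply Rmin_glb_lt; lra). fold z in A, B.
      specialize (Hc z). unfold dist in Hc; simpl in Hc. unfold R_dist in Hc.
      assert (Rabs (u z - u y) < u y).
      { apply Hc. split; [ split; [ exact I | lra ] | ]. rewrite Rabs_pos_eq; lra. }
      apply Rabs_lt_between in H.
      assert (z <= y) by (apply Hy1; split; lra). lra. }
  assert (yh' : y < h2) by (destruct yh as [? | ->]; lra).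
  destruct (is_derive_sign u y _ (Hd y ltac:(lra)) Huy (Hz y ltac:(lra) Huy)) as (d & Hd0 & Hr & _).
  set (z := Rmin ((y + h2) / 2) (y + d / 2)).
  assert (A := Rmin_l ((y + h2) / 2) (y + d / 2)). assert (B := Rmin_r ((y + h2) / 2) (y + d / 2)).
  assert (C : y < z) by (apply Rmin_glb_lt; lra). fold z in A, B.
  assert (0 < u z) by (apply Hr; lra).
  assert (z <= y) by (apply Hy1; split; lra). lra.
Qed.

Definition ratio1 (h : R) : R :=
  (4 * h + (8 * h - 4) * ratio h - 5 * (ratio h * ratio h)) / (4 * h * (4 * h + 1)).
Definition ratio2 (h : R) : R :=
  (4 + 8 * ratio h - ratio1 h * (24 * h + 8 + 10 * ratio h)) / (4 * h * (4 * h + 1)).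
Definition ratio3 (h : R) : R :=
  (- ratio1 h * (16 + 10 * ratio1 h) - ratio2 h * (56 * h + 12 + 10 * ratio h)) /
    (4 * h * (4 * h + 1)).

Lemma ratio1_derive (h : R) : 0 < h -> is_derive ratio1 h (ratio2 h).
Proof.
  intros Hh. assert (D := ratio_derive h Hh). fold (ratio1 h) in D.
  unfold ratio1. auto_derive.
  - repeat split; try (now exists (ratio1 h)). nra.
  - rewrite (is_derive_unique (fun x : R => ratio x : R) _ _ D). unfold ratio2, ratio1. field.
    repeat split; lra.
Qed.

Lemma ratio2_derive (h : R) : 0 < h -> is_derive ratio2 h (ratio3 h).
Proof.
  intros Hh. assert (D := ratio_derive h Hh). fold (ratio1 h) in D.
  assert (D1 := ratio1_derive h Hh).
  unfold ratio2. auto_derive.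
  - repeat split; try (now exists (ratio1 h)); try (now exists (ratio2 h)). nra.
  - rewrite (is_derive_unique (fun x : R => ratio x : R) _ _ D),
      (is_derive_unique (fun x : R => ratio1 x : R) _ _ D1).
    unfold ratio3, ratio2. field. repeat split; lra.
Qed.

Lemma decreasing_of_derive (f f' : R -> R) (a b : R) : a < b ->
  (forall x, a <= x <= b -> is_derive f x (f' x)) -> (forall x, a <= x <= b -> f' x < 0)
    -> f b < f a.
Proof.
  intros Hab Hd Hn.
  destruct (MVT_gen f a b f') as (c & Hc & E).
  - intros x. rewrite Rmin_left, Rmax_right by lra. intros Hx. apply Hd; lra.
  - intros x. rewrite Rmin_left, Rmax_right by lra. intros Hx.
    apply is_derive_continuity with (f' x). now apply Hd.
  - rewrite Rmin_left, Rmax_right in Hc by lra. specialize (Hn c Hc). nra.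
Qed.

(** At a zero of ratio1 the Riccati equation gives ratio2 > 0. So if ratio1 were not
    positive at h, it would be negative on (0, h), and ratio would decrease there although
    it is positive and tends to 0 at 0. *)
Lemma ratio1_pos (h : R) : 0 < h -> 0 < ratio1 h.
Proof.
  intros Hh. apply Rnot_le_lt. intros H1.
  assert (N : forall x, 0 < x < h -> ratio1 x < 0).
  { apply (barrier ratio1 ratio2 h); try assumption; [ apply ratio1_derive | ].
    intros x Hx E. unfold ratio2. rewrite E. assert (P := ratio_pos x Hx).
    apply Rdiv_lt_0_compat; nra. }
  assert (P := ratio_pos (h / 2) ltac:(lra)).
  (* At this x the bound 16 x for ratio x is below ratio (h / 2). *)
  set (x := Rmin (Rmin (h / 4) (3 / 4)) (ratio (h / 2) / 32)).
  assert (X1 : x <= h / 4) by (apply Rle_trans with (1 := Rmin_l _ _), Rmin_l).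
  assert (X2 : x <= 3 / 4) by (apply Rle_trans with (1 := Rmin_l _ _), Rmin_r).
  assert (X3 : x <= ratio (h / 2) / 32) by apply Rmin_r.
  assert (X0 : 0 < x) by (repeat apply Rmin_pos; lra).
  assert (L := decreasing_of_derive ratio ratio1 x (h / 2) ltac:(lra)
    ltac:(intros; apply ratio_derive; lra) ltac:(intros; apply N; lra)).
  assert (S := ratio_small x ltac:(lra)). lra.
Qed.

(** At a zero of ratio2 one has ratio3 < 0. So if ratio2 were not negative at h, it would
    be positive on (0, h). Then ratio2 x * x^2 would decrease on (0, h), although it tends
    to 0 at 0. *)
Lemma ratio2_neg (h : R) : 0 < h -> ratio2 h < 0.
Proof.
  intros Hh. apply Rnot_le_lt. intros H1.
  assert (Pos : forall x, 0 < x < h -> 0 < ratio2 x).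
  { intros x Hx. apply Ropp_lt_cancel. rewrite Ropp_0.
    apply (barrier (fun x => - ratio2 x) (fun x => - ratio3 x) h); try lra.
    - intros y Hy. apply (is_derive_opp (V := RN) ratio2). now apply ratio2_derive.
    - intros y Hy E. assert (E0 : ratio2 y = 0) by lra. unfold ratio3. rewrite E0.
      assert (P := ratio1_pos y Hy).
      replace (- ((- ratio1 y * (16 + 10 * ratio1 y) - 0 * (56 * y + 12 + 10 * ratio y)) /
        (4 * y * (4 * y + 1))))
        with (ratio1 y * (16 + 10 * ratio1 y) / (4 * y * (4 * y + 1))) by (field; lra).
      apply Rdiv_lt_0_compat; apply Rmult_lt_0_compat; lra. }
  set (k := ratio2 (h / 2) * (h / 2 * (h / 2))).
  assert (Hk : 0 < k) by (unfold k; assert (P := Pos (h / 2) ltac:(lra)); apply Rmult_lt_0_compat;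
    [ exact P | apply Rmult_lt_0_compat; lra ]).
  (* As ratio x <= 16 x, the product ratio2 x * x^2 is at most (1 + 32 x) / (1 + 4 x) * x,
     hence at most 13 x and so at most k. *)
  set (x := Rmin (Rmin (h / 4) (3 / 4)) (k / 13)).
  assert (X1 : x <= h / 4) by (apply Rle_trans with (1 := Rmin_l _ _), Rmin_l).
  assert (X2 : x <= 3 / 4) by (apply Rle_trans with (1 := Rmin_l _ _), Rmin_r).
  assert (X3 : x <= k / 13) by apply Rmin_r.
  assert (X0 : 0 < x) by (repeat apply Rmin_pos; lra).
  assert (L : ratio2 (h / 2) * (h / 2 * (h / 2)) < ratio2 x * (x * x)).
  { apply (decreasing_of_derive (fun y => ratio2 y * (y * y)) (fun y => ratio3 y * (y * y)
      + ratio2 y * (2 * y))); [ lra | | ].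
    - intros y Hy. assert (D := ratio2_derive y ltac:(lra)).
      auto_derive; [ now exists (ratio3 y) | ].
      rewrite (is_derive_unique (fun x : R => ratio2 x : R) _ _ D). ring.
    - intros y Hy. assert (P1 := ratio1_pos y ltac:(lra)). assert (P2 := Pos y ltac:(lra)).
      assert (P0 := ratio_pos y ltac:(lra)).
      unfold ratio3.
      replace ((- ratio1 y * (16 + 10 * ratio1 y) - ratio2 y * (56 * y + 12 + 10 * ratio y)) /
        (4 * y * (4 * y + 1)) * (y * y) + ratio2 y * (2 * y))
        with (- ((ratio1 y * (16 + 10 * ratio1 y) + ratio2 y * (24 * y + 4 + 10 * ratio y)) *
          (y * y) / (4 * y * (4 * y + 1)))) by (field; lra).
      apply Ropp_lt_gt_0_contravar. apply Rlt_gt. apply Rdiv_lt_0_compat; [ | nra ].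
      apply Rmult_lt_0_compat; [ | nra ]. apply Rplus_lt_0_compat; apply Rmult_lt_0_compat; lra. }
  fold k in L.
  assert (B : ratio2 x * (x * x) <= 13 * x).
  { assert (P1 := ratio1_pos x X0). assert (P0 := ratio_pos x X0).
      assert (S := ratio_small x ltac:(lra)).
    unfold ratio2.
    replace ((4 + 8 * ratio x - ratio1 x * (24 * x + 8 + 10 * ratio x)) / (4 * x * (4 * x + 1)) *
      (x * x))
      with (x * ((4 + 8 * ratio x - ratio1 x * (24 * x + 8 + 10 * ratio x)) / (4 * (4 * x + 1))))
        by (field; lra).
    rewrite (Rmult_comm 13). apply Rmult_le_compat_l; [ lra | ].
    apply Rmult_le_reg_r with (4 * (4 * x + 1)); [ lra | ].
    unfold Rdiv. rewrite Rmult_assoc, Rinv_l by lra.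
    assert (0 < ratio1 x * (24 * x + 8 + 10 * ratio x)) by (apply Rmult_lt_0_compat; lra). lra. }
  lra.
Qed.

(** * Boundary values on the cut *)

Lemma strict_chord (f f1 f2 : R -> R) :
  (forall x, 0 < x -> is_derive f x (f1 x)) -> (forall x, 0 < x -> is_derive f1 x (f2 x)) ->
  (forall x, 0 < x -> f2 x < 0) ->
  forall x y z, 0 < x -> x < y < z -> f x * (z - y) + f z * (y - x) < f y * (z - x).
Proof.
  intros H1 H2 H3 x y z Hx Hy.
  destruct (MVT_cor2 f f1 x y) as (c1 & E1 & C1);
    [ lra | intros; apply is_derive_Reals, H1; lra | ].
  destruct (MVT_cor2 f f1 y z) as (c2 & E2 & C2);
    [ lra | intros; apply is_derive_Reals, H1; lra | ].
  assert (L : f1 c2 < f1 c1).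
  { apply (decreasing_of_derive f1 f2); [ lra | intros; apply H2; lra | intros; apply H3; lra ]. }
  assert (P : (f z - f y) * (y - x) < (f y - f x) * (z - y)).
  { rewrite E1, E2.
    replace (f1 c2 * (z - y) * (y - x)) with (f1 c2 * ((z - y) * (y - x))) by ring.
    replace (f1 c1 * (y - x) * (z - y)) with (f1 c1 * ((z - y) * (y - x))) by ring.
    apply Rmult_lt_compat_r; [ apply Rmult_lt_0_compat; lra | exact L ]. }
  nra.
Qed.

(** Along a ray starting at a point of positivity, a concave function changes sign at most
    once, and it then has the sign of 1 - u y, where 1 / u is the zero. *)
Lemma concave_ray (g : R -> R) (D : R -> Prop) : (forall x y, 0 <= x <= y -> D y -> D x) ->
  (forall y, D y -> continuity_pt g y) ->
  (forall x y z, 0 <= x -> x < y < z -> D z -> g x * (z - y) + g z * (y - x) < g y * (z - x)) ->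
  0 < g 0 -> exists u, 0 <= u /\ forall y, 0 <= y -> D y -> 0 <= (1 - u * y) * g y.
Proof.
  intros HD Cg chord Hg0.
  destruct (classic (exists x, 0 < x /\ D x /\ g x < 0)) as [(x & Hx & Dx & Hgx) | N].
  - destruct (IVT_interv (fun y => - g y) 0 x) as (b & Hb & Eb); [ | assumption | lra | lra | ].
    { intros a Ha. apply continuity_pt_opp, Cg, HD with x; assumption. }
    assert (Gb : g b = 0) by lra.
    assert (pb : 0 < b) by (destruct (Req_dec 0 b) as [E | ]; [ subst; lra | lra ]).
    exists (/ b). assert (P := Rinv_0_lt_compat b pb). split; [ lra | ]. intros y Hy Dy.
    replace ((1 - / b * y) * g y) with (/ b * ((b - y) * g y)) by (field; lra).
    apply Rmult_le_pos; [ lra | ].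
    destruct (Rtotal_order y b) as [L | [-> | G]].
    + apply Rmult_le_pos; [ lra | ]. destruct Hy as [Hy | <-]; [ | lra ].
      assert (C := chord 0 y b (Rle_refl 0) ltac:(lra) ltac:(apply HD with x; [ lra | exact Dx ])).
      rewrite Gb in C. nra.
    + rewrite Gb. lra.
    + assert (C := chord 0 b y (Rle_refl 0) ltac:(lra) Dy). rewrite Gb in C.
      assert (0 < g 0 * (y - b)) by (apply Rmult_lt_0_compat; lra).
      assert (g y < 0) by nra. nra.
  - exists 0. split; [ lra | ]. intros y Hy Dy.
    replace ((1 - 0 * y) * g y) with (g y) by ring.
    apply Rnot_lt_le. intros L. apply N. exists y. destruct Hy as [Hy | <-]; [ auto | lra ].
Qed.

(** The set where f > 0 is an interval, so a product of at most two linear factors has the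
    sign of f. If that set is empty, -1 will do. *)
Lemma concave_sign (f f1 f2 : R -> R) :
  (forall x, 0 < x -> is_derive f x (f1 x)) -> (forall x, 0 < x -> is_derive f1 x (f2 x)) ->
  (forall x, 0 < x -> f2 x < 0) ->
  exists q0 q1 q2, (forall h, 0 < h -> 0 <= (q0 + q1 * h + q2 * (h * h)) * f h) /\
    exists h, 0 < h /\ 0 < (q0 + q1 * h + q2 * (h * h)) * f h.
Proof.
  intros H1 H2 H3. assert (chord := strict_chord f f1 f2 H1 H2 H3).
  assert (Cf : forall x, 0 < x -> continuity_pt f x).
  { intros x Hx. apply is_derive_continuity with (f1 x). now apply H1. }
  destruct (classic (exists p, 0 < p /\ 0 < f p)) as [(p & Hp & Hfp) | N].
  - destruct (concave_ray (fun y => f (p + y)) (fun y => - p < y)) as (u & Hu & U).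
    + intros; lra.
    + intros y Hy. apply (continuity_pt_comp (fun y => p + y) f); [ | apply Cf; lra ].
      apply continuity_pt_plus; [ apply continuity_pt_const; intros a b;
        reflexivity | apply continuity_pt_id ].
    + intros x y z Hx Hy _. assert (C := chord (p + x) (p + y) (p + z) ltac:(lra) ltac:(lra)).
      replace (p + z - (p + y)) with (z - y) in C by ring.
      replace (p + y - (p + x)) with (y - x) in C by ring.
      replace (p + z - (p + x)) with (z - x) in C by ring. exact C.
    + now rewrite Rplus_0_r.
    + destruct (concave_ray (fun y => f (p - y)) (fun y => y < p)) as (v & Hv & V).
      * intros; lra.
      * intros y Hy. apply (continuity_pt_comp (fun y => p - y) f); [ | apply Cf; lra ].
        apply continuity_pt_minus; [ apply continuity_pt_const; intros a b;
          reflexivity | apply continuity_pt_id ].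
      * intros x y z Hx Hy Hz. assert (C := chord (p - z) (p - y) (p - x) ltac:(lra) ltac:(lra)).
        replace (p - x - (p - y)) with (y - x) in C by ring.
        replace (p - y - (p - z)) with (z - y) in C by ring.
        replace (p - x - (p - z)) with (z - x) in C by ring. lra.
      * now rewrite Rminus_0_r.
      * exists ((1 + u * p) * (1 - v * p)), ((1 + u * p) * v - u * (1 - v * p)), (- (u * v)).
        assert (E : forall h, ((1 + u * p) * (1 - v * p) + ((1 + u * p) * v - u * (1 - v * p)) * h
          + - (u * v) * (h * h)) * f h
          = (1 - u * (h - p)) * (1 - v * (p - h)) * f h) by (intros; ring).
        split.
        -- intros h Hh. rewrite E. destruct (Rle_lt_dec p h) as [L | L].
           ++ specialize (U (h - p) ltac:(lra) ltac:(lra)).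
              replace (p + (h - p)) with h in U by ring.
              replace ((1 - u * (h - p)) * (1 - v * (p - h)) * f h)
                with ((1 - v * (p - h)) * ((1 - u * (h - p)) * f h)) by ring.
              apply Rmult_le_pos; [ nra | exact U ].
           ++ specialize (V (p - h) ltac:(lra) ltac:(lra)).
              replace (p - (p - h)) with h in V by ring.
              rewrite Rmult_assoc. apply Rmult_le_pos; [ nra | exact V ].
        -- exists p. split; [ assumption | ]. rewrite E.
           replace ((1 - u * (p - p)) * (1 - v * (p - p)) * f p) with (f p) by ring. exact Hfp.
  - assert (M : forall h, 0 < h -> f h <= 0).
    { intros h Hh. apply Rnot_lt_le. intros L. apply N. now exists h. }
    exists (-1), 0, 0.
    assert (E : forall h, (-1 + 0 * h + 0 * (h * h)) * f h = - f h) by (intros; ring).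
    split; [ intros h Hh; rewrite E; specialize (M h Hh); lra | ].
    assert (C := chord 1 2 3 ltac:(lra) ltac:(lra)). assert (M2 := M 2 ltac:(lra)).
    destruct (Rlt_dec (f 1) 0) as [L | L].
    + exists 1. split; [ lra | ]. rewrite E. lra.
    + exists 3. split; [ lra | ]. rewrite E. assert (M1 := M 1 ltac:(lra)). nra.
Qed.

(** A multiple of ratio plus a linear function is strictly concave or strictly convex, or
    it is a polynomial and its own multiplier. *)
Lemma sign_poly (c0 c1 c2 : R) : ~ (c0 = 0 /\ c1 = 0 /\ c2 = 0) ->
  exists q0 q1 q2, (forall h, 0 < h -> 0 <= (q0 + q1 * h + q2 * (h * h)) * (c0
    + c1 * h - c2 * ratio h)) /\
    exists h, 0 < h /\ 0 < (q0 + q1 * h + q2 * (h * h)) * (c0 + c1 * h - c2 * ratio h).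
Proof.
  intros Hc.
  assert (D : forall k, (forall x, 0 < x -> is_derive (fun h => k * (c0 + c1 * h - c2 * ratio h)) x
    (k * (c1 - c2 * ratio1 x))) /\
    (forall x, 0 < x -> is_derive (fun x => k * (c1 - c2 * ratio1 x)) x (- (k * c2) * ratio2 x))).
  { intros k. split; intros x Hx.
    - assert (D := ratio_derive x Hx). fold (ratio1 x) in D.
      auto_derive; [ now exists (ratio1 x) | ].
      rewrite (is_derive_unique (fun x : R => ratio x : R) _ _ D). ring.
    - assert (D := ratio1_derive x Hx). auto_derive; [ now exists (ratio2 x) | ].
      rewrite (is_derive_unique (fun x : R => ratio1 x : R) _ _ D). ring. }
  destruct (Rtotal_order c2 0) as [L | [E | G]].
  - destruct (D 1) as [D1 D2].
    destruct (concave_sign _ _ _ D1 D2) as (q0 & q1 & q2 & H1 & (h & Hh & H2)).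
    { intros x Hx. assert (P := ratio2_neg x Hx). nra. }
    exists q0, q1, q2. split; [ | exists h; split; [ assumption | ] ].
    + intros x Hx. specialize (H1 x Hx). rewrite Rmult_1_l in H1. exact H1.
    + rewrite Rmult_1_l in H2. exact H2.
  - subst c2. exists c0, c1, 0. split.
    + intros h Hh. replace ((c0 + c1 * h + 0 * (h * h)) * (c0 + c1 * h - 0 * ratio h))
        with (Rsqr (c0 + c1 * h)) by (unfold Rsqr; ring).
      apply Rle_0_sqr.
    + assert (H : exists h, 0 < h /\ c0 + c1 * h <> 0).
      { destruct (Req_dec (c0 + c1 * 1) 0) as [E1 | N1]; [ | exists 1; lra ].
        exists 2. split; [ lra | ]. intros E2. apply Hc. repeat split; lra. }
      destruct H as (h & Hh & N). exists h. split; [ assumption | ].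
      replace ((c0 + c1 * h + 0 * (h * h)) * (c0 + c1 * h - 0 * ratio h)) with (Rsqr (c0 + c1 * h))
        by (unfold Rsqr; ring).
      now apply Rsqr_pos_lt.
  - destruct (D (-1)) as [D1 D2].
    destruct (concave_sign _ _ _ D1 D2) as (q0 & q1 & q2 & H1 & (h & Hh & H2)).
    { intros x Hx. assert (P := ratio2_neg x Hx). nra. }
    exists (- q0), (- q1), (- q2).
    assert (E : forall x, (- q0 + - q1 * x + - q2 * (x * x)) * (c0 + c1 * x - c2 * ratio x) =
        (q0 + q1 * x + q2 * (x * x)) * (-1 * (c0 + c1 * x - c2 * ratio x))) by (intros; ring).
    split; [ | exists h; split; [ assumption | ] ].
    + intros x Hx. rewrite E. now apply H1.
    + rewrite E. exact H2.
Qed.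

Lemma CsqrtL_neg (a : R) : 0 <= a -> CsqrtL (RtoC (- a)) = (0, - sqrt a).
Proof.
  intros Ha. unfold CsqrtL. rewrite Cmod_R, Rabs_Ropp, Rabs_pos_eq by assumption. simpl.
  apply injective_projections; simpl.
  - replace ((a + - a) / 2) with 0 by field. apply sqrt_0.
  - f_equal. f_equal. field.
Qed.

Lemma CsqrtL_nonneg (a : R) : 0 <= a -> CsqrtL (RtoC a) = RtoC (sqrt a).
Proof.
  intros Ha. unfold CsqrtL. rewrite Cmod_R, Rabs_pos_eq by assumption. simpl.
  apply injective_projections; simpl.
  - f_equal. field.
  - replace ((a - a) / 2) with 0 by field. rewrite sqrt_0. ring.
Qed.

Lemma radicand_real (h r t : R) : r * r = 1 + 4 * h -> radicand (RtoC h) t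
  = RtoC (1 - r * cos t * (r * cos t)).
Proof.
  intros E. unfold radicand. rewrite <- RtoC_mult, <- RtoC_plus, <- RtoC_mult, <- RtoC_minus.
  f_equal. rewrite <- E. ring.
Qed.

(** For r cos t > 1 the second root sqrt (1 - r cos t) becomes - i sqrt (r cos t - 1), and
    otherwise everything is real, in accordance with sqrt being 0 on negative numbers. *)
Lemma Im_fun_on_cut (h r t : R) : 1 < r -> r * r = 1 + 4 * h -> 0 <= cos t ->
  Im (per0_fun CsqrtL (RtoC h) t) = 2 / r * (cos t * sqrt (r * cos t - 1)) /\
  Im (per2_fun CsqrtL (RtoC h) t) = - (sin t * sin t * sqrt (r * cos t - 1)).
Proof.
  intros Hr Er Hc. unfold per0_fun, per2_fun, root_sum. rewrite (radicand_real h r t Er).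
  assert (Hrc : 0 <= r * cos t) by nra.
  destruct (Rle_lt_dec (r * cos t) 1) as [L | L].
  - rewrite CsqrtL_nonneg by nra. rewrite <- RtoC_mult, <- RtoC_plus.
    assert (P : 0 < 2 + 2 * sqrt (1 - r * cos t * (r * cos t))).
    { assert (Q := sqrt_pos (1 - r * cos t * (r * cos t))). lra. }
    rewrite CsqrtL_nonneg by lra. assert (P2 := sqrt_lt_R0 _ P).
    rewrite <- RtoC_inv, <- !RtoC_mult by lra. rewrite (sqrt_neg_0 (r * cos t - 1)) by lra.
    simpl. split; ring.
  - set (a := sqrt (1 + r * cos t)). set (b := sqrt (r * cos t - 1)).
    assert (Ea : a * a = 1 + r * cos t) by (apply sqrt_sqrt; lra).
    assert (Eb : b * b = r * cos t - 1) by (apply sqrt_sqrt; lra).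
    assert (Ha : 0 < a) by (apply sqrt_lt_R0; lra). assert (Hb : 0 < b) by (apply sqrt_lt_R0; lra).
    replace (1 - r * cos t * (r * cos t)) with (- ((a * b) * (a * b))).
    2: { transitivity (- ((a * a) * (b * b))); [ ring | rewrite Ea, Eb; ring ]. }
    rewrite CsqrtL_neg by nra. rewrite sqrt_square by nra.
    assert (ES : CsqrtL (RtoC 2 + 2 * ((0, (- (a * b))%R) : C))%C = (a, - b)).
    { rewrite CsqrtL_Csqrt by (simpl; nra). apply Csqrt_unique; [ exact Ha | ].
      apply injective_projections; simpl; lra. }
    rewrite ES. simpl.
    assert (N : a * (a * 1) + - b * (- b * 1) = 2 * r * cos t) by lra. rewrite N.
    assert (0 < cos t) by nra. split; field; lra.
Qed.

Lemma is_derive_asin (x : R) : -1 < x < 1 -> is_derive asin x (/ sqrt (1 - x * x)).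
Proof.
  intros Hx. apply is_derive_Reals.
  assert (D := derive_pt_eq_1 _ _ _ _ (derive_pt_asin x Hx)).
  replace (/ sqrt (1 - x * x)) with (1 / sqrt (1 - x²)) by (unfold Rsqr, Rdiv; ring). exact D.
Qed.

(** The substitution sin (theta / 2) = sqrt n * sin x, which maps [0, PI/2] onto the
    interval where r cos theta >= 1. *)
Definition angle (n x : R) : R := 2 * asin (sqrt n * sin x).
Definition angle_speed (n x : R) : R := 2 * sqrt n * cos x / Delta n x.

Lemma sqrt_parameter_facts (n : R) : 0 < n < 1 / 2 -> 0 < sqrt n /\ sqrt n * sqrt n = n
  /\ sqrt n < 1.
Proof.
  intros Hn. split; [ apply sqrt_lt_R0; lra | split; [ apply sqrt_sqrt; lra | ] ].
  rewrite <- sqrt_1. apply sqrt_lt_1; lra.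
Qed.

Lemma sqrt_parameter_sin_bound (n x : R) : 0 < n < 1 / 2 -> -1 < sqrt n * sin x < 1.
Proof. intros Hn. destruct (sqrt_parameter_facts n Hn) as (H1 & _ & H3). assert (H := SIN_bound x).
nra. Qed.

Lemma angle_derive (n x : R) : 0 < n < 1 / 2 -> is_derive (angle n) x (angle_speed n x).
Proof.
  intros Hn.
  assert (H := sqrt_parameter_sin_bound n x Hn).
  destruct (sqrt_parameter_facts n Hn) as (H1 & H2 & H3).
  assert (D := is_derive_asin _ H).
  destruct (Delta_facts n x ltac:(lra)) as (Q1 & Q2 & Q3).
  assert (E : sqrt (1 - sqrt n * sin x * (sqrt n * sin x)) = Delta n x).
  { unfold Delta. f_equal.
    transitivity (1 - (sqrt n * sqrt n) * (sin x * sin x)); [ ring | now rewrite H2 ]. }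
  rewrite E in D. unfold angle.
  auto_derive; [ now exists (/ Delta n x) | ].
  rewrite (is_derive_unique (fun y : R => asin y : R) _ _ D). unfold angle_speed. field. lra.
Qed.

Lemma angle_speed_continuous (n x : R) : 0 < n < 1 / 2 -> continuous (angle_speed n) x.
Proof.
  intros Hn.
  destruct (Delta_facts n x ltac:(lra)) as (Q1 & Q2 & Q3).
  apply (ex_derive_continuous (V := RN)). unfold angle_speed. unfold Delta in *. auto_derive.
  unfold Rminus in *. repeat split; try assumption; lra.
Qed.

Lemma cos_angle (n x : R) : 0 < n < 1 / 2 -> cos (angle n x) = 1 - 2 * n * (sin x * sin x).
Proof.
  intros Hn. unfold angle. rewrite cos_2a_sin. assert (H := sqrt_parameter_sin_bound n x Hn).
  rewrite sin_asin by lra.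
  destruct (sqrt_parameter_facts n Hn) as (H1 & H2 & H3).
  transitivity (1 - 2 * (sqrt n * sqrt n) * (sin x * sin x)); [ ring | now rewrite H2 ].
Qed.

Lemma sin_angle_sqr (n x : R) : 0 < n < 1 / 2 -> sin (angle n x) * sin (angle n x)
  = 4 * n * (sin x * sin x) * (Delta n x * Delta n x).
Proof.
  intros Hn. assert (H := sin2_cos2 (angle n x)). unfold Rsqr in H.
  rewrite cos_angle in H by assumption.
  destruct (Delta_facts n x ltac:(lra)) as (_ & _ & Q3). rewrite Q3. lra.
Qed.

Lemma angle_ends (n : R) : 0 < n < 1 / 2 -> angle n 0 = 0 /\ 0 <= angle n (PI / 2) <= PI / 2.
Proof.
  intros Hn.
  destruct (sqrt_parameter_facts n Hn) as (H1 & H2 & H3). unfold angle.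
  rewrite sin_0, Rmult_0_r, asin_0, sin_PI2, Rmult_1_r. split; [ ring | ].
  assert (A := asin_bound_lt (sqrt n) ltac:(lra)).
  assert (S := sin_asin (sqrt n) ltac:(lra)).
  assert (P0 : 0 <= asin (sqrt n)).
  { apply Rnot_lt_le. intros L. assert (sin (asin (sqrt n)) < 0)
      by (apply sin_lt_0_var; generalize PI_RGT_0; lra). lra. }
  assert (C := cos_angle n (PI / 2) Hn). unfold angle in C. rewrite sin_PI2, !Rmult_1_r in C.
  split; [ lra | ]. apply Rnot_lt_le. intros L.
  assert (cos (2 * asin (sqrt n)) < 0) by (apply cos_lt_0; generalize PI_RGT_0; lra). lra.
Qed.

(** F vanishes beyond the point where r cos t = 1, that is, beyond angle n (PI / 2). *)
Lemma cut_integral (n : R) (F G : R -> R) (r c : R) : 0 < n < 1 / 2 -> r * (1 - 2 * n) = 1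
  -> (forall t, continuous F t) ->
  (forall t, continuous G t) ->
  (forall t, r * cos t <= 1 -> F t = 0) ->
  (forall x, 0 <= x <= PI / 2 -> angle_speed n x * F (angle n x) = c * G x) ->
  RInt F 0 (PI / 2) = c * RInt G 0 (PI / 2).
Proof.
  intros Hn Hr HF HG H0 HE. destruct (angle_ends n Hn) as (T0 & T1 & T2).
  assert (rp : 0 < r) by nra.
  rewrite <- (RInt_Chasles (V := RCN) F 0 (angle n (PI / 2)) (PI / 2)) by now apply ex_RInt_cont.
  assert (Z : RInt F (angle n (PI / 2)) (PI / 2) = 0).
  { rewrite (RInt_ext F (fun _ => 0)).
    - rewrite RInt_const. unfold scal; simpl; unfold mult; simpl. ring.
    - intros t. rewrite Rmin_left, Rmax_right by lra. intros Ht. apply H0.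
      assert (cos t <= cos (angle n (PI / 2))) by (apply cos_decr_1; generalize PI_RGT_0; lra).
      rewrite cos_angle, sin_PI2 in H by assumption. nra. }
  rewrite Z.
  transitivity (RInt F 0 (angle n (PI / 2))); [ unfold plus; simpl; ring | ].
  rewrite <- T0 at 1.
  rewrite <- (RInt_comp (V := RCN) F (angle n) (angle_speed n) 0 (PI / 2));
    [ | intros; apply HF | intros; split; [ now apply angle_derive
      | now apply angle_speed_continuous ] ].
  rewrite <- (RInt_scal (V := RCN) G) by now apply ex_RInt_cont.
  apply RInt_ext. intros x. rewrite Rmin_left, Rmax_right by (generalize PI_RGT_0; lra). intros Hx.
  apply HE. lra.
Qed.

Lemma Im_per_on_cut (h : R) : 0 < h -> exists K, 0 < K /\
  Im (per0 CsqrtL (RtoC h)) = K /\ Im (per2 CsqrtL (RtoC h)) = - (K * ratio h).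
Proof.
  intros Hh. destruct (ell_parameter_facts h Hh) as (Hn & _ & _).
  set (r := sqrt (1 + 4 * h)).
  assert (Er : r * r = 1 + 4 * h) by (apply sqrt_sqrt; lra).
  assert (Hr : 1 < r) by (rewrite <- sqrt_1 at 1; apply sqrt_lt_1; lra).
  set (n := ell_parameter h) in *.
  assert (rn : r * (1 - 2 * n) = 1) by (unfold n, ell_parameter; fold r; field; lra).
  set (k := sqrt n). assert (Hk : 0 < k) by (apply sqrt_lt_R0; lra).
  set (e := sqrt (r - 1)). assert (He : 0 < e) by (apply sqrt_lt_R0; lra).
  assert (J0 := ell0_pos n Hn).
  assert (Cs : forall t, continuous (fun t => sqrt (r * cos t - 1)) t).
  { intros t. apply (continuous_comp (fun t => r * cos t - 1) sqrt); [ | apply continuous_sqrt ].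
    smooth. }
  assert (sq : forall x, 0 <= x <= PI / 2 -> sqrt (r * (1 - 2 * n * (sin x * sin x)) - 1)
    = e * cos x).
  { intros x Hx. replace (r * (1 - 2 * n * (sin x * sin x)) - 1) with ((r - 1) * (cos x * cos x)).
    - rewrite sqrt_mult by (try lra; apply Rle_0_sqr). rewrite sqrt_square; [ reflexivity | ].
      apply cos_ge_0; generalize PI_RGT_0; lra.
    - rewrite cos4_eq. replace (2 * n) with (1 - / r)
        by (apply Rmult_eq_reg_l with r; [ rewrite Rmult_minus_distr_l, Rinv_r; lra | lra ]).
      field. lra. }
  assert (cpos : forall t, 0 < t < PI / 2 -> 0 <= cos t) by (intros; apply cos_ge_0; lra).
  exists (4 * k * e / r * ell0 n). split.
  { apply Rmult_lt_0_compat; [ | exact J0 ]. apply Rdiv_lt_0_compat; [ | lra ].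
      repeat apply Rmult_lt_0_compat; lra. }
  split.
  - unfold per0, CInt. simpl.
    rewrite (RInt_ext _ (fun t => 2 / r * (cos t * sqrt (r * cos t - 1)))).
    2: { intros t. rewrite Rmin_left, Rmax_right by (generalize PI_RGT_0; lra). intros Ht.
         apply (Im_fun_on_cut h r t Hr Er). now apply cpos. }
    apply (cut_integral n _ (ell0_fun n) r); [ exact Hn | exact rn | | intros;
      apply continuous_section, ell0_fun_continuous_2d; lra | | ].
    + intros t. apply (continuous_scal_r (V := RN)).
      apply (continuous_mult (K := R_AbsRing)); [ apply continuous_cos | apply Cs ].
    + intros t Ht. rewrite sqrt_neg_0 by lra. ring.
    + intros x Hx. rewrite cos_angle, sq by assumption.
      destruct (Delta_facts n x ltac:(lra)) as (Q1 & Q2 & Q3).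
      unfold ell0_fun, angle_speed. fold k. field. lra.
  - unfold per2, CInt. simpl.
    rewrite (RInt_ext _ (fun t => - (sin t * sin t * sqrt (r * cos t - 1)))).
    2: { intros t. rewrite Rmin_left, Rmax_right by (generalize PI_RGT_0; lra). intros Ht.
         apply (Im_fun_on_cut h r t Hr Er). now apply cpos. }
    transitivity (- (8 * n * k * e) * RInt (ell2_fun n) 0 (PI / 2)).
    + apply (cut_integral n _ (ell2_fun n) r);
        [ exact Hn | exact rn | | intros; apply continuous_section, ell2_fun_continuous_2d;
          lra | | ].
      * intros t. apply (continuous_opp (V := RN)).
        apply (continuous_mult (K := R_AbsRing)); [ smooth | apply Cs ].
      * intros t Ht. rewrite sqrt_neg_0 by lra. ring.
      * intros x Hx. rewrite cos_angle, sin_angle_sqr, sq by assumption.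
        destruct (Delta_facts n x ltac:(lra)) as (Q1 & Q2 & Q3).
        unfold ell2_fun, angle_speed. fold k. field. lra.
    + unfold ratio. fold n. fold (ell2 n).
      replace (4 * k * e / r * ell0 n * (2 * n / (1 - 2 * n) * (ell2 n / ell0 n)))
        with (8 * n * k * e * ell2 n * / (r * (1 - 2 * n))) by (field; lra).
      rewrite rn. field.
Qed.

(** * Zeros closed under conjugation *)

Definition holo_DD (f : C -> C) : Prop := forall z, DD z -> holo f z.
Definition real_DD (f : C -> C) : Prop := forall z, DD z -> f (Cconj z) = Cconj (f z).
Definition root_poly (zs : list C) (z : C) : C := fold_right (fun a p => Cmult (Cminus z a) p)
  (RtoC 1) zs.

Lemma DD_conj (z : C) : DD z -> DD (Cconj z).
Proof. intros H [H1 H2]. apply H. destruct z; simpl in *. split; lra. Qed.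

Lemma cont_conj (z : C) : cont Cconj z.
Proof.
  destruct (cont_id z) as [H1 H2]. split; simpl; [ exact H1 | exact (continuous_opp _ _ H2) ].
Qed.

Lemma holo_conj (f : C -> C) (z : C) : holo f (Cconj z) -> holo (fun w => Cconj (f (Cconj w))) z.
Proof.
  intros [phi [Hp L]]. exists (fun w => Cconj (phi (Cconj w))). split.
  - apply (cont_comp (V := CU) (fun w : C => phi (Cconj w)) Cconj); [ | apply cont_conj ].
    apply cont_continuous.
    apply (cont_comp (V := CU) Cconj phi); [ apply cont_continuous, cont_conj | exact Hp ].
  - assert (Cc : continuous (T := CU) (U := CU) Cconj z) by apply cont_continuous, cont_conj.
    assert (L' : locally (T := CU) z
      (fun w => f (Cconj w) = f (Cconj z) + phi (Cconj w) * (Cconj w - Cconj z))%C)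
        by exact (Cc _ L).
    revert L'. apply filter_imp. intros w E.
    rewrite E, Cplus_conj, Cmult_conj, <- Cminus_conj, Cconj_conj. reflexivity.
Qed.

Lemma holo_DD_conj (f : C -> C) : holo_DD f -> holo_DD (fun w => Cconj (f (Cconj w))).
Proof. intros H z Hz. apply holo_conj, H, DD_conj, Hz. Qed.

(** Both functions are continuous at a and b, and these points are limits of other points
    of DD. *)
Lemma agree_off (a b : C) (f g : C -> C) : holo_DD f -> holo_DD g ->
  (forall z, DD z -> z <> a -> z <> b -> f z = g z) -> forall z, DD z -> f z = g z.
Proof.
  intros Hf Hg H z Hz.
  apply Ceq_minus, Cmod_eq_0. apply Rle_antisym; [ | apply Cmod_ge_0 ].
  apply Rnot_lt_le. intros Hpos. set (X := Cmod (f z - g z)) in *.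
  destruct (proj1 (cont_eps f z) (holo_cont _ _ (Hf z Hz)) (X / 2) ltac:(lra)) as [d1 [Hd1 H1]].
  destruct (proj1 (cont_eps g z) (holo_cont _ _ (Hg z Hz)) (X / 2) ltac:(lra)) as [d2 [Hd2 H2]].
  destruct (proj1 (locally_Cmod z _) (locally_DD z Hz)) as [d3 [Hd3 H3]].
  assert (away : forall c : C, exists d, 0 < d /\ forall w, w <> z -> Cmod (w - z) < d -> w <> c).
  { intros c. destruct (Ceq_dec c z) as [-> | N].
    - exists 1. split; [ lra | auto ].
    - exists (Cmod (c - z)). split; [ now apply Cmod_gt_0, Cminus_eq_contra | ].
      intros w _ Hw E. rewrite E in Hw. lra. }
  destruct (away a) as [d4 [Hd4 H4]]. destruct (away b) as [d5 [Hd5 H5]].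
  destruct (below_all (d1 :: d2 :: d3 :: d4 :: d5 :: nil)) as (e1 & He1 & Hle).
  { simpl. intros x Hx. repeat destruct Hx as [<- | Hx]; assumption || contradiction. }
  set (e := e1 / 2). assert (He : 0 < e) by (unfold e; lra).
  assert (le : 2 * e <= d1 /\ 2 * e <= d2 /\ 2 * e <= d3 /\ 2 * e <= d4 /\ 2 * e <= d5).
  { replace (2 * e) with e1 by (unfold e; field). repeat split; apply Hle; simpl; tauto. }
  set (w := (z + RtoC e)%C).
  assert (Ew : (w - z)%C = RtoC e) by (unfold w; ring).
  assert (Dw : Cmod (w - z) = e) by (rewrite Ew; apply Cmod_R_pos; lra).
  assert (Nw : w <> z). { intros E. rewrite E in Dw. replace (z - z)%C with (RtoC 0) in Dw by ring.
    rewrite Cmod_0 in Dw. lra. }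
  assert (E : f w = g w).
  { apply H; [ apply H3 | apply H4; [ assumption | ] | apply H5; [ assumption | ] ]; lra. }
  specialize (H1 w ltac:(lra)). specialize (H2 w ltac:(lra)).
  assert (T : X < X).
  { unfold X at 1. replace (f z - g z)%C with (- (f w - f z) + (g w - g z))%C by (rewrite E; ring).
    apply Rle_lt_trans with (1 := Cmod_triangle _ _). rewrite Cmod_opp. lra. }
  lra.
Qed.

Lemma holo_root_poly (zs : list C) (z : C) : holo (root_poly zs) z.
Proof.
  induction zs as [ | a zs IH ]; [ apply holo_const | ].
  change (holo (fun z => (z - a) * root_poly zs z)%C z). prove_holo.
Qed.

Lemma root_poly_neq0 (zs : list C) (z : C) : ~ In z zs -> root_poly zs z <> RtoC 0.
Proof.
  induction zs as [ | a zs IH ]; simpl; intros H.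
  - intros [= E]. lra.
  - apply Cmult_neq_0; [ apply Cminus_eq_contra; intros E; apply H; now left | apply IH; intros E;
      apply H; now right ].
Qed.

Lemma root_poly_app_cons (l1 l2 : list C) (b z : C) : root_poly (l1 ++ b :: l2) z
  = ((z - b) * root_poly (l1 ++ l2) z)%C.
Proof.
  induction l1 as [ | a l1 IH ]; [ reflexivity | ].
  simpl app. change (((z - a) * root_poly (l1 ++ b :: l2) z)%C
    = ((z - b) * ((z - a) * root_poly (l1 ++ l2) z))%C).
  rewrite IH. ring.
Qed.

Lemma locally_neq (z b : C) : z <> b -> locally (T := CU) z (fun w => w <> b).
Proof.
  intros N. apply locally_Cmod. exists (Cmod (b - z)).
  split; [ apply Cmod_gt_0, Cminus_eq_contra; auto | ].
  intros w Hw E. rewrite E in Hw. lra.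
Qed.

Lemma holo_lin_inv (z b : C) : z <> b -> holo (fun w => / (w - b))%C z.
Proof.
  intros N. apply holo_inv; [ prove_holo | now apply Cminus_eq_contra ].
Qed.

Lemma Cmult_cancel (a x y : C) : a <> RtoC 0 -> (a * x)%C = (a * y)%C -> x = y.
Proof.
  intros N E. transitivity (/ a * (a * x))%C; [ field; assumption | ]. rewrite E. field. assumption.
Qed.

Definition divide_out (f : C -> C) (b v : C) (z : C) : C := if Ceq_dec z b then v else
  (f z * / (z - b))%C.

Lemma divide_out_holo (f : C -> C) (b v : C) (g : C -> C) : holo_DD f ->
  (DD b -> holo g b /\ g b = v /\ locally (T := CU) b (fun w => w <> b -> f w = ((w - b) * g w)%C))
    ->
  holo_DD (divide_out f b v).
Proof.
  intros Hf Hb z Hz. destruct (Ceq_dec z b) as [E | N].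
  - subst z. destruct (Hb Hz) as (H1 & H2 & H3).
    apply holo_ext_loc with g; [ | exact H1 ].
    revert H3. apply filter_imp. intros w Hw. unfold divide_out.
    destruct (Ceq_dec w b) as [E | N]; [ rewrite E; exact H2 | ].
    rewrite (Hw N). field. now apply Cminus_eq_contra.
  - apply holo_ext_loc with (fun w => f w * / (w - b))%C.
    + apply filter_imp with (2 := locally_neq z b N). intros w Hw. unfold divide_out.
      destruct (Ceq_dec w b); [ contradiction | reflexivity ].
    + apply holo_mult; [ now apply Hf | now apply holo_lin_inv ].
Qed.

Lemma divide_out_spec (f : C -> C) (b v z : C) : z <> b -> f z = ((z - b) * divide_out f b v z)%C.
Proof.
  intros N. unfold divide_out. destruct (Ceq_dec z b); [ contradiction | ]. field.
  now apply Cminus_eq_contra.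
Qed.

(** Zeros are extracted one at a time. A real zero a leaves the quotient F / (z - a), again
    real on the real axis. With a nonreal zero a its conjugate b is a zero as well, and F /
    ((z - a) (z - b)) is again symmetric; if b occurs among the remaining zeros it is
    struck off there. Near b the quotient is differentiable, because the conjugate of F =
    (z - a) K at the conjugate points exhibits the factor z - b. The list can only grow,
    and each pair contributes |t - a|^2 > 0 on the real axis. *)
Lemma conj_closure (n : nat) : forall (zs : list C) (F G : C -> C), (length zs <= n)%nat ->
  holo_DD F -> real_DD F -> (forall a, In a zs -> DD a) -> holo_DD G ->
  (forall z, DD z -> F z = (root_poly zs z * G z)%C) ->
  exists (ws : list C) (H : C -> C), (length zs <= length ws)%nat /\
    (forall a, In a ws -> DD a) /\ holo_DD H /\ real_DD H /\
    (forall z, DD z -> F z = (root_poly ws z * H z)%C) /\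
    (forall t : R, Im (root_poly ws (RtoC t)) = 0 /\ (0 <= t -> 0 < Re (root_poly ws (RtoC t)))).
Proof.
  induction n as [ | n IH ]; intros zs F G Hn HF SF Hzs HG E.
  { destruct zs; [ | simpl in Hn; lia ].
    exists nil, F. repeat split; auto; try (simpl; intros; lra); try contradiction.
    intros z _. simpl. ring. }
  destruct zs as [ | a A ].
  { exists nil, F. repeat split; auto; try (simpl; intros; lra); try contradiction.
    intros z _. simpl. ring. }
  assert (Ha : DD a) by (apply Hzs; now left).
  assert (HA : forall c, In c A -> DD c) by (intros c Hc; apply Hzs; now right).
  simpl in Hn.
  set (K := fun z => (root_poly A z * G z)%C).
  assert (HK : holo_DD K) by (intros z Hz; apply holo_mult;
    [ apply holo_root_poly | now apply HG ]).
  assert (EK : forall z, DD z -> F z = ((z - a) * K z)%C).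
  { intros z Hz. rewrite (E z Hz). unfold K. simpl. ring. }
  destruct (Req_dec (Im a) 0) as [Ra | Ra].
  - assert (Ca : Cconj a = a) by (destruct a as [x y]; simpl in Ra; subst y;
      apply injective_projections; simpl; ring).
    assert (SK : real_DD K).
    { intros z Hz.
      rewrite <- (Cconj_conj (K (Cconj z))). f_equal. symmetry.
      apply (agree_off a a K (fun w => Cconj (K (Cconj w)))); auto using holo_DD_conj.
      intros w Hw N _. apply Cmult_cancel with (w - a)%C; [ now apply Cminus_eq_contra | ].
      rewrite <- EK by assumption.
      transitivity (Cconj (F (Cconj w))); [ rewrite SF, Cconj_conj; auto | ].
      rewrite EK by now apply DD_conj.
      rewrite Cmult_conj, Cminus_conj, Cconj_conj, Ca. reflexivity. }
    destruct (IH A K G ltac:(lia) HK SK HA HG (fun z _ => eq_refl)) as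
      (ws & H & W1 & W2 & W3 & W4 & W5 & W6).
    exists (a :: ws), H. split; [ simpl; lia | ]. split.
    { intros c [<- | Hc]; auto. }
    split; [ assumption | ]. split; [ assumption | ]. split.
    + intros z Hz. rewrite (EK z Hz), (W5 z Hz). simpl. unfold root_poly. ring.
    + intros t. destruct (W6 t) as [I1 I2].
      assert (Rn : Re a < 0) by (apply Rnot_le_lt; intros L; apply Ha; now split).
      change (root_poly (a :: ws) (RtoC t)) with ((RtoC t - a) * root_poly ws (RtoC t))%C.
      destruct a as [x y]; simpl in Ra, Rn; subst y.
      destruct (root_poly ws (RtoC t)) as [u v]; simpl in *. subst v.
      split; [ ring | ]. intros Ht. specialize (I2 Ht). nra.
  - set (b := Cconj a).
    assert (Hb : DD b) by now apply DD_conj.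
    assert (nab : a <> b).
    { intros Eab. apply Ra. assert (X := f_equal Im Eab). unfold b in X. simpl in X. unfold Im in *.
        lra. }
    assert (Fb : F b = RtoC 0).
    { unfold b. rewrite SF by assumption. rewrite (EK a Ha).
        replace ((a - a) * K a)%C with (RtoC 0) by ring.
      apply injective_projections; simpl; ring. }
    set (K' := fun w => Cconj (K (Cconj w))).
    assert (HK' : holo_DD K') by now apply holo_DD_conj.
    assert (EK' : forall z, DD z -> F z = ((z - b) * K' z)%C).
    { intros z Hz. transitivity (Cconj (F (Cconj z))); [ rewrite SF, Cconj_conj; auto | ].
      rewrite EK by now apply DD_conj. unfold K'. rewrite Cmult_conj, Cminus_conj, Cconj_conj.
      reflexivity. }
    set (F1 := divide_out K b (K' b * / (b - a))%C).
    assert (HF1 : holo_DD F1).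
    { apply divide_out_holo with (fun w => K' w * / (w - a))%C; [ assumption | ]. intros _.
        split; [ | split ].
      - apply holo_mult; [ now apply HK' | now apply holo_lin_inv; auto ].
      - reflexivity.
      - assert (nba : b <> a) by auto.
        generalize (filter_and _ _ (locally_DD b Hb) (locally_neq b a nba)). apply filter_imp.
        intros w [Dw Nw] _. apply Cmult_cancel with (w - a)%C; [ now apply Cminus_eq_contra | ].
        rewrite <- (EK w Dw), (EK' w Dw). field. now apply Cminus_eq_contra. }
    assert (Kb : K b = RtoC 0).
    { apply Cmult_cancel with (b - a)%C; [ apply Cminus_eq_contra; auto | ].
        rewrite <- EK, Fb by assumption. ring. }
    assert (EF1 : forall z, K z = ((z - b) * F1 z)%C).
    { intros z. destruct (Ceq_dec z b) as [-> | N];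
        [ rewrite Kb; ring | now apply divide_out_spec ]. }
    assert (SF1 : real_DD F1).
    { intros z Hz.
      rewrite <- (Cconj_conj (F1 (Cconj z))). f_equal. symmetry.
      apply (agree_off a b F1 (fun w => Cconj (F1 (Cconj w)))); auto using holo_DD_conj.
      intros w Hw Na Nb. apply Cmult_cancel with ((w - a) * (w - b))%C.
      { apply Cmult_neq_0; now apply Cminus_eq_contra. }
      transitivity (F w); [ rewrite (EK w Hw), EF1; ring | ].
      transitivity (Cconj (F (Cconj w))); [ rewrite SF, Cconj_conj; auto | ].
      rewrite EK by now apply DD_conj. rewrite EF1, !Cmult_conj, !Cminus_conj, !Cconj_conj.
      fold b. replace (Cconj b) with a by (unfold b; now rewrite Cconj_conj). ring. }
    assert (finish : forall A' G', (length A' <= n)%nat -> (S (length A) <= S (S (length A')))%nat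
      ->
       (forall c, In c A' -> DD c) -> holo_DD G'
         -> (forall z, DD z -> F1 z = (root_poly A' z * G' z)%C) ->
       exists (ws : list C) (H : C -> C), (S (length A) <= length ws)%nat /\
        (forall c, In c ws -> DD c) /\ holo_DD H /\ real_DD H /\
        (forall z, DD z -> F z = (root_poly ws z * H z)%C) /\
        (forall t : R, Im (root_poly ws (RtoC t)) = 0
          /\ (0 <= t -> 0 < Re (root_poly ws (RtoC t))))).
    { intros A' G' L1 L2 HA' HG' E'.
      destruct (IH A' F1 G' L1 HF1 SF1 HA' HG' E') as (ws & H & W1 & W2 & W3 & W4 & W5 & W6).
      exists (a :: b :: ws), H. split; [ simpl; lia | ]. split.
      { intros c [<- | [<- | Hc]]; auto. }
      split; [ assumption | ]. split; [ assumption | ]. split.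
      - intros z Hz. rewrite (EK z Hz), EF1, (W5 z Hz). simpl. unfold root_poly. ring.
      - intros t. destruct (W6 t) as [I1 I2].
        change (root_poly (a :: b :: ws) (RtoC t))
          with ((RtoC t - a) * ((RtoC t - b) * root_poly ws (RtoC t)))%C.
        unfold b. destruct a as [x y]; simpl in Ra.
        destruct (root_poly ws (RtoC t)) as [u v]; simpl in *. subst v.
        split; [ ring | ]. intros Ht. specialize (I2 Ht).
        assert (0 < y * y) by (apply Rsqr_pos_lt in Ra; exact Ra). assert (P := Rle_0_sqr (t - x)).
        unfold Rsqr in P.
        replace ((t + - x) * ((t + - x) * u - (0 + - - y) * 0) - (0 + - y) * ((t + - x) * 0
          + (0 + - - y) * u))
          with (((t - x) * (t - x) + y * y) * u) by ring.
        apply Rmult_lt_0_compat; lra. }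
    simpl length.
    destruct (classic (In b A)) as [Ib | Nb].
    + destruct (in_split b A Ib) as (l1 & l2 & EA).
      assert (LA : length A = S (length (l1 ++ l2))) by (rewrite EA, !length_app; simpl; lia).
      apply (finish (l1 ++ l2) G); try lia.
      * intros c Hc. apply HA. rewrite EA. apply in_app_or in Hc. apply in_or_app. simpl. tauto.
      * assumption.
      * apply (agree_off b b F1 (fun z => root_poly (l1 ++ l2) z * G z)%C); [ assumption | | ].
        { intros z Hz. apply holo_mult; [ apply holo_root_poly | now apply HG ]. }
        intros z Hz N _. apply Cmult_cancel with (z - b)%C; [ now apply Cminus_eq_contra | ].
        rewrite <- EF1. unfold K. rewrite EA, root_poly_app_cons. ring.
    + assert (PAb := root_poly_neq0 A b Nb).
      set (G1 := divide_out G b (F1 b * / root_poly A b)%C).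
      apply (finish A G1); try lia; try assumption.
      * apply divide_out_holo with (fun w => F1 w * / root_poly A w)%C; [ assumption | ]. intros _.
        split; [ | split ].
        -- apply holo_mult; [ now apply HF1 | apply holo_inv;
             [ apply holo_root_poly | assumption ] ].
        -- reflexivity.
        -- assert (Ln : locally (T := CU) b (fun w => root_poly A w <> RtoC 0)).
           { destruct (proj1 (cont_eps (root_poly A) b) (holo_cont _ _ (holo_root_poly A b))
               (Cmod (root_poly A b))) as [d [Hd Hw]].
             { now apply Cmod_gt_0. }
             apply locally_Cmod. exists d. split; [ assumption | ]. intros w Hwd E0.
             specialize (Hw w Hwd).
             rewrite E0 in Hw. replace (0 - root_poly A b)%C with (- root_poly A b)%C in Hw by ring.
             rewrite Cmod_opp in Hw. lra. }
           revert Ln. apply filter_imp. intros w Nw N.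
           apply Cmult_cancel with (root_poly A w); [ exact Nw | ].
           transitivity (K w); [ reflexivity | ]. rewrite EF1. field. exact Nw.
      * intros z Hz. destruct (Ceq_dec z b) as [-> | N].
        -- unfold G1, divide_out. destruct (Ceq_dec b b) as [_ | n0]; [ | now elim n0 ]. field.
           exact PAb.
        -- apply Cmult_cancel with (z - b)%C; [ now apply Cminus_eq_contra | ].
           rewrite <- EF1. unfold K. rewrite (divide_out_spec G b (F1 b * / root_poly A b)%C z N).
           fold G1. ring.
Qed.

(** * Growth of the continuation *)

Definition melnikov (c0 c1 c2 k : R) (q : C -> C) (z : C) : C :=
  (RtoC (/ sqrt 2) * (1 + 4 * z) * ((RtoC c0 + RtoC c1 * z) * per0 q z + RtoC c2 * per2 q z
    + RtoC k))%C.

Lemma holo_melnikov (c0 c1 c2 k : R) (z : C) : DD z -> holo (melnikov c0 c1 c2 k Csqrt) z.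
Proof.
  intros Hz. assert (H0 := holo_per0 z Hz). assert (H2 := holo_per2 z Hz). unfold melnikov.
  prove_holo.
Qed.

Lemma CsqrtL_outer (s : C) : 0 <= Re s -> Im s <= 0 -> CsqrtL (RtoC 2 + 2 * s)%C
  = Csqrt (RtoC 2 + 2 * s)%C.
Proof. intros H1 H2. apply CsqrtL_Csqrt. simpl. unfold Im in *. lra. Qed.

Lemma CsqrtL_Re_ge0 (w : C) : 0 <= Re (CsqrtL w).
Proof. simpl. apply sqrt_pos. Qed.

Lemma root_sum_CsqrtL_neq0 (z : C) (t : R) : root_sum CsqrtL z t <> RtoC 0.
Proof.
  unfold root_sum. rewrite CsqrtL_outer by (apply CsqrtL_Re_ge0 || apply CsqrtL_Im).
  apply Csqrt_neq0, slit_outer, CsqrtL_Re_ge0.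
Qed.

Lemma jcont_root_sum_CsqrtL (z : C) (t : R) : jcont (U := CU) (root_sum CsqrtL) z t.
Proof. apply jcont_root_sum; apply cont_CsqrtL. Qed.

Lemma jcont_per0_fun_CsqrtL (z : C) (t : R) : jcont (U := CU) (per0_fun CsqrtL) z t.
Proof. apply jcont_per0_fun; [ apply jcont_root_sum_CsqrtL | apply root_sum_CsqrtL_neq0 ]. Qed.

Lemma jcont_per2_fun_CsqrtL (z : C) (t : R) : jcont (U := CU) (per2_fun CsqrtL) z t.
Proof. assert (H := jcont_root_sum_CsqrtL z t). unfold per2_fun. prove_jcont. Qed.

Lemma cont_melnikov (c0 c1 c2 k : R) (z : C) : cont (melnikov c0 c1 c2 k CsqrtL) z.
Proof.
  assert (H0 : cont (per0 CsqrtL) z).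
  { apply (cont_CInt (U := CU)); [ apply PI2_ge0 | ]. apply filter_forall. intros w t _.
      apply jcont_per0_fun_CsqrtL. }
  assert (H2 : cont (per2 CsqrtL) z).
  { apply (cont_CInt (U := CU)); [ apply PI2_ge0 | ]. apply filter_forall. intros w t _.
      apply jcont_per2_fun_CsqrtL. }
  unfold melnikov. prove_cont.
Qed.

Lemma root_sum_upper (z : C) (t : R) : 0 <= Im z -> root_sum CsqrtL z t = root_sum Csqrt z t.
Proof.
  intros Hz. unfold root_sum.
  assert (HW : Im (radicand z t) <= 0).
  { assert (Q := Rle_0_sqr (cos t)). unfold Rsqr in Q. destruct z as [x y]. simpl in *. nra. }
  rewrite <- (CsqrtL_Csqrt (radicand z t)) by exact HW.
  apply CsqrtL_outer; [ apply CsqrtL_Re_ge0 | apply CsqrtL_Im ].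
Qed.

(** In the upper half plane the radicand lies in the lower one, where both branches agree. *)
Lemma melnikov_upper (c0 c1 c2 k : R) (z : C) : 0 <= Im z -> melnikov c0 c1 c2 k CsqrtL z
  = melnikov c0 c1 c2 k Csqrt z.
Proof.
  intros Hz. unfold melnikov, per0, per2.
  rewrite (CInt_ext (per0_fun CsqrtL z) (per0_fun Csqrt z)),
    (CInt_ext (per2_fun CsqrtL z) (per2_fun Csqrt z)); try apply PI2_ge0; [ reflexivity | | ];
    intros t _; unfold per0_fun, per2_fun; now rewrite root_sum_upper.
Qed.

Lemma pow4_le (a b : R) : 0 <= b -> a * a * (a * a) <= b * b * (b * b) -> a <= b.
Proof.
  intros Hb H. apply Rnot_lt_le. intros L.
  assert (b * b < a * a) by nra. assert (P := Rle_0_sqr b). unfold Rsqr in P. nra.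
Qed.

Lemma Cmod_sqr_CsqrtL (w : C) : Cmod (CsqrtL w) * Cmod (CsqrtL w) = Cmod w.
Proof.
  transitivity (Cmod (Csqrt w) * Cmod (Csqrt w)).
  - unfold Csqrt. destruct Rlt_dec; [ now rewrite Cmod_conj | reflexivity ].
  - rewrite <- Cmod_mult, Csqrt_sqr. reflexivity.
Qed.

(** The fourth power of root_sum is comparable with |radicand|, which is 4 |z| cos^2 t up
    to a bounded error. *)
Lemma root_sum_growth (z : C) (t v : R) : 1 <= Cmod z -> v * v * (v * v) = Cmod z ->
  16 * Cmod z * (cos t * cos t) <= Cmod (root_sum CsqrtL z t) * Cmod (root_sum CsqrtL z t) *
    (Cmod (root_sum CsqrtL z t) * Cmod (root_sum CsqrtL z t)) <= 56 * Cmod z.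
Proof.
  intros Hz Hv. unfold root_sum. rewrite !Cmod_sqr_CsqrtL.
  set (s := CsqrtL (radicand z t)).
  assert (Hs : Cmod s * Cmod s = Cmod (radicand z t)) by apply Cmod_sqr_CsqrtL.
  assert (E := Cmod_sqr (RtoC 2 + 2 * s)). assert (Es := Cmod_sqr s).
  assert (R0 : 0 <= Re s) by apply CsqrtL_Re_ge0.
  assert (C1 := cos4_eq t). assert (C2 := sin2_le1 t).
  set (m := cos t * cos t) in *.
  assert (ReE : Re (RtoC 2 + 2 * s)%C = 2 + 2 * Re s) by (simpl; unfold Re; ring).
  assert (ImE : Im (RtoC 2 + 2 * s)%C = 2 * Im s) by (simpl; unfold Im; ring).
  rewrite ReE, ImE in E.
  assert (W1 : 4 * Cmod z * m - 1 <= Cmod (radicand z t)).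
  { assert (T := Cmod_triangle (- radicand z t) (RtoC (1 - m))).
    rewrite Cmod_opp, Cmod_R, (Rabs_pos_eq (1 - m)) in T by lra.
    assert (EW : (- radicand z t + RtoC (1 - m))%C = (RtoC (4 * m) * z)%C).
    { unfold radicand. fold m. rewrite RtoC_minus, RtoC_mult. ring. }
    rewrite EW, Cmod_mult, Cmod_R, Rabs_pos_eq in T by lra. nra. }
  assert (W2 : Cmod (radicand z t) <= 1 + 4 * Cmod z).
  { assert (EW : radicand z t = (RtoC (1 - m) + - (RtoC (4 * m) * z))%C).
    { unfold radicand. fold m. rewrite RtoC_minus, RtoC_mult. ring. }
    rewrite EW. apply Rle_trans with (1 := Cmod_triangle _ _).
    rewrite Cmod_opp, Cmod_mult, !Cmod_R, !Rabs_pos_eq by lra. nra. }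
  split.
  - nra.
  - assert (Re s <= Cmod s) by (apply Rle_trans with (1 := Rle_abs _), re_le_Cmod).
    assert (0 <= (Cmod s - 1) * (Cmod s - 1)) by (apply Rle_0_sqr).
    rewrite E. nra.
Qed.

(** Here v = |z|^(1/4): per0 = O(1 / v) and per2 = O(v), so the function is O(|z|^2 / v). *)
Lemma melnikov_growth (c0 c1 c2 k : R) : exists K, 0 < K /\ forall (z : C) (v : R), 1 <= Cmod z
  -> 0 < v ->
  v * v * (v * v) = Cmod z -> Cmod (melnikov c0 c1 c2 k CsqrtL z) * v <= K * (Cmod z * Cmod z).
Proof.
  set (S := Rabs c0 + Rabs c1 + Rabs c2 + Rabs k + 1).
  assert (HS : 0 < S) by (generalize (Rabs_pos c0) (Rabs_pos c1) (Rabs_pos c2) (Rabs_pos k);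
    unfold S; lra).
  assert (S2 : 0 < / sqrt 2) by (apply Rinv_0_lt_compat, sqrt_lt_R0; lra).
  exists (/ sqrt 2 * 5 * (12 * S)). split; [ repeat apply Rmult_lt_0_compat; lra | ].
  intros z v Hz Hv Ev.
  assert (v1 : 1 <= v).
  { apply Rnot_lt_le. intros L. assert (v * v < 1) by nra. assert (0 < v * v) by nra. nra. }
  assert (P4 := PI_4). assert (P0 := PI_RGT_0).
  assert (L0 : Cmod (per0 CsqrtL z) <= 4 * (2 / v)).
  { apply Rle_trans with (2 * ((PI / 2 - 0) * (2 / v))).
    - apply CInt_norm; [ lra | | ].
      + intros t _. apply (jcont_section (U := CU)), jcont_per0_fun_CsqrtL.
      + intros t _. destruct (root_sum_growth z t v Hz Ev) as [G _].
        assert (Nb := proj1 (Cmod_gt_0 _) (root_sum_CsqrtL_neq0 z t)).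
        assert (C1 := cos4_eq t). assert (C2 := sin2_le1 t).
        unfold per0_fun. rewrite Cmod_mult, Cmod_inv, Cmod_R, Rabs_pos_eq
          by (try apply root_sum_CsqrtL_neq0; lra).
        set (b := Cmod (root_sum CsqrtL z t)) in *. set (m := cos t * cos t) in *.
        assert (X : 2 * m * v <= b).
        { apply pow4_le; [ lra | ]. apply Rle_trans with (2 := G). rewrite <- Ev.
          replace (2 * m * v * (2 * m * v) * (2 * m * v * (2 * m * v)))
            with (16 * (v * v * (v * v)) * (m * m * (m * m))) by ring.
          apply Rmult_le_compat_l; [ nra | ].
          assert (m * m <= m) by nra. assert (m * m * (m * m) <= m * m) by nra. lra. }
        apply Rmult_le_reg_r with (b * v); [ nra | ].
        replace (4 * m * / b * (b * v)) with (2 * (2 * m * v)) by (field; lra).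
        replace (2 / v * (b * v)) with (2 * b) by (field; lra). lra.
    - assert (0 < 2 / v) by (apply Rdiv_lt_0_compat; lra). nra. }
  assert (L2 : Cmod (per2 CsqrtL z) <= 4 * (3 * v)).
  { apply Rle_trans with (2 * ((PI / 2 - 0) * (3 * v))).
    - apply CInt_norm; [ lra | | ].
      + intros t _. apply (jcont_section (U := CU)), jcont_per2_fun_CsqrtL.
      + intros t _. destruct (root_sum_growth z t v Hz Ev) as [_ G].
        assert (C2 := sin2_le1 t).
        unfold per2_fun. rewrite Cmod_mult, Cmod_R, Rabs_pos_eq by lra.
        set (b := Cmod (root_sum CsqrtL z t)) in *.
        assert (0 <= b) by apply Cmod_ge_0.
        assert (X : b <= 3 * v).
        { apply pow4_le; [ lra | ]. apply Rle_trans with (1 := G). rewrite <- Ev.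
          assert (0 <= v * v * (v * v)) by nra. nra. }
        nra.
    - nra. }
  set (Z := Cmod z) in *.
  assert (vv : v * v <= Z). { rewrite <- Ev. assert (1 <= v * v) by nra. nra. }
  assert (vZ : v <= Z) by nra.
  unfold melnikov. rewrite !Cmod_mult, Cmod_R, (Rabs_pos_eq (/ sqrt 2)) by lra.
  assert (M1 : Cmod (1 + 4 * z) <= 5 * Z).
  { apply Rle_trans with (1 := Cmod_triangle _ _). rewrite Cmod_mult, !Cmod_R, !Rabs_pos_eq by lra.
      fold Z. lra. }
  set (X := Cmod ((RtoC c0 + RtoC c1 * z) * per0 CsqrtL z + RtoC c2 * per2 CsqrtL z + RtoC k)).
  assert (HX : X * v <= 12 * S * Z).
  { assert (T1 : X <= Cmod (RtoC c0 + RtoC c1 * z) * Cmod (per0 CsqrtL z)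
      + Rabs c2 * Cmod (per2 CsqrtL z) + Rabs k).
    { unfold X. eapply Rle_trans; [ apply Cmod_triangle | ]. rewrite Cmod_R.
        apply Rplus_le_compat_r.
      eapply Rle_trans; [ apply Cmod_triangle | ]. rewrite !Cmod_mult, Cmod_R. lra. }
    assert (T2 : Cmod (RtoC c0 + RtoC c1 * z) <= (Rabs c0 + Rabs c1) * Z).
    { eapply Rle_trans; [ apply Cmod_triangle | ]. rewrite Cmod_mult, !Cmod_R. fold Z.
      assert (P := Rabs_pos c0). nra. }
    assert (T3 : Cmod (RtoC c0 + RtoC c1 * z) * Cmod (per0 CsqrtL z)
      <= (Rabs c0 + Rabs c1) * Z * (4 * (2 / v)))
      by (apply Rmult_le_compat; try apply Cmod_ge_0; assumption).
    assert (T4 : Rabs c2 * Cmod (per2 CsqrtL z) <= Rabs c2 * (4 * (3 * v)))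
      by (apply Rmult_le_compat_l; [ apply Rabs_pos | assumption ]).
    apply Rle_trans with (((Rabs c0 + Rabs c1) * Z * (4 * (2 / v)) + Rabs c2 * (4 * (3 * v))
      + Rabs k) * v).
    { apply Rmult_le_compat_r; lra. }
    replace (((Rabs c0 + Rabs c1) * Z * (4 * (2 / v)) + Rabs c2 * (4 * (3 * v)) + Rabs k) * v)
      with ((Rabs c0 + Rabs c1) * (8 * Z) + Rabs c2 * (12 * (v * v)) + Rabs k * v) by (field; lra).
    assert (Q0 := Rabs_pos c0). assert (Q1 := Rabs_pos c1). assert (Q2 := Rabs_pos c2).
    assert (Q3 := Rabs_pos k).
    assert (Rabs c2 * (12 * (v * v)) <= Rabs c2 * (12 * Z)) by (apply Rmult_le_compat_l; lra).
    assert (Rabs k * v <= Rabs k * Z) by (apply Rmult_le_compat_l; lra).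
    unfold S. nra. }
  assert (X0 : 0 <= X) by apply Cmod_ge_0.
  replace (/ sqrt 2 * Cmod (1 + 4 * z) * X * v) with (/ sqrt 2 * (Cmod (1 + 4 * z) * (X * v)))
    by ring.
  replace (/ sqrt 2 * 5 * (12 * S) * (Z * Z)) with (/ sqrt 2 * (5 * Z * (12 * S * Z))) by ring.
  apply Rmult_le_compat_l; [ lra | ]. apply Rmult_le_compat; try assumption;
    [ apply Cmod_ge_0 | nra ].
Qed.

(** The term k, which stems from I_1, is real and drops out. *)
Lemma Im_melnikov_on_cut (c0 c1 c2 k : R) (h : R) : 0 < h -> exists K, 0 < K /\
  Im (melnikov c0 c1 c2 k CsqrtL (RtoC h)) = K * (c0 + c1 * h - c2 * ratio h).
Proof.
  intros Hh. destruct (Im_per_on_cut h Hh) as (K & HK & E0 & E2).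
  exists (/ sqrt 2 * (1 + 4 * h) * K). split.
  - apply Rmult_lt_0_compat; [ | exact HK ]. apply Rmult_lt_0_compat; [ | lra ].
    apply Rinv_0_lt_compat, sqrt_lt_R0; lra.
  - unfold melnikov. destruct (per0 CsqrtL (RtoC h)) as [a0 b0].
    destruct (per2 CsqrtL (RtoC h)) as [a2 b2]. simpl in *.
    rewrite E0, E2. ring.
Qed.

Lemma roots_bounded (ws : list C) : exists R0, 1 <= R0 /\ forall a, In a ws -> Cmod a <= R0.
Proof.
  induction ws as [ | a ws (R0 & H1 & H2) ].
  - exists 1. split; [ lra | contradiction ].
  - exists (Rmax R0 (Cmod a)). split; [ apply Rle_trans with (1 := H1), Rmax_l | ].
    intros b [<- | Hb]; [ apply Rmax_r | apply Rle_trans with (2 := Rmax_l _ _); now apply H2 ].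
Qed.

Lemma root_poly_lower (ws : list C) (R0 : R) (z : C) : (forall a, In a ws -> Cmod a <= R0) -> 2 * R0
  <= Cmod z ->
  (Cmod z / 2) ^ length ws <= Cmod (root_poly ws z).
Proof.
  intros Ha Hz. induction ws as [ | a ws IH ].
  - simpl. rewrite Cmod_1. lra.
  - change (root_poly (a :: ws) z) with ((z - a) * root_poly ws z)%C. rewrite Cmod_mult. simpl.
    assert (A := Ha a (or_introl eq_refl)).
    assert (T := Cmod_triangle (z - a) a). replace (z - a + a)%C with z in T by ring.
    assert (P := Cmod_ge_0 z).
    apply Rmult_le_compat; try lra; [ apply pow_le; lra | ].
    apply IH. intros b Hb. apply Ha. now right.
Qed.

(** * Integration over a large half square *)

Lemma rect_int_thin (h : C -> C) (a b e : R) : a <= b -> (forall z, cont h z) -> 0 < e ->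
  exists d, 0 < d <= 1 /\ forall y, 0 < y <= d -> Cmod (rect_int h a b 0 y) <= e.
Proof.
  intros Hab Hh He.
  destruct (cont_on_bounded (fun y => h (a, y)) 0 1) as [Ma HMa];
    [ lra | intros t _; now apply cont_ver | ].
  destruct (cont_on_bounded (fun y => h (b, y)) 0 1) as [Mb HMb];
    [ lra | intros t _; now apply cont_ver | ].
  assert (Pa : 0 <= Ma) by (apply Rle_trans with (2 := HMa 0 ltac:(lra)), Cmod_ge_0).
  assert (Pb : 0 <= Mb) by (apply Rle_trans with (2 := HMb 0 ltac:(lra)), Cmod_ge_0).
  assert (He' : 0 < e / (4 * (b - a + 1))) by (apply Rdiv_lt_0_compat; lra).
  assert (J : forall t, a <= t <= b -> jcont (U := RU) (fun y x => h (x, y)) 0 t).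
  { intros t _. apply (cont_comp (V := CU) (fun p : R * R => (snd p, fst p) : C) h); [ | apply Hh ].
    intros P [r Hr]. exists r. intros [u v] [Hu Hv]. apply Hr. split; assumption. }
  destruct (uniform_param (U := RU) (fun y x => h (x, y)) 0 a b _ He' J) as [d1 Hd1].
  set (d := Rmin (Rmin 1 (d1 / 2)) (e / (4 * (Ma + Mb + 1)))).
  assert (D1 : d <= 1) by (apply Rle_trans with (1 := Rmin_l _ _), Rmin_l).
  assert (D2 : d <= d1 / 2) by (apply Rle_trans with (1 := Rmin_l _ _), Rmin_r).
  assert (D3 : d <= e / (4 * (Ma + Mb + 1))) by apply Rmin_r.
  assert (Pd1 := cond_pos d1).
  assert (D0 : 0 < d) by (repeat apply Rmin_pos; try lra; apply Rdiv_lt_0_compat; lra).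
  exists d. split; [ lra | ]. intros y Hy.
  assert (By : ball (M := R_UniformSpace) 0 d1 y).
  { change (Rabs (y - 0) < d1). rewrite Rminus_0_r, Rabs_pos_eq; lra. }
  specialize (Hd1 y By). simpl in Hd1.
  assert (C0 : cont_on (fun x => h (x, 0)) a b) by (intros t _; now apply cont_hor).
  assert (Cy : cont_on (fun x => h (x, y)) a b) by (intros t _; now apply cont_hor).
  assert (N1 : Cmod (CInt (fun x => h (x, 0) - h (x, y))%C a b)
    <= 2 * ((b - a) * (e / (4 * (b - a + 1))))).
  { apply CInt_norm; [ assumption | | ].
    - intros t Ht. prove_cont.
    - intros t Ht. left. rewrite <- Cmod_opp.
      replace (- (h (t, 0) - h (t, y)))%C with (h (t, y) - h (t, 0))%C by ring. now apply Hd1. }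
  rewrite CInt_minus in N1 by assumption.
  assert (N2 : Cmod (CInt (fun s => h (b, s)) 0 y) <= 2 * ((y - 0) * Mb)).
  { apply CInt_norm; [ lra | intros t _; now apply cont_ver | ]. intros t Ht. apply HMb. lra. }
  assert (N3 : Cmod (CInt (fun s => h (a, s)) 0 y) <= 2 * ((y - 0) * Ma)).
  { apply CInt_norm; [ lra | intros t _; now apply cont_ver | ]. intros t Ht. apply HMa. lra. }
  unfold rect_int.
  replace (CInt (fun x => h (x, 0)) a b + Ci * CInt (fun s => h (b, s)) 0 y - CInt
    (fun x => h (x, y)) a b - Ci * CInt (fun s => h (a, s)) 0 y)%C
    with ((CInt (fun x => h (x, 0)) a b - CInt (fun x => h (x, y)) a b)
      + (Ci * CInt (fun s => h (b, s)) 0 y + - (Ci * CInt (fun s => h (a, s)) 0 y)))%C by ring.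
  apply Rle_trans with (1 := Cmod_triangle _ _).
  assert (T := Cmod_triangle (Ci * CInt (fun s => h (b, s)) 0 y)
    (- (Ci * CInt (fun s => h (a, s)) 0 y))).
  rewrite Cmod_opp, !Cmod_mult, Cmod_Ci in T.
  assert (X1 : 2 * ((b - a) * (e / (4 * (b - a + 1)))) <= e / 2).
  { apply Rmult_le_reg_r with (4 * (b - a + 1)); [ lra | ].
    replace (2 * ((b - a) * (e / (4 * (b - a + 1)))) * (4 * (b - a + 1))) with (2 * (b - a) * e)
      by (field; lra). nra. }
  assert (X2 : 2 * (y * (Ma + Mb)) <= e / 2).
  { apply Rle_trans with (2 * (e / (4 * (Ma + Mb + 1)) * (Ma + Mb))).
    - apply Rmult_le_compat_l; [ lra | ]. apply Rmult_le_compat_r; lra.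
    - apply Rmult_le_reg_r with (4 * (Ma + Mb + 1)); [ lra | ].
      replace (2 * (e / (4 * (Ma + Mb + 1)) * (Ma + Mb)) * (4 * (Ma + Mb + 1)))
        with (2 * (Ma + Mb) * e) by (field; lra). nra. }
  lra.
Qed.

(** On the base continuity suffices, since the integral over a thin rectangle along the
    base tends to 0. *)
Lemma goursat_bottom (h : C -> C) (a b d : R) : a <= b -> 0 < d -> (forall z, cont h z) ->
  (forall z, 0 < Im z -> holo h z) -> rect_int h a b 0 d = RtoC 0.
Proof.
  intros Hab Hd Hc Hh. apply Cmod_eq_0. apply Rle_antisym; [ | apply Cmod_ge_0 ].
  apply Rnot_lt_le. intros Hpos. set (X := Cmod (rect_int h a b 0 d)) in *.
  destruct (rect_int_thin h a b (X / 2) Hab Hc ltac:(lra)) as (d1 & Hd1 & HB).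
  set (y := Rmin d1 d).
  assert (Y1 : y <= d1) by apply Rmin_l. assert (Y2 : y <= d) by apply Rmin_r.
  assert (Y0 : 0 < y) by (apply Rmin_pos; lra).
  specialize (HB y ltac:(lra)).
  assert (E : rect_int h a b 0 d = (rect_int h a b 0 y + rect_int h a b y d)%C).
  { apply rect_int_split_h; [ lra | lra | intros t _; now apply cont_ver | intros t _;
      now apply cont_ver ]. }
  rewrite (goursat h a b y d) in E; [ | lra | lra | intros z [_ Hz]; apply Hh; lra ].
  replace (rect_int h a b 0 y + 0)%C with (rect_int h a b 0 y) in E by ring.
  rewrite <- E in HB. fold X in HB. lra.
Qed.

(** The integral over the base is minus the integral over the other three sides, of total
    length 4 L. *)
Lemma far_sides (h : C -> C) (L m : R) : 0 < L -> (forall z, cont h z) ->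
  (forall z, 0 < Im z -> holo h z) ->
  (forall z, 0 <= Im z -> L <= Cmod z -> Cmod (h z) <= m) ->
  RInt (fun x => Im (h (x, 0))) (- L) L <= 8 * (L * m).
Proof.
  intros L0 Ch Hh far.
  assert (G := goursat_bottom h (- L) L L ltac:(lra) L0 Ch Hh).
  assert (NR : Cmod (CInt (fun y => h (L, y)) 0 L) <= 2 * ((L - 0) * m)).
  { apply CInt_norm; [ lra | intros t _; now apply cont_ver | ]. intros t Ht.
      apply far; [ simpl; lra | ].
    apply Rle_trans with (2 := re_le_Cmod _). simpl. rewrite Rabs_pos_eq; lra. }
  assert (NT : Cmod (CInt (fun x => h (x, L)) (- L) L) <= 2 * ((L - - L) * m)).
  { apply CInt_norm; [ lra | intros t _; now apply cont_hor | ]. intros t Ht.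
      apply far; [ simpl; lra | ].
    apply Rle_trans with (2 := Im_le_Cmod _). simpl. rewrite Rabs_pos_eq; lra. }
  assert (NL : Cmod (CInt (fun y => h (- L, y)) 0 L) <= 2 * ((L - 0) * m)).
  { apply CInt_norm; [ lra | intros t _; now apply cont_ver | ]. intros t Ht.
      apply far; [ simpl; lra | ].
    apply Rle_trans with (2 := re_le_Cmod _). simpl. rewrite Rabs_Ropp, Rabs_pos_eq; lra. }
  assert (BB : CInt (fun x => h (x, 0)) (- L) L =
     (CInt (fun x => h (x, L)) (- L) L + (Ci * CInt (fun y => h ((- L)%R, y)) 0 L
       + - (Ci * CInt (fun y => h (L, y)) 0 L)))%C).
  { unfold rect_int in G.
    transitivity (CInt (fun x => h (x, 0)) (- L) L + Ci * CInt (fun y => h (L, y)) 0 L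
     - CInt (fun x => h (x, L)) (- L) L - Ci * CInt (fun y => h ((- L)%R, y)) 0 L
     + (CInt (fun x => h (x, L)) (- L) L + (Ci * CInt (fun y => h ((- L)%R, y)) 0 L
         + - (Ci * CInt (fun y => h (L, y)) 0 L))))%C; [ ring | ].
    rewrite G. ring. }
  change (Im (CInt (fun x => h (x, 0)) (- L) L) <= 8 * (L * m)).
  apply Rle_trans with (1 := Rle_abs _). apply Rle_trans with (1 := Im_le_Cmod _).
  rewrite BB. apply Rle_trans with (1 := Cmod_triangle _ _).
  assert (T := Cmod_triangle (Ci * CInt (fun y => h ((- L)%R, y)) 0 L)
    (- (Ci * CInt (fun y => h (L, y)) 0 L))).
  rewrite Cmod_opp, !Cmod_mult, Cmod_Ci in T. lra.
Qed.

Lemma RInt_bump (Phi : R -> R) (x0 : R) : 0 < x0 -> (forall x, continuous Phi x) ->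
  (forall x, x <> 0 -> 0 <= Phi x) -> 0 < Phi x0 ->
  exists c b, 0 < c /\ forall L, b <= L -> c <= RInt Phi (- L) L.
Proof.
  intros Hx0 CPhi nonneg Px0.
  destruct (proj1 (filterlim_locally _ _) (CPhi x0) (mkposreal _ Px0)) as [d0 Hd0].
  assert (Pd0 := cond_pos d0).
  set (d := Rmin (d0 / 2) (x0 / 2)).
  assert (D1 : d <= d0 / 2) by apply Rmin_l. assert (D2 : d <= x0 / 2) by apply Rmin_r.
  assert (D0 : 0 < d) by (apply Rmin_pos; lra).
  set (c := RInt Phi (x0 - d) (x0 + d)).
  assert (Pc : 0 < c).
  { apply RInt_gt_0; [ lra | | intros; apply CPhi ]. intros x Hx.
    assert (Bx : ball x0 d0 x) by (change (Rabs (x - x0) < d0); apply Rabs_lt_between; lra).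
    specialize (Hd0 x Bx). change (Rabs (Phi x - Phi x0) < Phi x0) in Hd0.
    apply Rabs_lt_between in Hd0. lra. }
  assert (exPhi : forall a b, ex_RInt Phi a b) by (intros; now apply ex_RInt_cont).
  exists c, (x0 + d). split; [ exact Pc | ]. intros L HL.
    assert (PL : forall a b, a <= b -> (0 <= a \/ b <= 0) -> 0 <= RInt Phi a b).
    { intros a b Hab Hs. apply RInt_ge_0; [ assumption | apply exPhi | ]. intros x Hx. apply nonneg.
        lra. }
    assert (I1 := PL (- L) 0 ltac:(lra) ltac:(lra)).
    assert (I2 := PL 0 (x0 - d) ltac:(lra) ltac:(lra)).
    assert (I3 := PL (x0 + d) L ltac:(lra) ltac:(lra)).
    assert (C1 := RInt_Chasles (V := RCN) Phi (- L) 0 (x0 - d) (exPhi _ _) (exPhi _ _)).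
    assert (C2 := RInt_Chasles (V := RCN) Phi (- L) (x0 - d) (x0 + d) (exPhi _ _) (exPhi _ _)).
    assert (C3 := RInt_Chasles (V := RCN) Phi (- L) (x0 + d) L (exPhi _ _) (exPhi _ _)).
    unfold plus in C1, C2, C3; simpl in C1, C2, C3. fold c in C2. lra.
Qed.

Definition quadratic (q0 q1 q2 : R) (z : C) : C := (RtoC q0 + RtoC q1 * z + RtoC q2 * (z * z))%C.

(** Here w ^ 4 bounds |z| from below. The quotient grows with exponent at most 2 + 7/4 - 5
    = -5/4. *)
Lemma quotient_decay (c0 c1 c2 k q0 q1 q2 : R) (ws : list C) : (5 <= length ws)%nat ->
  exists K R0, 0 < K /\ forall (z y : C) (w : R), 1 <= w -> R0 <= w -> w * w * (w * w) <= Cmod z ->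
    (y * root_poly ws z)%C = (quadratic q0 q1 q2 z * melnikov c0 c1 c2 k CsqrtL z)%C ->
    Cmod y * (w * w * (w * w) * w) <= K.
Proof.
  intros Hlen.
  destruct (melnikov_growth c0 c1 c2 k) as (K & HK & HG).
  destruct (roots_bounded ws) as (R0 & HR0 & HR).
  set (q := Rabs q0 + Rabs q1 + Rabs q2 + 1).
  assert (Pq : 0 < q) by (generalize (Rabs_pos q0) (Rabs_pos q1) (Rabs_pos q2); unfold q; lra).
  exists (32 * q * K), (2 * R0). split; [ repeat apply Rmult_lt_0_compat; lra | ].
  intros z y w Hw HwR Hwz EQ0.
  assert (Hw2 : 2 * R0 <= w * w * (w * w)).
  { assert (w <= w * w) by nra. assert (1 <= w * w) by nra. nra. }
    set (Z := Cmod z) in *.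
    set (v := sqrt (sqrt Z)).
    assert (Zp : 1 <= Z) by lra.
    assert (v2 : v * v = sqrt Z) by (apply sqrt_sqrt, sqrt_pos).
    assert (v4 : v * v * (v * v) = Z) by (rewrite v2; apply sqrt_sqrt; lra).
    assert (v0 : 0 < v) by (apply sqrt_lt_R0, sqrt_lt_R0; lra).
    assert (wv : w <= v) by (apply pow4_le; lra).
    assert (G := HG z v Zp v0 v4). fold Z in G.
    assert (EQ := f_equal Cmod EQ0). rewrite !Cmod_mult in EQ.
    assert (LP := root_poly_lower ws R0 z HR ltac:(unfold Z in *; lra)). fold Z in LP.
    assert (L5 : (Z / 2) ^ 5 <= Cmod (root_poly ws z)).
    { apply Rle_trans with (2 := LP). apply Rle_pow; [ lra | exact Hlen ]. }
    assert (BQ : Cmod (quadratic q0 q1 q2 z) <= q * (Z * Z)).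
    { unfold quadratic. eapply Rle_trans; [ apply Cmod_triangle | ].
      eapply Rle_trans; [ apply Rplus_le_compat_r, Cmod_triangle | ].
      rewrite !Cmod_mult, !Cmod_R. fold Z.
      assert (A0' := Rabs_pos q0). assert (A1' := Rabs_pos q1). assert (A2' := Rabs_pos q2).
      assert (Z <= Z * Z) by nra. unfold q.
      assert (Rabs q1 * Z <= Rabs q1 * (Z * Z)) by (apply Rmult_le_compat_l; lra).
      assert (Rabs q0 * 1 <= Rabs q0 * (Z * Z)) by (apply Rmult_le_compat_l; lra). nra. }
    set (F := Cmod y) in *. assert (F0 : 0 <= F) by apply Cmod_ge_0.
    assert (Z4 : 0 < Z * Z * (Z * Z)) by (repeat apply Rmult_lt_0_compat; lra).
    assert (U : F * (Z / 2) ^ 5 * v <= q * (Z * Z) * (K * (Z * Z))).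
    { apply Rle_trans with (F * Cmod (root_poly ws z) * v).
      - apply Rmult_le_compat_r; [ lra | ]. now apply Rmult_le_compat_l.
      - rewrite EQ, Rmult_assoc. apply Rmult_le_compat; try assumption; [ apply Cmod_ge_0 | ].
        apply Rmult_le_pos; [ apply Cmod_ge_0 | lra ]. }
    assert (U2 : F * (Z * v) <= 32 * q * K).
    { apply Rmult_le_reg_r with (Z * Z * (Z * Z) / 32); [ lra | ].
      replace (F * (Z * v) * (Z * Z * (Z * Z) / 32)) with (F * (Z / 2) ^ 5 * v) by field.
      replace (32 * q * K * (Z * Z * (Z * Z) / 32)) with (q * (Z * Z) * (K * (Z * Z))) by field.
      exact U. }
    apply Rle_trans with (2 := U2). apply Rmult_le_compat_l; [ exact F0 | ].
    apply Rmult_le_compat; lra.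
Qed.

(** With Q from [sign_poly], the imaginary part of Q G over the base of [-L, L] x [0, L]
    has an integral bounded below by a positive constant, whereas the far sides contribute
    O(L ^ (-1/4)). *)
Lemma melnikov_few_zeros (c0 c1 c2 k : R) (ws : list C) (H : C -> C) : ~ (c0 = 0 /\ c1 = 0 /\ c2
  = 0) ->
  (5 <= length ws)%nat -> (forall a, In a ws -> DD a) -> holo_DD H -> real_DD H ->
  (forall z, DD z -> melnikov c0 c1 c2 k Csqrt z = (root_poly ws z * H z)%C) ->
  (forall t : R, Im (root_poly ws (RtoC t)) = 0 /\ (0 <= t -> 0 < Re (root_poly ws (RtoC t))))
    -> False.
Proof.
  intros Hc Hlen Hws HH SH EM HP.
  destruct (sign_poly c0 c1 c2 Hc) as (q0 & q1 & q2 & Hq & (x0 & Hx0 & Hqx0)).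
  set (Q := quadratic q0 q1 q2).
  set (ML := melnikov c0 c1 c2 k CsqrtL).
  (* Q G inside the slit plane, and its boundary value from above on the cut. *)
  set (ft := fun z : C => if excluded_middle_informative (DD z) then (Q z * H z)%C else
    (Q z * ML z * / root_poly ws z)%C).
  assert (Pcut : forall z, ~ DD z -> root_poly ws z <> RtoC 0).
  { intros z Hz. apply root_poly_neq0. intros Hin. apply Hz. now apply Hws. }
  assert (key : forall z, 0 <= Im z -> (ft z * root_poly ws z)%C = (Q z * ML z)%C).
  { intros z Hz. unfold ft. destruct excluded_middle_informative as [D | D].
    - unfold ML. rewrite (melnikov_upper c0 c1 c2 k z Hz), (EM z D). ring.
    - field. now apply Pcut. }
  (* Folding the lower half plane onto the upper one turns the boundary value from above
     into a two-sided continuous function. *)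
  set (up := fun z : C => (Re z, Rabs (Im z)) : C).
  set (h := fun z : C => ft (up z)).
  assert (holoQ : forall z, holo Q z).
  { intros z. unfold Q, quadratic. prove_holo. }
  assert (Cup : forall z, cont up z).
  { intros z. destruct (cont_id z) as [I1 I2]. split; simpl; [ exact I1 | ].
    exact (continuous_comp (fun w : C => Im w) Rabs z I2 (continuous_Rabs _)). }
  assert (upIm : forall z, 0 <= Im (up z)) by (intros; simpl; apply Rabs_pos).
  assert (holoft : forall z, DD z -> holo ft z).
  { intros z Hz. apply holo_ext_loc with (fun w => Q w * H w)%C.
    - apply filter_imp with (2 := locally_DD z Hz). intros w Hw. unfold ft.
      destruct excluded_middle_informative; [ reflexivity | contradiction ].
    - apply holo_mult; [ apply holoQ | now apply HH ]. }
  assert (Ch : forall z, cont h z).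
  { intros z. destruct (classic (DD (up z))) as [D | D].
    - apply (cont_comp (V := CU) up ft); [ apply cont_continuous, Cup | ].
      now apply holo_cont, holoft.
    - assert (CP : cont (fun w => root_poly ws (up w)) z).
      { apply (cont_comp (V := CU) up (root_poly ws));
          [ apply cont_continuous, Cup | apply holo_cont, holo_root_poly ]. }
      assert (Ln : locally (T := CU) z (fun w => root_poly ws (up w) <> RtoC 0)).
      { generalize (cont_locally (U := CU) _ z (Cmod (root_poly ws (up z)))
          (proj1 (Cmod_gt_0 _) (Pcut _ D)) CP).
        apply filter_imp. intros w Hw E. rewrite E in Hw.
        replace (0 - root_poly ws (up z))%C with (- root_poly ws (up z))%C in Hw by ring.
        rewrite Cmod_opp in Hw. lra. }
      apply (cont_ext_loc (fun w => Q (up w) * ML (up w) * / root_poly ws (up w))%C).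
      + revert Ln. apply filter_imp. intros w Nw. unfold h. rewrite <- (key (up w) (upIm w)). field.
        exact Nw.
      + apply (cont_mult (U := CU)); [ | apply (cont_inv (U := CU));
          [ exact CP | now apply Pcut ] ].
        apply (cont_mult (U := CU)).
        * apply (cont_comp (V := CU) up Q); [ apply cont_continuous, Cup | apply holo_cont, holoQ ].
        * apply (cont_comp (V := CU) up ML); [ apply cont_continuous, Cup | apply cont_melnikov ]. }
  assert (Hh : forall z, 0 < Im z -> holo h z).
  { intros z Hz. assert (Dz : DD z) by (intros [E _]; lra).
    apply holo_ext_loc with ft; [ | now apply holoft ].
    apply locally_Cmod. exists (Im z). split; [ assumption | ]. intros w Hw.
    assert (A := Cmod_coords z w).
    unfold h. f_equal. unfold up. rewrite Rabs_pos_eq by lra. now destruct w. }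
  set (Phi := fun x : R => Im (h (x, 0))).
  assert (up0 : forall x, up (x, 0) = RtoC x) by (intros; unfold up; simpl; rewrite Rabs_R0;
    reflexivity).
  assert (CPhi : forall x, continuous Phi x).
  { intros x. destruct (cont_hor h 0 x (Ch _)) as [_ C]. exact C. }
  assert (QR : forall x, Q (RtoC x) = RtoC (q0 + q1 * x + q2 * (x * x))).
  { intros x. unfold Q, quadratic. rewrite !RtoC_plus, !RtoC_mult. reflexivity. }
  assert (neg : forall x, x < 0 -> Phi x = 0).
  { intros x Hx. unfold Phi, h. rewrite up0.
    assert (D : DD (RtoC x)) by (intros [_ E]; simpl in E; lra).
    unfold ft. destruct excluded_middle_informative; [ | contradiction ].
    assert (S := SH _ D). replace (Cconj (RtoC x)) with (RtoC x) in S
      by (apply injective_projections; simpl; ring).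
    rewrite QR. destruct (H (RtoC x)) as [u v]. assert (E := f_equal Im S). simpl in E. simpl.
    assert (v = 0) by lra. subst v. ring. }
  assert (pos : forall x, 0 < x -> exists g, 0 < g /\
     Phi x = g * ((q0 + q1 * x + q2 * (x * x)) * (c0 + c1 * x - c2 * ratio x))).
  { intros x Hx. destruct (Im_melnikov_on_cut c0 c1 c2 k x Hx) as (K & HK & E). fold ML in E.
    destruct (HP x) as [P1 P2]. specialize (P2 ltac:(lra)).
    unfold Phi, h. rewrite up0.
    assert (D : ~ DD (RtoC x)) by (intros D; apply D; simpl; split; lra).
    unfold ft. destruct excluded_middle_informative; [ contradiction | ].
    exists (K / Re (root_poly ws (RtoC x))). split; [ now apply Rdiv_lt_0_compat | ].
    rewrite QR. destruct (root_poly ws (RtoC x)) as [p p']. simpl in P1, P2. subst p'.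
    change ((p, 0) : C) with (RtoC p). rewrite <- RtoC_inv by lra.
    destruct (ML (RtoC x)) as [u v]. simpl in E. subst v. simpl. field. lra. }
  assert (nonneg : forall x, x <> 0 -> 0 <= Phi x).
  { intros x Hx. destruct (Rtotal_order x 0) as [L | [L | L]];
      [ rewrite neg; lra | contradiction | ].
    destruct (pos x L) as (g & Hg & ->). apply Rmult_le_pos; [ lra | now apply Hq ]. }
  assert (Px0 : 0 < Phi x0).
  { destruct (pos x0 Hx0) as (g & Hg & ->). now apply Rmult_lt_0_compat. }
  destruct (RInt_bump Phi x0 Hx0 CPhi nonneg Px0) as (c & b & Pc & lower).
  destruct (quotient_decay c0 c1 c2 k q0 q1 q2 ws Hlen) as (K & R0 & HK & decay).
  (* The far sides contribute at most 8 K / w, and w is chosen to make this less than c. *)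
  set (w := 1 + Rabs b + Rabs R0 + 9 * K / c).
  assert (X : 0 < 9 * K / c) by (apply Rdiv_lt_0_compat; lra).
  assert (Ab := Rabs_pos b). assert (Ar := Rabs_pos R0). assert (Ab' := Rle_abs b).
  assert (Ar' := Rle_abs R0).
  assert (w1 : 1 <= w) by (unfold w; lra).
  set (L := w * w * (w * w)).
  assert (wL : w <= L) by (unfold L; assert (w <= w * w) by nra; assert (1 <= w * w) by nra; nra).
  assert (far : forall z, 0 <= Im z -> L <= Cmod z -> Cmod (h z) <= K / (L * w)).
  { intros z Hz Hl. unfold h.
    assert (E : up z = z) by (unfold up; rewrite Rabs_pos_eq by assumption; now destruct z).
    rewrite E.
    assert (Dz := decay z (ft z) w w1 ltac:(unfold w; lra) Hl (key z Hz)). fold L in Dz.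
    apply Rmult_le_reg_r with (L * w); [ nra | ].
    replace (K / (L * w) * (L * w)) with K by (field; lra). exact Dz. }
  assert (upper := far_sides h L _ ltac:(lra) Ch Hh far). fold Phi in upper.
  assert (lowL := lower L ltac:(unfold w in wL; lra)).
  assert (Z : c * w <= 8 * K).
  { replace (8 * K) with (8 * (L * (K / (L * w))) * w) by (field; lra).
      apply Rmult_le_compat_r; lra. }
  assert (c * (9 * K / c) <= c * w) by (apply Rmult_le_compat_l; unfold w; lra).
  replace (c * (9 * K / c)) with (9 * K) in H0 by (field; lra). lra.
Qed.

Theorem lemma3 (s : side) (lam gam : nat -> R -> R) (M1 : R -> R) (M : C -> C)
  (hlam : forall i : nat, (i <= 9)%nat -> analytic_at_0 (lam i))
  (hgam : forall i : nat, (i <= 9)%nat -> analytic_at_0 (gam i))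
  (hmel : is_first_melnikov s lam gam M1)
  (hM1 : forall h : R, -1/4 < h < 0 ->
    M1 h = (c_0 lam gam + c_1 lam gam * h) * I_ s 0 h
           + alpha_1 lam gam * I_ s 1 h + c_2 lam gam * I_ s 2 h)
  (hnz : exists h : R, -1/4 < h < 0 /\ M1 h <> 0)
  (hM : is_continuation M1 M) :
  at_most_zeros_besides_center 3 M.
Proof.
  destruct hM as [HM HM1].
  set (c0 := c_0 lam gam) in *. set (c1 := c_1 lam gam) in *. set (c2 := c_2 lam gam) in *.
  set (al := alpha_1 lam gam) in *.
  destruct (I_1_eq s) as [k1 Hk1].
  set (k := al * k1).
  assert (holoM : holo_DD M) by (intros z Hz; apply ex_derive_holo, HM, Hz).
  assert (S2 : sqrt 2 <> 0) by (assert (P := sqrt_lt_R0 2); lra).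
  assert (EM : forall z, DD z -> M z = melnikov c0 c1 c2 k Csqrt z).
  { intros z Hz. apply Ceq_minus, Cmod_eq_0.
    rewrite (identity_DD (fun z => M z - melnikov c0 c1 c2 k Csqrt z)%C);
      [ apply Cmod_0 | | | exact Hz ].
    - intros w Hw. apply holo_minus; [ now apply holoM | now apply holo_melnikov ].
    - intros h Hh. rewrite (HM1 h Hh), (hM1 h Hh).
      rewrite !RtoC_plus, !RtoC_mult, (I_0_eq s h Hh), (I_2_eq s h Hh), (Hk1 h Hh).
      unfold melnikov, k. unfold Rdiv. rewrite !RtoC_plus, !RtoC_mult, !RtoC_plus, !RtoC_mult. ring.
      }
  assert (SM : real_DD M).
  { intros z Hz. rewrite <- (Cconj_conj (M (Cconj z))). f_equal. symmetry.
      apply Ceq_minus, Cmod_eq_0.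
    rewrite (identity_DD (fun z => M z - Cconj (M (Cconj z)))%C); [ apply Cmod_0 | | | exact Hz ].
    - intros w Hw. apply holo_minus; [ now apply holoM | now apply (holo_DD_conj M) ].
    - intros h Hh. replace (Cconj (RtoC h)) with (RtoC h)
        by (apply injective_projections; simpl; ring).
      rewrite (HM1 h Hh). apply injective_projections; simpl; ring. }
  intros zs [Hzs (G & HG & EG)].
  assert (holoG : holo_DD G) by (intros z Hz; apply ex_derive_holo, HG, Hz).
  destruct (Nat.le_gt_cases (length zs) 3) as [L | L]; [ exact L | exfalso ].
  destruct (classic (c0 = 0 /\ c1 = 0 /\ c2 = 0)) as [(Z0 & Z1 & Z2) | Hc].
  - destruct zs as [ | a zs ]; [ simpl in L; lia | ].
    assert (Da : DD a) by (apply Hzs; right; now left).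
    (* Now M is K0 (z + 1/4), so a further zero makes K0 vanish. *)
    set (K0 := (RtoC (/ sqrt 2) * RtoC 4 * RtoC k)%C).
    assert (E0 : K0 = ((a - a) * root_poly zs a * G a)%C).
    { apply (agree_off (RtoC (-1/4)) (RtoC (-1/4)) (fun _ => K0)
        (fun z => (z - a) * root_poly zs z * G z)%C); try assumption.
      - intros z _. apply holo_const.
      - intros z Hz. prove_holo. apply holo_root_poly.
      - intros z Hz N _. apply Cmult_cancel with (z - RtoC (-1/4))%C;
          [ now apply Cminus_eq_contra | ].
        transitivity (M z).
        + rewrite (EM z Hz). unfold melnikov, K0. rewrite Z0, Z1, Z2.
          replace (1 + 4 * z)%C with (4 * (z - RtoC (-1/4)))%C; [ ring | ].
          destruct z; apply injective_projections; simpl; field.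
        + rewrite (EG z Hz). simpl. unfold root_poly. ring. }
    replace (a - a)%C with (RtoC 0) in E0 by ring.
    assert (Ek : k = 0).
    { assert (X := f_equal Re E0). unfold K0 in X. simpl in X.
      assert (/ sqrt 2 <> 0) by now apply Rinv_neq_0_compat.
      assert (Y : / sqrt 2 * 4 * k = 0) by lra. apply Rmult_integral in Y. destruct Y; lra. }
    destruct hnz as (h & Hh & N). apply N. rewrite (hM1 h Hh), Z0, Z1, Z2, (Hk1 h Hh).
    replace (al * ((1 + 4 * h) / sqrt 2 * k1)) with ((1 + 4 * h) / sqrt 2 * k) by (unfold k; ring).
    rewrite Ek. ring.
  - destruct (conj_closure _ (RtoC (-1/4) :: zs) M G (le_n _) holoM SM Hzs holoG EG)
      as (ws & H & W1 & W2 & W3 & W4 & W5 & W6).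
    apply (melnikov_few_zeros c0 c1 c2 k ws H); try assumption.
    + simpl in W1. lia.
    + intros z Hz. rewrite <- EM by assumption. now apply W5.
Qed.
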